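(* Let $\zeta\in\mathbb{C}^m$, let $M$ be a finitely generated $\mathcal{O}_\zeta$-module with $\mathrm{depth}_{\mathfrak{m}_\zeta}M>0$, let $p:\mathcal{O}^n_\zeta\rightarrow M$ be an epimorphism of $\mathcal{O}_\zeta$-modules, and let $E$ be a complex Banach space. Then any $\mathcal{O}_\zeta$-homomorphism $\phi:\mathcal{O}^E_\zeta\rightarrow M$ factors through $p$, i.e., $\phi=p\psi$ for some $\mathcal{O}_\zeta$-homomorphism $\psi:\mathcal{O}^E_\zeta\rightarrow\mathcal{O}^n_\zeta$.
   Context: $\mathcal{O}^E_\zeta$ denotes the set of germs at $\zeta\in\mathbb{C}^m$ of holomorphic functions with values in the Banach space $E$; $\mathcal{O}_\zeta=\mathcal{O}^{\mathbb{C}}_\zeta$ is the local ring of scalar holomorphic germs at $\zeta$, $\mathfrak{m}_\zeta$ is its maximal ideal (germs vanishing at $\zeta$), $\mathcal{O}^n_\zeta=\mathcal{O}^{\mathbb{C}^n}_\zeta$, and $\mathcal{O}^E_\zeta$ is an $\mathcal{O}_\zeta$-module. Homomorphisms are purely algebraic. Positivity of depth: for a Noetherian ring $R$, an ideal $I\subset R$ and a finitely generated $R$-module $M$ with $M\neq IM$, $\mathrm{depth}_I M>0$ means that there is an $r\in I$ that is a nonzerodivisor on $M$ and satisfies $rM\neq M$; otherwise $\mathrm{depth}_I M=0$. If $M=IM$ (in particular if $M=0$), $\mathrm{depth}_I M=+\infty$ by convention (so it is positive). (When $m=0$, $\mathcal{O}_\zeta=\mathbb{C}$ and $\mathfrak{m}_\zeta=0$.)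 *)

(* Defs.v *)
From HB Require Import structures.
From mathcomp Require Import all_boot all_order all_algebra.
From mathcomp Require Export complex.
From mathcomp Require Import all_classical all_reals all_analysis.

Set Implicit Arguments.
Unset Strict Implicit.
Unset Printing Implicit Defensive.

Import Order.TTheory GRing.Theory Num.Theory.
Import numFieldNormedType.Exports.

Local Open Scope classical_set_scope.
Local Open Scope quotient_scope.
Local Open Scope ring_scope.

(* [differentiable] is Frechet differentiability over the base field [K], so   *)
(* for [K = R[i]] this is holomorphy on a neighbourhood of [zeta] in [C^m].    *)
Definition holomorphic_at (K : numFieldType) (m : nat) (E : normedModType K)
    (zeta : 'rV[K]_m) (f : 'rV[K]_m -> E) : Prop :=
  \forall z \near zeta, differentiable f z.

Section HolomorphicTheory.
Variables (K : numFieldType) (m : nat) (zeta : 'rV[K]_m).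

Section Scale.
Variable E : normedModType K.

Lemma scale_is_bilinear :
  bilinear_for (GRing.Scale.Law.clone _ _ *:%R _)
    (GRing.Scale.Law.clone _ _ *:%R _) (fun (a : K^o) (v : E) => a *: v).
Proof.
split=> [v|a] c x y /=; first by rewrite scalerDl scalerA.
by rewrite scalerDr !scalerA mulrC.
Qed.

Let scaleE (a : K^o) (v : E) : E := a *: v.
HB.instance Definition _ :=
  bilinear_isBilinear.Build K K^o E E _ _ scaleE scale_is_bilinear.

Lemma differentiable_scale (f : 'rV[K]_m -> K^o) (g : 'rV[K]_m -> E) z :
  differentiable f z -> differentiable g z ->
  differentiable (fun x => f x *: g x) z.
Proof.
move=> df dg.
have -> : (fun x => f x *: g x) =
    (fun p : K^o * E => scaleE p.1 p.2) \o (fun x => (f x, g x)) by [].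
apply: differentiable_comp; first exact: differentiable_pair.
by apply: differentiable_bilin => p; exact: scale_continuous.
Qed.
End Scale.

Variable E : normedModType K.
Implicit Types f g : 'rV[K]_m -> E.

Lemma holomorphic_cst (v : E) : holomorphic_at zeta (fun=> v).
Proof. by near=> z; exact: differentiable_cst. Unshelve. all: by end_near. Qed.

Lemma holomorphicD f g : holomorphic_at zeta f -> holomorphic_at zeta g ->
  holomorphic_at zeta (f \+ g).
Proof. by apply: filterS2 => z; exact: differentiableD. Qed.

Lemma holomorphicN f : holomorphic_at zeta f ->
  holomorphic_at zeta (fun z => - f z).
Proof. by apply: filterS => z; exact: differentiableN. Qed.

Lemma holomorphicZ (a : 'rV[K]_m -> K^o) f :
  holomorphic_at zeta a -> holomorphic_at zeta f ->
  holomorphic_at zeta (fun z => a z *: f z).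
Proof. by apply: filterS2 => z; exact: differentiable_scale. Qed.

End HolomorphicTheory.

Section Germ.
Variables (K : numFieldType) (m : nat) (zeta : 'rV[K]_m) (E : normedModType K).

Definition holo : Type := {f : 'rV[K]_m -> E | `[< holomorphic_at zeta f >]}.
HB.instance Definition _ := Choice.on holo.

Definition Holo f (hf : holomorphic_at zeta f) : holo :=
  exist _ f (introT (asboolP _) hf).

Lemma holoP (f : holo) : holomorphic_at zeta (val f).
Proof. exact/asboolP/(valP f). Qed.

Definition germ_eq (f g : holo) : bool :=
  `[< \forall z \near zeta, val f z = val g z >].

Lemma germ_eq_is_equiv : equiv_class_of germ_eq.
Proof.
split=> [f|f g|g f h].
- by apply/asboolP; near=> z.
- by apply/asboolP/asboolP; apply: filterS => z ->.
- by move=> /asboolP fg /asboolP gh; apply/asboolP; apply: filterS2 fg gh => z -> ->.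
Unshelve. all: by end_near. Qed.

Canonical germ_eq_equiv := EquivRelPack germ_eq_is_equiv.
Canonical germ_eq_encModRel := defaultEncModRel germ_eq.

Definition germ : Type := {eq_quot germ_eq}.
HB.instance Definition _ := Choice.on germ.
HB.instance Definition _ := EqQuotient.on germ.

Definition germ_of f (hf : holomorphic_at zeta f) : germ := \pi_germ (Holo hf).

Lemma germ_ofP f g (hf : holomorphic_at zeta f) (hg : holomorphic_at zeta g) :
  germ_of hf = germ_of hg <-> \forall z \near zeta, f z = g z.
Proof.
split=> [/eqP|fg]; first by rewrite eqmodE => /asboolP.
by apply/eqP; rewrite eqmodE; apply/asboolP.
Qed.

Lemma germ_ind (P : germ -> Prop) :
  (forall f (hf : holomorphic_at zeta f), P (germ_of hf)) -> forall a, P a.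
Proof.
move=> Pf a; rewrite -[a]reprK.
suff -> : repr a = Holo (holoP (repr a)) by exact: Pf.
exact: val_inj.
Qed.

Lemma repr_germ_of f (hf : holomorphic_at zeta f) :
  \forall z \near zeta, val (repr (germ_of hf)) z = f z.
Proof.
have /eqP := reprK (germ_of hf).
by rewrite {2}/germ_of eqmodE => /asboolP.
Qed.

Definition germ_val (a : germ) : E := val (repr a) zeta.

Lemma germ_valE f (hf : holomorphic_at zeta f) : germ_val (germ_of hf) = f zeta.
Proof. exact: nbhs_singleton (repr_germ_of hf). Qed.

Definition germ_zero : germ := germ_of (holomorphic_cst zeta (0 : E)).
Definition germ_opp (a : germ) : germ := germ_of (holomorphicN (holoP (repr a))).
Definition germ_add (a b : germ) : germ :=
  germ_of (holomorphicD (holoP (repr a)) (holoP (repr b))).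

Lemma germ_oppE f (hf : holomorphic_at zeta f) :
  germ_opp (germ_of hf) = germ_of (holomorphicN hf).
Proof.
by apply/germ_ofP; apply: filterS (repr_germ_of hf) => z ->.
Qed.

Lemma germ_addE f g (hf : holomorphic_at zeta f) (hg : holomorphic_at zeta g) :
  germ_add (germ_of hf) (germ_of hg) = germ_of (holomorphicD hf hg).
Proof.
apply/germ_ofP; apply: filterS2 (repr_germ_of hf) (repr_germ_of hg) => z /=.
by move=> -> ->.
Qed.

Lemma eq_germ_of f g (hf : holomorphic_at zeta f) (hg : holomorphic_at zeta g) :
  f =1 g -> germ_of hf = germ_of hg.
Proof.
by move=> fg; apply/germ_ofP; near=> z; exact: fg.
Unshelve. all: by end_near. Qed.

Lemma germ_addA : associative germ_add.
Proof.
elim/germ_ind=> f hf; elim/germ_ind=> g hg; elim/germ_ind=> h hh.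
by rewrite !germ_addE; apply: eq_germ_of => z /=; rewrite addrA.
Qed.

Lemma germ_addC : commutative germ_add.
Proof.
elim/germ_ind=> f hf; elim/germ_ind=> g hg.
by rewrite !germ_addE; apply: eq_germ_of => z /=; rewrite addrC.
Qed.

Lemma germ_add0 : left_id germ_zero germ_add.
Proof.
elim/germ_ind=> f hf.
by rewrite germ_addE; apply: eq_germ_of => z /=; rewrite add0r.
Qed.

Lemma germ_addN : left_inverse germ_zero germ_opp germ_add.
Proof.
elim/germ_ind=> f hf.
by rewrite germ_oppE germ_addE; apply: eq_germ_of => z /=; rewrite addNr.
Qed.

HB.instance Definition _ :=
  GRing.isZmodule.Build germ germ_addA germ_addC germ_add0 germ_addN.

End Germ.

Section GermScale.
Variables (K : numFieldType) (m : nat) (zeta : 'rV[K]_m).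
Local Notation O := (germ zeta K^o).

Definition germ_one : O := germ_of (holomorphic_cst zeta (1 : K^o)).

Section Module.
Variable E : normedModType K.

Definition germ_scale (a : O) (b : germ zeta E) : germ zeta E :=
  germ_of (holomorphicZ (holoP (repr a)) (holoP (repr b))).

Lemma germ_scaleE a f (ha : holomorphic_at zeta a) (hf : holomorphic_at zeta f) :
  germ_scale (germ_of ha) (germ_of hf) = germ_of (holomorphicZ ha hf).
Proof.
apply/germ_ofP; apply: filterS2 (repr_germ_of ha) (repr_germ_of hf) => z /=.
by move=> -> ->.
Qed.

Lemma germ_scale1 : left_id germ_one germ_scale.
Proof.
elim/germ_ind=> f hf.
by rewrite germ_scaleE; apply: eq_germ_of => z /=; rewrite scale1r.
Qed.

Lemma germ_scaleDr : right_distributive germ_scale +%R.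
Proof.
elim/germ_ind=> a ha; elim/germ_ind=> f hf; elim/germ_ind=> g hg.
rewrite -[_ + _]/(germ_add _ _) -[RHS]/(germ_add _ _) !(germ_addE, germ_scaleE).
by apply: eq_germ_of => z /=; rewrite scalerDr.
Qed.

Lemma germ_scaleDl (v : germ zeta E) :
  {morph germ_scale^~ v : a b / a + b}.
Proof.
elim/germ_ind: v => f hf; elim/germ_ind=> a ha; elim/germ_ind=> b hb.
rewrite -[_ + _]/(germ_add _ _) -[RHS]/(germ_add _ _) !(germ_addE, germ_scaleE).
by apply: eq_germ_of => z /=; rewrite scalerDl.
Qed.

End Module.

Lemma germ_scaleA (E : normedModType K) (a b : O) (c : germ zeta E) :
  germ_scale a (germ_scale b c) = germ_scale (germ_scale a b) c.
Proof.
elim/germ_ind: a => a ha; elim/germ_ind: b => b hb; elim/germ_ind: c => f hf.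
rewrite !germ_scaleE; apply: eq_germ_of => z /=.
by rewrite scalerA.
Qed.

Lemma germ_mulC : commutative (@germ_scale K^o).
Proof.
elim/germ_ind=> f hf; elim/germ_ind=> g hg.
rewrite !germ_scaleE; apply: eq_germ_of => z /=.
exact: mulrC.
Qed.

Lemma germ_one_neq0 : germ_one != 0.
Proof.
apply/eqP => /(congr1 (@germ_val _ _ _ _)); rewrite !germ_valE => /eqP.
by rewrite oner_eq0.
Qed.

HB.instance Definition _ := GRing.Zmodule_isComNzRing.Build O
  (@germ_scaleA K^o) germ_mulC (@germ_scale1 K^o)
  (fun a b c => @germ_scaleDl K^o c a b)
  germ_one_neq0.

HB.instance Definition _ (E : normedModType K) :=
  GRing.Zmodule_isLmodule.Build O (germ zeta E)
    (@germ_scaleA E) (@germ_scale1 E) (@germ_scaleDr E)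
    (@germ_scaleDl E).

End GermScale.

Definition maxideal (K : numFieldType) (m : nat) (zeta : 'rV[K]_m) :
  set (germ zeta K^o) := [set a | germ_val a = 0].
Arguments maxideal {K m} zeta.

Section Depth.
Variables (A : comNzRingType) (I : set A) (M : lmodType A).

Definition finitely_generated : Prop :=
  exists (k : nat) (g : 'I_k -> M),
    forall x : M, exists a : 'I_k -> A, x = \sum_(i < k) a i *: g i.

Definition ideal_smul : set M :=
  [set x | exists (k : nat) (a : 'I_k -> A) (v : 'I_k -> M),
     (forall i, I (a i)) /\ x = \sum_(i < k) a i *: v i].

Definition nonzerodivisor_on (r : A) : Prop :=
  forall x : M, r *: x = 0 -> x = 0.

(* The first disjunct is the convention that the depth is +oo if [M = I M].    *)
Definition depth_gt0 : Prop :=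
  ideal_smul = setT \/
  exists r : A, [/\ I r, nonzerodivisor_on r & range (fun x : M => r *: x) <> setT].

End Depth.

(* Main.v *)
(* A power series in m variables is indexed by the integers d whose prime        *)
(* factors are among m fixed primes; germs then correspond to coefficient arrays *)
(* of polynomial growth in d, and products to Dirichlet convolution. Hironaka's  *)
(* division by a submodule K of O^n keeps a bound B w^t on coefficients up to a  *)
(* constant factor, for every large t, and yields a linear normal form nf        *)
(* modulo K that respects the order filtration.                                  *)
(*   Let K be the kernel of p. If M = mM, then M = 0 by Krull's intersection     *)
(* theorem. Otherwise let r in m be a nonzerodivisor on M. Each coefficient of   *)
(* nf vanishes on r^k O^n for k large, and a gliding hump argument along power   *)
(* series in a power of r shows that e |-> nf (phi e), a coefficient of a lift   *)
(* of phi on constant germs, is a bounded functional on E. By a Baire argument   *)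
(* these functionals satisfy a common growth bound, so they are the Taylor       *)
(* coefficients of an operator psi extending to all germs, with phi = p psi on   *)
(* constants. Finally phi - p psi kills constants, hence maps germs into m^k M   *)
(* for all k, hence vanishes.                                                    *)
From HB Require Import structures.
From mathcomp Require Import all_boot all_order all_algebra.
From mathcomp Require Import all_classical all_reals all_analysis.
From mathcomp Require Import ring lra zify.
Require Import Defs.

Set Implicit Arguments.
Unset Strict Implicit.
Unset Printing Implicit Defensive.

Import Order.TTheory GRing.Theory Num.Theory.
Import numFieldNormedType.Exports.
Local Open Scope classical_set_scope.
Local Open Scope ring_scope.

(** * Norms of complex normed spaces *)

(** Write M as the quotient of the free module by the kernel K of [p]. On constant germs a
    factorization must send e to some preimage of phi(e), but an arbitrary choice [lift e] is
    neither linear nor bounded in e. The remedy is a canonical choice: the normal form [nf] of a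
    preimage, i.e. its remainder under division by leading terms of K ([submodule_division]). It is
    complex linear, depends only on phi(e), respects orders, and at most doubles a growth bound with
    large enough exponent.

    Depth enters in showing that every coefficient of e |-> nf (lift e) is bounded, although phi is
    purely algebraic ([lam_lift_bounded]). Such a coefficient [lam] kills the multiples of S = r^N
    for large N. If it were unbounded, one could choose e_k in the unit ball successively, with lam
    (lift e_k) as large as desired. The germ f = sum S^k e_k exists ([germ_series]), and phi f minus
    the image of the k-th partial sum is S^k phi(f_k), where lam of a preimage of phi(f_k) equals
    lam (lift e_k). As S^k is injective on M, [cancel_bound] bounds this number through the growth
    of a single preimage of phi f and the k-th partial sum, both controlled before e_k is chosen: a
    contradiction.

    A Banach-Steinhaus argument ([uniform_bound]) makes the bounds polynomial in the index d of the
    coefficient. So the coefficient operators L_d define psi f = sum_d chi_d L_d(f), which is linear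
    over the germs ([germ_extension]), and phi = p psi on constants.

    Finally phi - p psi is a homomorphism killing constants. By Hadamard's lemma ([germ_hadamard])
    its image P satisfies P <= mP, hence P = 0 by a Krull-type argument ([maxideal_stable_eq0]),
    which also settles the case M = mM.

    The function theory is built up from complex differentiability: Goursat gives Cauchy's estimate,
    hence limits of bounded holomorphic maps are holomorphic ([weierstrass]); Hadamard division
    gives Taylor expansions ([taylor_expands]), and [tau] identifies germs with coefficient arrays
    of polynomial growth. *)

Section RealNorm.
Variable R : realType.
Local Notation C := R[i].

(** Norms over [R[i]] take values in [R[i]], whose order is only partial. Taking real parts moves
    all estimates to the totally ordered field [R]. *)
Definition nm (V : normedZmodType C) (x : V) : R := complex.Re `|x|.

Lemma nmE (V : normedZmodType C) (x : V) : `|x| = (nm x)%:C%C.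
Proof. by rewrite /nm RRe_real// realE normr_ge0. Qed.

Lemma nm_ge0 (V : normedZmodType C) (x : V) : 0 <= nm x.
Proof. by rewrite -ler0c -nmE. Qed.

Lemma nm0 (V : normedZmodType C) : nm (0 : V) = 0.
Proof. by rewrite /nm normr0. Qed.

Lemma nm_eq0 (V : normedZmodType C) (x : V) : (nm x == 0) = (x == 0).
Proof. by rewrite -[x == 0]normr_eq0 nmE (inj_eq (@complexI R)). Qed.

Lemma nmD (V : normedZmodType C) (x y : V) : nm (x + y) <= nm x + nm y.
Proof. by rewrite -lecR rmorphD/= -!nmE ler_normD. Qed.

Lemma nmN (V : normedZmodType C) (x : V) : nm (- x) = nm x.
Proof. by rewrite /nm normrN. Qed.

Lemma nmBC (V : normedZmodType C) (x y : V) : nm (x - y) = nm (y - x).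
Proof. by rewrite /nm distrC. Qed.

Lemma nmB (V : normedZmodType C) (x y : V) : nm (x - y) <= nm x + nm y.
Proof. by rewrite -[nm y]nmN; exact: nmD. Qed.

Lemma nm_sum (V : normedZmodType C) (I : Type) (r : seq I) (P : pred I) (F : I -> V) :
  nm (\sum_(i <- r | P i) F i) <= \sum_(i <- r | P i) nm (F i).
Proof.
elim/big_ind2 : _ => [|x1 x2 y1 y2 h1 h2|//]; first by rewrite nm0.
by rewrite (le_trans (nmD _ _))// lerD.
Qed.

Lemma nmM (a b : C) : nm (a * b) = nm a * nm b.
Proof. by apply: (@complexI R); rewrite rmorphM/= -!nmE normrM. Qed.

Lemma nmX (a : C) n : nm (a ^+ n) = nm a ^+ n.
Proof. by apply: (@complexI R); rewrite rmorphXn/= -!nmE normrX. Qed.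

Lemma nmV (a : C) : nm a^-1 = (nm a)^-1.
Proof. by apply: (@complexI R); rewrite fmorphV/= -!nmE normfV. Qed.

Lemma nm1 : nm (1 : C) = 1.
Proof. by apply: (@complexI R); rewrite -!nmE normr1. Qed.

Lemma nmZ (V : normedModType C) (a : C) (x : V) : nm (a *: x) = nm a * nm x.
Proof. by apply: (@complexI R); rewrite rmorphM/= -!nmE normrZ. Qed.

Lemma nm_real (r : R) : nm (r%:C%C : C) = `|r|.
Proof. by apply: (@complexI R); rewrite -nmE normc_def /= expr0n addr0 sqrtr_sqr. Qed.

Lemma nm_nat n : nm (n%:R : C) = n%:R.
Proof. by rewrite -[n%:R](rmorph_nat (real_complex R)) nm_real normr_nat. Qed.

Lemma nm_i : nm ('i%C : C) = 1.
Proof.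
by apply: (@complexI R); rewrite -nmE normc_def /= expr0n expr1n add0r sqrtr1.
Qed.

Lemma nm_Re (a : C) : `|complex.Re a| <= nm a.
Proof.
rewrite /nm normc_def/= -sqrtr_sqr ler_wsqrtr// lerDl sqr_ge0//.
Qed.

Lemma nm_Im (a : C) : `|complex.Im a| <= nm a.
Proof.
rewrite /nm normc_def/= -sqrtr_sqr ler_wsqrtr// lerDr sqr_ge0//.
Qed.

Lemma nm_nearP (V : normedModType C) (x : V) (P : V -> Prop) :
  (\forall z \near x, P z) <->
  exists2 e : R, 0 < e & forall z, nm (z - x) < e -> P z.
Proof.
split.
  move=> /nbhs_normP[e /= e0 eP]; have er : e \is Num.real by rewrite realE ltW.
  exists (complex.Re e); first by rewrite -ltcR RRe_real.
  by move=> z zx; apply: eP => /=; rewrite distrC nmE -(RRe_real er) ltcR.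
move=> [e e0 eP]; apply/nbhs_normP; exists (e%:C)%C => /=; first by rewrite ltcR.
by move=> z /=; rewrite distrC nmE ltcR; exact: eP.
Qed.

Lemma diff_approx (V W : normedModType C) (f : V -> W) (z : V) :
  differentiable f z -> forall e : R, 0 < e -> exists2 d : R, 0 < d &
  forall h, nm h < d -> nm (f (z + h) - f z - 'd f z h) <= e * nm h.
Proof.
move=> /diff_locallyP[_ /eqaddoP df] e e0.
have e0' : (0 : C) < e%:C%C by rewrite ltcR.
have := df _ e0'; move=> /nm_nearP[d d0 dP]; exists d => // h hd.
have := dP h; rewrite subr0 => /(_ hd).
by rewrite /= !nmE -rmorphM lecR !fctE /cst opprD addrA [h + z]addrC.
Qed.

(** Differentiability includes continuity of the differential, whence the boundedness condition on
    [D]. *)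
Lemma approx_diff (V W : normedModType C) (f : V -> W) (z : V) (D : V -> W) :
  linear D -> (exists K : R, forall h, nm (D h) <= K * nm h) ->
  (forall e : R, 0 < e -> exists2 d : R, 0 < d &
  forall h, nm h < d -> nm (f (z + h) - f z - D h) <= e * nm h) ->
  differentiable f z /\ forall h, 'd f z h = D h.
Proof.
move=> linD [K DK] fD.
pose L : {linear V -> W} := HB.pack D (GRing.isLinear.Build _ _ _ _ D linD).
have cL : continuous L.
  apply/linear_bounded_continuous/linear_boundedP.
  near=> M => x; rewrite !nmE.
  have /RRe_real <- : M \is Num.real by near: M; exact: nbhs_pinfty_real.
  rewrite -rmorphM lecR (le_trans (DK _))// ler_wpM2r ?nm_ge0//.
  have : K%:C%C < M by near: M; apply: nbhs_pinfty_gt; rewrite realE -[0]/(0%:C%C) !lecR le_total.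
  by rewrite ltcE /= => /andP[_ /ltW].
have oL : f \o shift z = cst (f z) + L +o_ 0 id.
  apply/eqaddoP => e e0; have er : e \is Num.real by rewrite realE ltW.
  have e0' : 0 < complex.Re e by rewrite -ltcR RRe_real.
  have [d d0 dP] := fD _ e0'; apply/nm_nearP; exists d => // h.
  rewrite subr0 => /dP; rewrite /= !nmE -(RRe_real er) -rmorphM lecR !fctE /cst.
  by rewrite opprD addrA [h + z]addrC.
have dL : 'd f z = L :> (V -> W) by exact: diff_unique.
split; last by move=> h; rewrite dL.
by apply/diff_locallyP; split; rewrite dL.
Unshelve. all: by end_near. Qed.

End RealNorm.

(** * Completeness in epsilon form *)

Section Completeness.
Variable R : realType.
Local Notation C := R[i].

Definition ncvg (E : normedZmodType C) (u : nat -> E) (l : E) :=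
  forall e : R, 0 < e -> exists n0, forall n, (n0 <= n)%N -> nm (u n - l) <= e.

Definition ncauchy (E : normedZmodType C) (u : nat -> E) :=
  forall e : R, 0 < e -> exists n0, forall n k, (n0 <= n)%N -> (n0 <= k)%N ->
    nm (u n - u k) <= e.

(** A property rather than a structure, so that Banach spaces, the scalars and row vectors are
    treated uniformly. *)
Definition ncomplete (E : normedZmodType C) :=
  forall u : nat -> E, ncauchy u -> exists l, ncvg u l.

Lemma completeNormedMod_ncomplete (E : completeNormedModType C) : ncomplete E.
Proof.
move=> u uc.
have : cvg (u @ \oo).
  apply: cauchy_cvg; apply: cauchy_exP => e e0.
  have er : e \is Num.real by rewrite realE ltW.
  have e0' : 0 < complex.Re e / 2 by rewrite divr_gt0// -ltcR RRe_real.
  have [n0 n0P] := uc _ e0'; exists (u n0).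
  exists n0 => // n /= n0n; rewrite -ball_normE /= nmE -(RRe_real er) ltcR.
  rewrite (le_lt_trans (n0P _ _ _ _))//.
  by rewrite ltr_pdivrMr// ltr_pMr ?ltr1n// -ltcR RRe_real.
move=> /cvg_ex[/= l ul]; exists l => e e0.
have : \forall z \near l, nm (z - l) <= e.
  by apply/nm_nearP; exists e => // z /ltW.
by move=> /ul[n0 _ n0P]; exists n0 => n n0n; exact: n0P.
Qed.

Lemma real_cauchy_cvg (v : nat -> R) :
  (forall e : R, 0 < e -> exists n0, forall n k, (n0 <= n)%N -> (n0 <= k)%N ->
    `|v n - v k| <= e) ->
  exists l, forall e : R, 0 < e -> exists n0, forall n, (n0 <= n)%N ->
    `|v n - l| <= e.
Proof.
move=> uc.
have : cvg (v @ \oo).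
  apply: cauchy_cvg; apply: cauchy_exP => e e0.
  have e0' : 0 < e / 2 by rewrite divr_gt0.
  have [n0 n0P] := uc _ e0'; exists (v n0).
  exists n0 => // n /= n0n; rewrite -ball_normE /=.
  rewrite (le_lt_trans (n0P _ _ _ _))//.
  by rewrite ltr_pdivrMr// ltr_pMr ?ltr1n.
move=> /cvg_ex[/= l ul]; exists l => e e0.
have : \forall z \near l, `|z - l| <= e.
  by apply/nbhs_normP; exists e => // z /= /ltW; rewrite distrC.
by move=> /ul[n0 _ n0P]; exists n0 => n n0n; exact: n0P.
Qed.

Lemma nm_complex_le (a : C) : nm a <= `|complex.Re a| + `|complex.Im a|.
Proof.
rewrite {1}[a]complexE (le_trans (nmD _ _))//.
by rewrite nmM nm_i mul1r !nm_real.
Qed.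

Lemma complex_ncomplete : ncomplete C.
Proof.
move=> u uc.
have [x xP] : exists l, forall e : R, 0 < e -> exists n0, forall n, (n0 <= n)%N ->
    `|complex.Re (u n) - l| <= e.
  apply: real_cauchy_cvg => e /uc[n0 n0P]; exists n0 => n k nn0 kn0.
  by rewrite (le_trans _ (n0P n k _ _))// (le_trans _ (nm_Re _))// !raddfB.
have [y yP] : exists l, forall e : R, 0 < e -> exists n0, forall n, (n0 <= n)%N ->
    `|complex.Im (u n) - l| <= e.
  apply: real_cauchy_cvg => e /uc[n0 n0P]; exists n0 => n k nn0 kn0.
  by rewrite (le_trans _ (n0P n k _ _))// (le_trans _ (nm_Im _))// !raddfB.
exists (x +i* y)%C => e e0.
have e20 : 0 < e / 2 by rewrite divr_gt0.
have [n1 n1P] := xP _ e20; have [n2 n2P] := yP _ e20.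
exists (maxn n1 n2) => n; rewrite geq_max => /andP[nn1 nn2].
rewrite (le_trans (nm_complex_le _))// [leRHS]splitr lerD//.
  by rewrite raddfB/=; exact: n1P.
by rewrite raddfB/=; exact: n2P.
Qed.

Lemma nm_mx_coord m n (x : 'M[C]_(m, n)) i j : nm (x i j) <= nm x.
Proof.
rewrite -lecR -!nmE [leRHS]/Num.norm/= mx_normE -[leLHS]nngE num_le.
exact: (le_bigmax _ (fun ij => `|x ij.1 ij.2|%:nng) (i, j)).
Qed.

Lemma nm_mx_le m n (x : 'M[C]_(m, n)) (B : R) : 0 <= B ->
  (forall i j, nm (x i j) <= B) -> nm x <= B.
Proof.
move=> B0 xB; have B0' : 0 <= B%:C%C by rewrite ler0c.
rewrite -lecR -nmE [leLHS]/Num.norm/= mx_normE.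
rewrite -[leRHS]/((NngNum B0')%:num) num_le; apply/bigmax_leP.
by split => [|[i j] _ /=]; rewrite -num_le//= nmE lecR.
Qed.

Lemma rV_ncomplete m n : ncomplete 'M[C]_(m, n).
Proof.
move=> u uc.
have /choice[l lP] : forall ij : 'I_m * 'I_n, exists l, ncvg (fun n => u n ij.1 ij.2) l.
  move=> ij; apply: complex_ncomplete => e /uc[n0 n0P]; exists n0 => p k pn kn.
  have := nm_mx_coord (u p - u k) ij.1 ij.2; rewrite !mxE => /le_trans; apply.
  exact: n0P.
exists (\matrix_(i, j) l (i, j)) => e e0.
have /choice[n0 n0P] : forall ij : 'I_m * 'I_n, exists n0, forall n, (n0 <= n)%N ->
    nm (u n ij.1 ij.2 - l ij) <= e by move=> ij; exact: lP.
exists (\max_ij n0 ij) => k kn; apply: nm_mx_le; first exact: ltW.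
move=> i j; rewrite !mxE; apply: (n0P (i, j)).
by rewrite (leq_trans _ kn)//; exact: leq_bigmax.
Qed.

End Completeness.

(** * Nested dyadic rectangles *)

Section Bisection.
Variable R : realType.

Lemma half_pow_le (a e : R) : 0 <= a -> 0 < e -> exists k, a / 2 ^+ k <= e.
Proof.
move=> a0 e0; exists (Num.truncn (a / e)).+1.
rewrite ler_pdivrMr ?exprn_gt0// -ler_pdivrMl//.
have : a / e < (Num.truncn (a / e)).+1%:R by rewrite real_truncnS_gt// num_real.
move=> /ltW; rewrite mulrC => /le_trans; apply.
by rewrite -natrX ler_nat ltnW// ltn_expl.
Qed.

Lemma nested_intervals (a : R) (s : nat -> R) : 0 <= a ->
  (forall k, s k <= s k.+1) ->
  (forall k, s k.+1 + a / 2 ^+ k.+1 <= s k + a / 2 ^+ k) ->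
  exists x, forall k, s k <= x <= s k + a / 2 ^+ k.
Proof.
move=> a0 s1 s2.
have smono k n : (k <= n)%N -> s k <= s n.
  by move=> /subnK <-; elim: (n - k)%N => // j /le_trans; apply; exact: s1.
have tmono k n : (k <= n)%N -> s n + a / 2 ^+ n <= s k + a / 2 ^+ k.
  by move=> /subnK <-; elim: (n - k)%N => // j; apply: le_trans; exact: s2.
have ak k : 0 <= a / 2 ^+ k by rewrite divr_ge0// exprn_ge0.
have st k n : s n <= s k + a / 2 ^+ k.
  have [/smono nk|/ltnW/tmono] := leqP n k.
    by rewrite (le_trans nk)// lerDl.
  by apply: le_trans; rewrite lerDl.
have sup_s : has_sup (range s).
  split; first by exists (s 0%N), 0%N.
  by exists (s 0%N + a / 2 ^+ 0) => _ [n _ <-]; exact: st.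
exists (sup (range s)) => k; apply/andP; split.
  by apply: sup_upper_bound => //; exists k.
by apply: sup_le_ub => [|_ [n _ <-]]; [exists (s 0%N), 0%N|exact: st].
Qed.

(** Repeated choice of a half in each direction, with the limit point of the corners. [P k] speaks
    of the corner of a rectangle of sides a/2^k and b/2^k; [b = 0] gives bisection of an
    interval. *)
Lemma bisection (a b s0 t0 : R) (P : nat -> R -> R -> Prop) :
  0 <= a -> 0 <= b -> P 0%N s0 t0 ->
  (forall k s t, P k s t -> exists x y : bool,
     P k.+1 (s + x%:R * (a / 2 ^+ k.+1)) (t + y%:R * (b / 2 ^+ k.+1))) ->
  exists s t, [/\ s0 <= s <= s0 + a, t0 <= t <= t0 + b &
    forall k, exists s' t', [/\ P k s' t', s' <= s <= s' + a / 2 ^+ k &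
                                 t' <= t <= t' + b / 2 ^+ k]].
Proof.
move=> a0 b0 P0 PS.
have /choice[x xP] : forall p : nat * (R * R), exists xy : bool * bool,
    P p.1 p.2.1 p.2.2 -> P p.1.+1 (p.2.1 + xy.1%:R * (a / 2 ^+ p.1.+1))
                               (p.2.2 + xy.2%:R * (b / 2 ^+ p.1.+1)).
  move=> [k [s t]] /=; have [/PS[x [y xyP]]|nP] := pselect (P k s t).
    by exists (x, y).
  by exists (false, false).
pose st := fix st k := if k is k'.+1 then let p := st k' in
  (p.1 + (x (k', p)).1%:R * (a / 2 ^+ k), p.2 + (x (k', p)).2%:R * (b / 2 ^+ k))
  else (s0, t0).
have Pst k : P k (st k).1 (st k).2.
  by elim: k => // k IH; exact: (xP (k, st k) IH).
have step (c : R) k (z : bool) : 0 <= c ->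
    (0 <= z%:R * (c / 2 ^+ k.+1)) /\
    (z%:R * (c / 2 ^+ k.+1) + c / 2 ^+ k.+1 <= c / 2 ^+ k).
  move=> c0; have -> : c / 2 ^+ k = c / 2 ^+ k.+1 + c / 2 ^+ k.+1.
    rewrite exprS invfM mulrCA [2^-1 * _]mulrC -splitr//.
  have h : 0 <= c / 2 ^+ k.+1 by rewrite divr_ge0// exprn_ge0.
  by case: z; rewrite ?mul1r ?mul0r; split=> //; rewrite add0r lerDl.
have [s sP] : exists s, forall k, (st k).1 <= s <= (st k).1 + a / 2 ^+ k.
  apply: nested_intervals => // k /=; have [h1 h2] := step a k (x (k, st k)).1 a0.
    by rewrite lerDl.
  by rewrite -addrA lerD2l.
have [t tP] : exists t, forall k, (st k).2 <= t <= (st k).2 + b / 2 ^+ k.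
  apply: nested_intervals => // k /=; have [h1 h2] := step b k (x (k, st k)).2 b0.
    by rewrite lerDl.
  by rewrite -addrA lerD2l.
exists s, t; split; [|by have := tP 0%N; rewrite expr0 divr1|].
  by have := sP 0%N; rewrite expr0 divr1.
by move=> k; exists (st k).1, (st k).2; split.
Qed.

End Bisection.

Lemma zmod_eqP (V : zmodType) (x y : V) : x - y + 0 == 0 -> x = y.
Proof. by rewrite addr0 subr_eq0 => /eqP. Qed.

Ltac zmod_pull y t :=
  lazymatch t with
  | ?a + ?t' => first [unify a y | zmod_pull y t'; rewrite (addrCA a)]
  end.
Ltac zmod_step :=
  lazymatch goal with
  | |- is_true (0 + _ == 0) => rewrite add0r
  | |- is_true (- ?x + ?r == 0) => zmod_pull x r; rewrite (addKr x)
  | |- is_true (?x + ?r == 0) => zmod_pull (- x) r; rewrite (addNKr x)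
  end.
(* Decides identities of commutative groups by cancelling opposite terms. *)
Ltac zmod :=
  apply: zmod_eqP; rewrite ?(opprD, opprK, opprB, oppr0) -?addrA;
  repeat zmod_step; try exact: eqxx.

(** * Goursat's theorem and Cauchy's estimate *)

Section MeanValue.
Variables (R : realType) (E : normedModType R[i]).

(** If the increment L exceeded K, bisection would give arbitrarily short intervals whose increment
    is at least L times their length, shrinking to a point where the derivative has norm at most
    K. *)
Lemma mean_value_ineq (g : R -> E) (K : R) :
  (forall t, 0 <= t <= 1 -> exists2 D : E, nm D <= K &
     forall e : R, 0 < e -> exists2 d : R, 0 < d & forall h : R, `|h| < d ->
       nm (g (t + h) - g t - h%:C%C *: D) <= e * `|h|) ->
  nm (g 1 - g 0) <= K.
Proof.
move=> gD; rewrite leNgt; apply/negP => KL.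
set L := nm _ in KL.
have hlf (x : R) k : x / 2 ^+ k = x / 2 ^+ k.+1 + x / 2 ^+ k.+1.
  by rewrite exprS invfM mulrCA [2^-1 * _]mulrC -splitr.
have [||t [t' [t01 _ tP]]] := @bisection R 1 0 0 0
    (fun k s _ => L / 2 ^+ k <= nm (g (s + 1 / 2 ^+ k) - g s)) ler01 (lexx _).
- by rewrite expr0 !divr1 add0r.
- move=> k s _ sP; set h := 1 / 2 ^+ k.+1.
  have [h1|/ltW h1] := leP (L / 2 ^+ k.+1) (nm (g (s + h) - g s)).
    by exists false, false; rewrite mul0r addr0.
  exists true, false; rewrite mul1r.
  rewrite -(lerD2r (L / 2 ^+ k.+1)) -hlf (le_trans sP)// (hlf 1) -/h.
  have -> : g (s + (h + h)) - g s = (g (s + h + h) - g (s + h)) + (g (s + h) - g s).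
    by rewrite (addrA s) [RHS]addrA subrK.
  by rewrite (le_trans (nmD _ _))// lerD2l.
rewrite add0r in t01.
have [D DK tD] := gD t t01.
have e0 : 0 < (L - K) / 2 by rewrite divr_gt0 ?subr_gt0.
have [d d0 dP] := tD _ e0.
have d20 : 0 < d / 2 by rewrite divr_gt0.
have [k kd] := half_pow_le ler01 d20.
have [s [_ [sP /andP[st ts] _]]] := tP k.
have hk : L / 2 ^+ k = L * (1 / 2 ^+ k) by rewrite mul1r.
move: hk; set h := 1 / 2 ^+ k in kd sP ts * => hk.
have hgt : 0 < h by rewrite divr_gt0 ?exprn_gt0.
have := sP; apply/negP; rewrite -ltNge hk.
have hd : h < d by rewrite (le_lt_trans kd)// ltr_pdivrMr// ltr_pMr ?ltr1n.
clearbody h; clear sP hk kd tP hlf.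
(* The limit point lies between the two ends, so |u| + |v| = h and the two linearization errors add
   up to (L - K)/2 times h. *)
pose u := s + h - t; pose v := s - t.
have uE : `|u| = u by rewrite ger0_norm// /u; lra.
have vE : `|v| = - v by rewrite ler0_norm// /v; lra.
have hu : `|u| <= h by rewrite uE /u; lra.
have hv : `|v| <= h by rewrite vE /v; lra.
have := dP u (le_lt_trans hu hd); have := dP v (le_lt_trans hv hd).
rewrite (_ : t + u = s + h); last by rewrite /u addrC subrK.
rewrite (_ : t + v = s); last by rewrite /v addrC subrK.
move=> gv gu.
have huv : h = u - v by rewrite /u /v opprB addrA subrK addrAC subrr add0r.
have -> : g (s + h) - g s = (g (s + h) - g t - u%:C%C *: D) - (g s - g t - v%:C%C *: D)
     + h%:C%C *: D.
  have -> : h%:C%C = u%:C%C - v%:C%C by rewrite huv rmorphB.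
  by clearbody u v; rewrite scalerBl; zmod.
apply: (le_lt_trans (nmD _ _)).
apply: (@le_lt_trans _ _ ((L - K) / 2 * `|u| + (L - K) / 2 * `|v| + h * K)).
  rewrite lerD//; first by rewrite (le_trans (nmB _ _))// lerD.
  by rewrite nmZ nm_real gtr0_norm// ler_pM2l.
have -> : (L - K) / 2 * `|u| + (L - K) / 2 * `|v| = (L - K) / 2 * h.
  by rewrite -mulrDr uE vE huv.
have : 0 < (L - K) * h by rewrite mulr_gt0// subr_gt0.
by lra.
Qed.

End MeanValue.

(** * Goursat's argument for Riemann sums *)

Section Goursat.
Variables (R : realType) (E : normedModType R[i]).
Local Notation C := R[i].
Local Notation rc := (real_complex R).
Implicit Types (g : R -> E) (u : R -> R -> E).

(** A left Riemann sum on [0, 1]. With 2^n nodes, halving the interval is an exact identity,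
    [avgS]. *)
Definition avg n g : E := (2 ^+ n)^-1 *: \sum_(j < 2 ^ n) g (j%:R / 2 ^+ n).

Lemma nm_avg n g B : (forall x, 0 <= x <= 1 -> nm (g x) <= B) -> nm (avg n g) <= B.
Proof.
move=> gB; rewrite /avg nmZ nmV nmX nm_nat mulrC ler_pdivrMr ?exprn_gt0//.
rewrite (le_trans (nm_sum _ _ _))//.
apply: (@le_trans _ _ (\sum_(j < 2 ^ n) B)).
  apply: ler_sum => j _; apply: gB.
  rewrite divr_ge0// ler_pdivrMr ?exprn_gt0// mul1r -natrX ler_nat.
  exact/ltnW/ltn_ord.
by rewrite sumr_const card_ord -[B *+ _]mulr_natr natrX.
Qed.

Lemma eq_avg n g g' : g =1 g' -> avg n g = avg n g'.
Proof. by move=> gg'; congr (_ *: _); apply: eq_bigr. Qed.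

Lemma avgB n g g' : avg n (fun x => g x - g' x) = avg n g - avg n g'.
Proof. by rewrite /avg sumrB scalerBr. Qed.

Lemma avg_cst n c : avg n (fun=> c) = c.
Proof.
rewrite /avg sumr_const card_ord -[c *+ _]scaler_nat natrX scalerA mulVf ?scale1r//.
Qed.

Lemma avgS n g : avg n.+1 g =
  2^-1 *: (avg n (fun x => g (x / 2)) + avg n (fun x => g (2^-1 + x / 2))).
Proof.
rewrite /avg -scalerDr scalerA -invfM -exprS; congr (_ *: _).
rewrite -(big_mkord xpredT (fun j => g (j%:R / 2 ^+ n.+1))).
rewrite -(big_mkord xpredT (fun j => g (j%:R / 2 ^+ n / 2))).
rewrite -(big_mkord xpredT (fun j => g (2^-1 + j%:R / 2 ^+ n / 2))).
rewrite (@big_cat_nat _ _ _ (2 ^ n)%N) /=; last 2 first.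
- by [].
- by rewrite leq_exp2l.
congr (_ + _).
  by apply: eq_bigr => j _; rewrite exprSr invfM mulrA.
rewrite -[X in \sum_(X <= i < _) _]add0n [(2 ^ n.+1)%N]expnS mul2n -addnn.
rewrite big_addn addnK; apply: eq_bigr => j _; congr g.
rewrite natrD natrX exprSr invfM mulrA mulrDl mulrDl addrC; congr (_ + _).
by rewrite mulfV ?mul1r// expf_neq0// pnatr_eq0.
Qed.

Definition bdry n u s t a b : E :=
  ('i%C * rc b) *: avg n (fun x => u (s + a) (t + b * x) - u s (t + b * x)) -
  rc a *: avg n (fun x => u (s + a * x) (t + b) - u (s + a * x) t).

(** Inner edges cancel. A sum of level n+1 over the double rectangle restricts to sums of level n
    over the quarters, so the identity is exact. *)
Lemma bdry_split n u s t a b : bdry n.+1 u s t (a + a) (b + b) =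
  (bdry n u s t a b + bdry n u (s + a) t a b) +
  (bdry n u s (t + b) a b + bdry n u (s + a) (t + b) a b).
Proof.
pose V s' t' := avg n (fun x => u s' (t' + b * x)).
pose H s' t' := avg n (fun x => u (s' + a * x) t').
have bdryE s' t' : bdry n u s' t' a b =
    ('i%C * rc b) *: (V (s' + a) t' - V s' t') - rc a *: (H s' (t' + b) - H s' t').
  by rewrite /bdry !avgB.
have half2 (c x : R) : (c + c) * (x / 2) = c * x by field.
have half1 (c x : R) : (c + c) * (2^-1 + x / 2) = c + c * x by field.
have VE s' : avg n.+1 (fun x => u s' (t + (b + b) * x)) = 2^-1 *: (V s' t + V s' (t + b)).
  rewrite avgS; congr (_ *: (_ + _)); apply: eq_avg => x; congr (u _ _).
    by rewrite half2.
  by rewrite half1 addrA.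
have HE t' : avg n.+1 (fun x => u (s + (a + a) * x) t') = 2^-1 *: (H s t' + H (s + a) t').
  rewrite avgS; congr (_ *: (_ + _)); apply: eq_avg => x; congr (u _ _).
    by rewrite half2.
  by rewrite half1 addrA.
clearbody V H; rewrite {1}/bdry !avgB !VE !HE !bdryE -!scalerBr !scalerA.
have -> : 'i%C * rc (b + b) / 2 = 'i%C * rc b by rewrite rmorphD/=; field.
have -> : rc (a + a) / 2 = rc a by rewrite rmorphD/=; field.
rewrite (addrA s) (addrA t).
move: ('i%C * rc b) (rc a) => al be.
by rewrite !scalerBr !scalerDr; zmod.
Qed.

Lemma bdryB n u v s t a b :
  bdry n (fun x y => u x y - v x y) s t a b = bdry n u s t a b - bdry n v s t a b.
Proof.
by rewrite /bdry !avgB; move: ('i%C * rc b) (rc a) => al be; rewrite !scalerBr; zmod.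
Qed.

(** Opposite edges of an affine function differ by constants, which every Riemann sum averages
    exactly. *)
Lemma bdry_affine n c D s t a b :
  bdry n (fun x y => c + (x +i* y)%C *: D) s t a b = 0.
Proof.
rewrite /bdry (_ : (fun x => _) = (fun=> rc a *: D)); last first.
  apply/funext => x; rewrite opprD addrACA subrr add0r -scalerBl; congr (_ *: _).
  by apply/eqP; rewrite eq_complex/= addrAC subrr add0r addrN !eqxx.
rewrite (_ : (fun x => _ - _) = (fun=> ('i%C * rc b) *: D)); last first.
  apply/funext => x; rewrite opprD addrACA subrr add0r -scalerBl; congr (_ *: _).
  apply/eqP; rewrite eq_complex/=.
  by apply/andP; split; apply/eqP; ring.
by rewrite !avg_cst !scalerA mulrC subrr.
Qed.

Lemma nm_bdry n u s t a b B : 0 <= a -> 0 <= b ->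
  (forall x y, s <= x <= s + a -> t <= y <= t + b -> nm (u x y) <= B) ->
  nm (bdry n u s t a b) <= 2 * (a + b) * B.
Proof.
move=> a0 b0 uB; have cv (c x0 x : R) : 0 <= c -> 0 <= x <= 1 -> x0 <= x0 + c * x <= x0 + c.
  by move=> c0 /andP[x0' x1]; rewrite lerDl mulr_ge0//= lerD2l ler_piMr.
have lec (x c : R) : 0 <= c -> x <= x <= x + c by move=> c0; rewrite lexx lerDl.
have ler (x c : R) : 0 <= c -> x <= x + c <= x + c by move=> c0; rewrite lexx lerDl c0.
have -> : 2 * (a + b) * B = b * (B + B) + a * (B + B) by ring.
rewrite (le_trans (nmB _ _))// nmZ [X in _ + X]nmZ nmM nm_i mul1r !nm_real !ger0_norm//.
rewrite lerD//; apply: ler_wpM2l => //; apply: nm_avg => x x01.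
  by rewrite (le_trans (nmB _ _))// lerD// uB// ?cv ?lec ?ler.
by rewrite (le_trans (nmB _ _))// lerD// uB// ?cv ?lec ?ler.
Qed.

(* The Riemann sums [bdry n] of [u d(s + i t)] along the boundary of a rectangle *)
(* are additive under dyadic subdivision and vanish on affine functions exactly, *)
(* so Goursat's argument applies to them directly, without any integral.         *)
Lemma goursat u s0 t0 a b : 0 <= a -> 0 <= b ->
  (forall s t, s0 <= s <= s0 + a -> t0 <= t <= t0 + b -> exists D : E,
    forall e : R, 0 < e -> exists2 d : R, 0 < d & forall h k : R,
      `|h| <= d -> `|k| <= d ->
      nm (u (s + h) (t + k) - u s t - (h +i* k)%C *: D) <= e * (`|h| + `|k|)) ->
  ncvg (fun n => bdry n u s0 t0 a b) 0.
Proof.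
move=> a0 b0 uD e e0; apply: contrapT => Ne.
have half (x : R) k : x / 2 ^+ k = x / 2 ^+ k.+1 + x / 2 ^+ k.+1.
  by rewrite exprS invfM mulrCA [2^-1 * _]mulrC -splitr.
have pge (x : R) k : 0 <= x -> 0 <= x / 2 ^+ k by move=> x0; rewrite divr_ge0 ?exprn_ge0.
(* The invariant asks for large sums at arbitrarily high levels. This passes to one of four
   quarters: if each had small sums from some level on, so would their union. *)
have [|k s t Pk|s [t [sa tb stP]]] := @bisection R a b s0 t0 (fun k s t => forall n0,
   exists2 n, (n0 <= n)%N &
     e / 4 ^+ k < nm (bdry n u s t (a / 2 ^+ k) (b / 2 ^+ k))) a0 b0.
- move=> n0; apply: contrapT => Nn; apply: Ne; exists n0 => n n0n.
  rewrite subr0 leNgt; apply/negP => en; apply: Nn; exists n => //.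
  by rewrite !expr0 !divr1.
- apply: contrapT => NP.
  have {}NP (x y : bool) : exists n0, forall n, (n0 <= n)%N ->
      nm (bdry n u (s + x%:R * (a / 2 ^+ k.+1)) (t + y%:R * (b / 2 ^+ k.+1))
        (a / 2 ^+ k.+1) (b / 2 ^+ k.+1)) <= e / 4 ^+ k.+1.
    apply: contrapT => Nn; apply: NP; exists x, y => n0.
    apply: contrapT => Nn0; apply: Nn; exists n0 => n n0n.
    by rewrite leNgt; apply/negP => en; apply: Nn0; exists n.
  have [n00 n00P] := NP false false; have [n01 n01P] := NP false true.
  have [n10 n10P] := NP true false; have [n11 n11P] := NP true true.
  have [[//|n] nn] := Pk (maxn (maxn n00 n01) (maxn n10 n11)).+1.
  apply/negP; rewrite -leNgt (half a) (half b) bdry_split.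
  move: nn; rewrite ltnS !geq_max => /andP[/andP[m1 m2] /andP[m3 m4]].
  have := n00P n m1; have := n01P n m2; have := n10P n m3; have := n11P n m4.
  rewrite !mul0r !mul1r !addr0 => h4 h3 h2 h1.
  have -> : e / 4 ^+ k = (e / 4 ^+ k.+1 + e / 4 ^+ k.+1) + (e / 4 ^+ k.+1 + e / 4 ^+ k.+1).
    rewrite exprS invfM; set X := _^-1; rewrite /X; field.
    by rewrite expf_neq0// pnatr_eq0.
  by rewrite (le_trans (nmD _ _))// lerD// (le_trans (nmD _ _))// lerD.
have [D stD] := uD s t sa tb.
(* The last estimate is e/4^k times 2(a + b)^2/c; the added 1 keeps c positive for degenerate
   rectangles. *)
set c := 2 * (a + b) * (a + b) + 1.
have c0 : 0 < c by rewrite ltr_wpDl// !mulr_ge0// addr_ge0.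
have ec0 : 0 < e / c by rewrite divr_gt0.
have [d d0 dP] := stD _ ec0.
have [k kd] := half_pow_le (addr_ge0 a0 b0) d0.
have [s' [t' [P' s's t't]]] := stP k; have [n _] := P' 0%N.
apply/negP; rewrite -leNgt.
set ak := a / 2 ^+ k in s's *; set bk := b / 2 ^+ k in t't *.
have ak0 : 0 <= ak by exact: pge.
have bk0 : 0 <= bk by exact: pge.
have akd : ak + bk <= d by rewrite -mulrDl.
rewrite -[bdry _ _ _ _ _ _]subr0 -(bdry_affine n (u s t - (s +i* t)%C *: D) D s' t' ak bk).
rewrite -bdryB.
apply: (@le_trans _ _ (2 * (ak + bk) * (e / c * (ak + bk)))).
  apply: nm_bdry => // x y xs yt.
  have hx : `|x - s| <= ak.
    by rewrite ler_norml; move: xs s's; clear; lra.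
  have hy : `|y - t| <= bk.
    by rewrite ler_norml; move: yt t't; clear; lra.
  have := dP (x - s) (y - t).
  rewrite (addrC s) (addrC t) !subrK.
  rewrite (_ : (_ +i* _)%C = (x +i* y)%C - (s +i* t)%C)// scalerBl.
  rewrite (_ : u x y - _ - _ = u x y - (u s t - (s +i* t)%C *: D + (x +i* y)%C *: D)).
    move=> /(_ _ _)/le_trans; apply.
    - by move: hx akd bk0; clear; lra.
    - by move: hy akd ak0; clear; lra.
    - by rewrite ler_wpM2l ?(ltW ec0)// lerD.
  by move: ((x +i* y)%C *: D) ((s +i* t)%C *: D) => z1 z2; zmod.
have -> : 2 * (ak + bk) * (e / c * (ak + bk)) = e / 4 ^+ k * (2 * (a + b) * (a + b) / c).
  have -> : 4 ^+ k = 2 ^+ k * 2 ^+ k :> R by rewrite -exprMn -natrM.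
  rewrite /ak /bk -mulrDl; field.
  by rewrite (gt_eqF c0) /= expf_neq0// pnatr_eq0.
rewrite ler_piMr ?divr_ge0 ?(ltW e0) ?exprn_ge0//.
by rewrite ler_pdivrMr// mul1r lerDl.
Qed.

End Goursat.

Section DifferentiableScale.
Variables (K : numFieldType) (V E : normedModType K).

Let scale_bilinear (a : K^o) (v : E) : E := a *: v.

Let scale_bilinear_subproof : bilinear_for (GRing.Scale.Law.clone _ _ *:%R _)
  (GRing.Scale.Law.clone _ _ *:%R _) scale_bilinear.
Proof.
split=> [v|a] c x y; first by rewrite /scale_bilinear /= scalerDl scalerA.
by rewrite /scale_bilinear /= scalerDr !scalerA mulrC.
Qed.

HB.instance Definition _ := bilinear_isBilinear.Build K K^o E E _ _
  scale_bilinear scale_bilinear_subproof.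

Lemma differentiable_scaler (f : V -> K^o) (g : V -> E) z :
  differentiable f z -> differentiable g z ->
  differentiable (fun x => f x *: g x) z.
Proof.
move=> df dg; have -> : (fun x => f x *: g x) =
    (fun p : K^o * E => scale_bilinear p.1 p.2) \o (fun x => (f x, g x)) by [].
apply: differentiable_comp; first exact: differentiable_pair.
by apply: differentiable_bilin => p; exact: scale_continuous.
Qed.

End DifferentiableScale.

(** * Circular means and Cauchy's estimate *)

Section CauchyEstimate.
Variable R : realType.
Local Notation C := R[i].
Local Notation rc := (real_complex R).

Lemma is_derive_approx (f : R -> R) (x d : R) : is_derive x 1 f d ->
  forall e : R, 0 < e -> exists2 r : R, 0 < r &
  forall h, `|h| <= r -> `|f (x + h) - f x - h * d| <= e * `|h|.
Proof.
move=> fd e e0; have df := @ex_derive _ _ _ _ _ _ _ fd.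
have /cvgrPdist_le /(_ e e0) : h^-1 *: (f (h *: 1 + x) - f x) @[h --> 0^'] --> d.
  by rewrite -(@derive_val _ _ _ _ _ _ _ fd); exact: df.
rewrite near_withinE => /nbhs_normP[r /= r0 rP].
exists (r / 2); first by rewrite divr_gt0.
move=> h hr; have [->|h0] := eqVneq h 0.
  by rewrite addr0 subrr mul0r subrr normr0 mulr0.
have hrr : `|0 - h| < r.
  by rewrite sub0r normrN (le_lt_trans hr)// ltr_pdivrMr// ltr_pMr ?ltr1n.
have := rP h hrr h0; rewrite [h *: 1]mulr1 => hP.
have -> : f (x + h) - f x - h * d = - h * (d - h^-1 * (f (h + x) - f x)).
  by rewrite [h + x]addrC; field.
by rewrite normrM normrN mulrC ler_wpM2r.
Qed.

(** The complex exponential of s + i t, used as polar coordinates. *)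
Definition cexp (s t : R) : C := (expR s * cos t +i* (expR s * sin t))%C.

Lemma cexpD s t h k : cexp (s + h) (t + k) = cexp s t * cexp h k.
Proof.
rewrite /cexp; apply/eqP; rewrite eq_complex /= expRD cosD sinD.
by apply/andP; split; apply/eqP; ring.
Qed.

Lemma nm_cexp s t : nm (cexp s t) = expR s.
Proof.
rewrite /nm normc_def /= !exprMn -mulrDr cos2Dsin2 mulr1 sqrtr_sqr ger0_norm//.
Qed.

Lemma cexp_approx (e : R) : 0 < e -> exists2 d : R, 0 < d & forall h k,
  `|h| <= d -> `|k| <= d ->
  nm (cexp h k - 1 - (h +i* k)%C) <= e * (`|h| + `|k|).
Proof.
move=> e0; pose e' := Num.min 1 (e / 6).
have e'0 : 0 < e' by rewrite lt_min ltr01 divr_gt0.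
have e'1 : e' <= 1 by rewrite ge_min lexx.
have e'e : e' * 6 <= e by rewrite -ler_pdivlMr// ge_min lexx orbT.
clearbody e'.
have [d1 d10 d1P] := is_derive_approx (is_derive_expR 0) e'0.
have [d2 d20 d2P] := is_derive_approx (is_derive_cos 0) e'0.
have [d3 d30 d3P] := is_derive_approx (is_derive_sin 0) e'0.
exists (Num.min (Num.min d1 e') (Num.min d2 d3)); first by rewrite !lt_min d10 d20 d30 e'0.
move=> h k; rewrite !le_min => /andP[/andP[h1 h4] /andP[h2 h3]].
move=> /andP[/andP[k1 k4] /andP[k2 k3]].
have := d1P h h1; rewrite add0r expR0 mulr1 => E1.
have := d2P k k2; rewrite add0r cos0 sin0 oppr0 mulr0 subr0 => E2.
have := d3P k k3; rewrite add0r sin0 cos0 mulr1 subr0 => E3.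
have E4 : `|expR h| <= 3.
  have : `|expR h - 1 - h| <= 1.
    by rewrite (le_trans E1)// mulr_ile1// ?(ltW e'0)// (le_trans h4).
  have : `|h| <= 1 by exact: le_trans e'1.
  by rewrite !ler_norml => /andP[a1 a2] /andP[a3 a4]; apply/andP; split; lra.
apply: (le_trans (nm_complex_le _)).
have -> : complex.Re (cexp h k - 1 - (h +i* k)%C) =
   expR h * (cos k - 1) + (expR h - 1 - h) by rewrite /=; ring.
have -> : complex.Im (cexp h k - 1 - (h +i* k)%C) =
   expR h * (sin k - k) + (expR h - 1) * k by rewrite /=; ring.
have E5 : `|expR h - 1| <= 2 * `|h|.
  have -> : expR h - 1 = (expR h - 1 - h) + h by ring.
  rewrite (le_trans (ler_normD _ _))// mulr_natl mulr2n lerD2r (le_trans E1)//.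
  by rewrite ler_piMl.
have E6 : `|expR h * (cos k - 1)| <= 3 * (e' * `|k|) by rewrite normrM ler_pM.
have E7 : `|expR h * (sin k - k)| <= 3 * (e' * `|k|) by rewrite normrM ler_pM.
have E8 : `|(expR h - 1) * k| <= 2 * (e' * `|h|).
  rewrite normrM (le_trans (ler_wpM2r _ E5))// -mulrA ler_pM2l// mulrC.
  by rewrite ler_wpM2r.
have hk1 := normr_ge0 h; have hk2 := normr_ge0 k.
apply: (@le_trans _ _ (e' * 6 * (`|h| + `|k|))); last first.
  by rewrite ler_wpM2r// addr_ge0.
have F1 := ler_normD (expR h * (cos k - 1)) (expR h - 1 - h).
have F2 := ler_normD (expR h * (sin k - k)) ((expR h - 1) * k).
have : 0 <= e' * `|h| by rewrite mulr_ge0// ltW.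
move: E1 E6 E7 E8 F1 F2; clear; lra.
Qed.

Variable E : normedModType C.

Lemma diff_scalar (g : C^o -> E) z m : 'd g z m = m *: 'd g z (1 : C^o).
Proof. by rewrite -linearZ; congr ('d g z _); rewrite [RHS]mulr1. Qed.

(** The chain rule for F composed with the exponential, with derivative z F'(z), in the form that
    [goursat] requires. *)
Lemma differentiable_polar (F : C^o -> E) s t :
  differentiable F (cexp s t : C^o) -> exists D : E,
  forall e : R, 0 < e -> exists2 d : R, 0 < d & forall h k : R,
    `|h| <= d -> `|k| <= d ->
    nm (F (cexp (s + h) (t + k)) - F (cexp s t) - (h +i* k)%C *: D) <=
      e * (`|h| + `|k|).
Proof.
move=> dF; set z : C^o := cexp s t in dF *; pose D := 'd F z (1 : C^o).
exists (z *: D) => e e0.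
pose c := nm z; have c0 : 0 < c by rewrite /c nm_cexp expR_gt0.
have e10 : 0 < e / (4 * c) by rewrite divr_gt0// mulr_gt0.
have [d1 d10 d1P] := diff_approx dF e10.
pose e2 := Num.min 1 (e / (2 * c * (nm D + 1))).
have nD0 : 0 < nm D + 1 by rewrite ltr_wpDl// nm_ge0.
have e20 : 0 < e2 by rewrite lt_min ltr01 divr_gt0// !mulr_gt0.
have [d2 d20 d2P] := cexp_approx e20.
exists (Num.min d2 (d1 / (8 * c))).
  by rewrite lt_min d20 divr_gt0// mulr_gt0.
move=> h k; rewrite !le_min => /andP[h2 h1] /andP[k2 k1].
have := d2P h k h2 k2; set w := cexp h k - 1 - _ => wP.
pose m := z * ((h +i* k)%C + w).
have zm : cexp (s + h) (t + k) = z + m.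
  by rewrite cexpD -/z /m /w; ring.
have nhk : nm (h +i* k)%C <= `|h| + `|k| by exact: nm_complex_le.
have hk0 : 0 <= `|h| + `|k| by rewrite addr_ge0.
have nmm : nm m <= c * (2 * (`|h| + `|k|)).
  rewrite /m nmM ler_pM2l// (le_trans (nmD _ _))// mulr_natl mulr2n lerD//.
  by rewrite (le_trans wP)// ler_piMl// ge_min lexx.
have md1 : nm m < d1.
  have : `|h| + `|k| <= d1 / (4 * c).
    have -> : d1 / (4 * c) = d1 / (8 * c) + d1 / (8 * c) by field; rewrite gt_eqF.
    by rewrite lerD.
  rewrite ler_pdivlMr ?mulr_gt0// => hkd.
  rewrite (le_lt_trans nmm)//; move: hkd d10; clear; nra.
have := d1P m md1; rewrite diff_scalar -/D zm => Fm.
have -> : F (z + m) - F z - (h +i* k)%C *: (z *: D) =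
    (F (z + m) - F z - m *: D) + (z * w) *: D.
  rewrite scalerA; have -> : m = (h +i* k)%C * z + z * w by rewrite /m; ring.
  by rewrite scalerDl; move: (_ *: D) (_ *: D) => x y; zmod.
apply: (le_trans (nmD _ _)); rewrite nmZ nmM -/c.
have -> : e * (`|h| + `|k|) = e / 2 * (`|h| + `|k|) + e / 2 * (`|h| + `|k|) by field.
rewrite lerD//.
  rewrite (le_trans Fm)// (le_trans (ler_wpM2l (ltW e10) nmm))//.
  by rewrite le_eqVlt; apply/orP; left; apply/eqP; field; rewrite gt_eqF.
have wP' : nm w <= e / (2 * c * (nm D + 1)) * (`|h| + `|k|).
  by rewrite (le_trans wP)// ler_wpM2r// ge_min lexx orbT.
rewrite (@le_trans _ _ (c * (e / (2 * c * (nm D + 1)) * (`|h| + `|k|)) * (nm D + 1)))//.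
  rewrite ler_pM ?mulr_ge0 ?nm_ge0 ?(ltW c0)// ?lerDl//.
  by rewrite ler_pM2l.
by rewrite le_eqVlt; apply/orP; left; apply/eqP; field; rewrite !gt_eqF.
Qed.

Definition circle (r x : R) : C^o := cexp (ln r) (2 * pi * x).

(** The exponential maps the rectangle with sides ln r2 - ln r1 and 2 pi onto the annulus. The
    horizontal edges cancel by periodicity, and the vertical ones are the two circular means. *)
Lemma circle_mean_indep (F : C^o -> E) (r1 r2 : R) : 0 < r1 -> r1 <= r2 ->
  (forall z, r1 <= nm z <= r2 -> differentiable F z) ->
  ncvg (fun n => avg n (F \o circle r2) - avg n (F \o circle r1)) 0.
Proof.
move=> r10 r12 dF; have r20 := lt_le_trans r10 r12.
have pi2 : 0 < 2 * pi :> R by rewrite mulr_gt0// pi_gt0.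
pose u s t := F (cexp s t).
have l12 : 0 <= ln r2 - ln r1 by rewrite subr_ge0 ler_ln ?posrE.
have lcv : ncvg (fun n => bdry n u (ln r1) 0 (ln r2 - ln r1) (2 * pi)) 0.
  apply: goursat => //; first exact: ltW.
  move=> s t; rewrite addrC subrK => /andP[s1 s2] _; apply: differentiable_polar.
  apply: dF; rewrite nm_cexp -[X in X <= _]lnK ?posrE// -[X in _ && (_ <= X)]lnK ?posrE//.
  by rewrite !ler_expR s1.
move=> e e0; have [n0 n0P] := lcv _ (mulr_gt0 pi2 e0).
exists n0 => n /n0P; rewrite !subr0 /bdry.
rewrite [X in rc (ln _ - _) *: X](_ : _ = avg n (fun=> 0)); last first.
  apply: eq_avg => x; apply/eqP; rewrite subr_eq0 /u; apply/eqP; congr F.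
  rewrite /cexp add0r [2 * pi]mulr_natl; apply/eqP; rewrite eq_complex /=.
  by rewrite cos2pi sin2pi cos0 sin0 !eqxx.
rewrite avg_cst scaler0 subr0 nmZ nmM nm_i mul1r nm_real gtr0_norm// ler_pM2l//.
rewrite avgB (addrC (ln r1)) subrK.
suff ec r : avg n (F \o circle r) = avg n (fun x => u (ln r) (0 + 2 * pi * x)) by rewrite !ec.
by apply: eq_avg => x; rewrite add0r.
Qed.

(** The means of (g z - g 0)/z over all circles agree in the limit: at radius r they are at most
    2M/r, and at small radius they are close to the derivative at 0. *)
Lemma cauchy_estimate (g : C^o -> E) (r M : R) : 0 < r ->
  (forall z, nm z <= r -> differentiable g z) ->
  (forall z, nm z <= r -> nm (g z) <= M) ->
  nm ('d g 0 (1 : C^o)) <= 2 * M / r.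
Proof.
move=> r0 dg gM; set D := 'd g 0 _.
pose F (z : C^o) : E := z^-1 *: (g z - g 0).
have dF z : 0 < nm z <= r -> differentiable F z.
  move=> /andP[z0 zr]; apply: differentiable_scaler.
    by apply: differentiable_Rinv; rewrite -nm_eq0 gt_eqF.
  apply: differentiableB; first exact: dg.
  exact: differentiable_cst.
apply/ler_addgt0Pr => e e0; have e20 : 0 < e / 2 by rewrite divr_gt0.
have dg0 : differentiable g (0 : C^o) by apply: dg; rewrite nm0 ltW.
have [d d0 dP] := diff_approx dg0 e20.
pose r1 := Num.min r (d / 2).
have r10 : 0 < r1 by rewrite lt_min r0 divr_gt0.
have r1r : r1 <= r by rewrite ge_min lexx.
have r1d : r1 < d.
  by rewrite gt_min; apply/orP; right; rewrite ltr_pdivrMr// ltr_pMr// ltr1n.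
have ncirc s x : 0 < s -> nm (circle s x) = s by move=> s0; rewrite nm_cexp lnK.
have [|n0 n0P] := circle_mean_indep r10 r1r _ e20 (F := F).
  by move=> z /andP[z1 z2]; apply: dF; rewrite (lt_le_trans r10 z1).
have := n0P n0 (leqnn _); rewrite subr0; set a2 := avg n0 _; set a1 := avg n0 _ => a21.
have na2 : nm a2 <= 2 * M / r.
  apply: nm_avg => x _; rewrite /= /F nmZ nmV ncirc// mulrC ler_pM2r ?invr_gt0//.
  rewrite (le_trans (nmB _ _))// mulr_natl mulr2n lerD// gM//.
    by rewrite ncirc.
  by rewrite nm0 ltW.
have na1 : nm (a1 - D) <= e / 2.
  rewrite -[D](avg_cst n0) -avgB; apply: nm_avg => x _ /=.
  have := dP (circle r1 x); rewrite ncirc// add0r diff_scalar -/D => /(_ r1d) Fx.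
  have cn0 : circle r1 x != 0 by rewrite -nm_eq0 ncirc// gt_eqF.
  have -> : F (circle r1 x) - D = (circle r1 x)^-1 *:
      (g (circle r1 x) - g 0 - circle r1 x *: D).
    by rewrite /F [in RHS]scalerBr scalerA mulVf// scale1r.
  by rewrite nmZ nmV ncirc// mulrC ler_pdivrMr.
have -> : D = a2 - (a2 - a1) - (a1 - D) by clearbody a1 a2 D; zmod.
rewrite [e]splitr addrA (le_trans (nmB _ _))// lerD// (le_trans (nmB _ _))//.
by rewrite lerD.
Qed.

End CauchyEstimate.

(** * Bounded holomorphic maps of several variables *)

Section BoundedHolomorphic.
Variable R : realType.
Local Notation C := R[i].

Lemma ncvg_unique (E : normedZmodType C) (u : nat -> E) l l' :
  ncvg u l -> ncvg u l' -> l = l'.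
Proof.
move=> ul ul'; apply/eqP; rewrite -subr_eq0 -nm_eq0 eq_le nm_ge0 andbT.
apply/ler_addgt0Pr => e e0; rewrite add0r; have e20 : 0 < e / 2 by rewrite divr_gt0.
have [n1 n1P] := ul _ e20; have [n2 n2P] := ul' _ e20.
have -> : l - l' = (u (maxn n1 n2) - l') - (u (maxn n1 n2) - l) by zmod.
rewrite (le_trans (nmB _ _))// [leRHS]splitr lerD//.
  by rewrite n2P// leq_maxr.
by rewrite n1P// leq_maxl.
Qed.

Lemma ncvg_lin (E : normedModType C) (u v : nat -> E) (a : C) l m :
  ncvg u l -> ncvg v m -> ncvg (fun n => a *: u n + v n) (a *: l + m).
Proof.
move=> ul vm e e0; have a0 : 0 < nm a + 1 by rewrite ltr_wpDl// nm_ge0.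
have e10 : 0 < e / 2 / (nm a + 1) by rewrite !divr_gt0.
have e20 : 0 < e / 2 by rewrite divr_gt0.
have [n1 n1P] := ul _ e10; have [n2 n2P] := vm _ e20.
exists (maxn n1 n2) => n; rewrite geq_max => /andP[/n1P nn1 /n2P nn2].
rewrite opprD addrACA -scalerBr (le_trans (nmD _ _))// nmZ [leRHS]splitr lerD//.
rewrite (le_trans (ler_wpM2l (nm_ge0 _) nn1))// mulrCA ler_piMr ?(ltW e20)//.
by rewrite ler_pdivrMr// mul1r lerDl.
Qed.

Lemma ncvgB (E : normedModType C) (u v : nat -> E) l m :
  ncvg u l -> ncvg v m -> ncvg (fun n => u n - v n) (l - m).
Proof.
move=> ul vm; have := ncvg_lin (-1) vm ul; rewrite scaleN1r addrC.
by under eq_fun do rewrite scaleN1r addrC.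
Qed.

Lemma ncvg_le (E : normedZmodType C) (u : nat -> E) l (B : R) n0 :
  (forall n, (n0 <= n)%N -> nm (u n) <= B) -> ncvg u l -> nm l <= B.
Proof.
move=> uB ul; apply/ler_addgt0Pr => e e0; have [n1 n1P] := ul _ e0.
have -> : l = u (maxn n0 n1) - (u (maxn n0 n1) - l) by zmod.
by rewrite (le_trans (nmB _ _))// lerD// ?n1P ?uB ?leq_maxl ?leq_maxr.
Qed.

Section Slices.
Variables (V E : normedModType C).
Implicit Types f : V -> E.

(* Fixing the type of the base point keeps unification from comparing the many *)
(* presentations of its neighbourhood filter.                                  *)
Definition dd f (x : V) : V -> E := 'd f x.

Lemma dd_linear f x : linear (dd f x).
Proof. by move=> a u v; rewrite /dd linearP. Qed.

HB.instance Definition _ f x := GRing.isLinear.Build C V E *:%R (dd f x) (dd_linear f x).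

Lemma dd_approx f z : differentiable f z -> forall e : R, 0 < e -> exists2 d : R, 0 < d &
  forall h, nm h < d -> nm (f (z + h) - f z - dd f z h) <= e * nm h.
Proof. exact: diff_approx. Qed.

Lemma approx_dd f z (D : V -> E) :
  linear D -> (exists K : R, forall h, nm (D h) <= K * nm h) ->
  (forall e : R, 0 < e -> exists2 d : R, 0 < d &
  forall h, nm h < d -> nm (f (z + h) - f z - D h) <= e * nm h) ->
  differentiable f z /\ dd f z =1 D.
Proof. exact: approx_diff. Qed.

Lemma dd_bounded f z : differentiable f z ->
  exists K : R, forall v, nm (dd f z v) <= K * nm v.
Proof.
move=> df; have /linear_bounded_continuous/linear_boundedP : continuous ('d f z).
  exact: diff_continuous.
move=> /pinfty_ex_gt0[M M0 MP]; exists (complex.Re M) => v.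
by have := MP v; rewrite !nmE -(RRe_real (gtr0_real M0)) -rmorphM lecR; exact.
Qed.

Lemma differentiable_dd f z x : differentiable f z ->
  differentiable (dd f z) x /\ dd (dd f z) x =1 dd f z.
Proof.
move=> df; apply: approx_dd; [exact: dd_linear|exact: dd_bounded|].
move=> e e0; exists 1 => // h _.
rewrite linearD (addrC (dd f z x)) addrK subrr nm0.
by rewrite mulr_ge0 ?nm_ge0// ltW.
Qed.

Lemma ddB f g x : differentiable f x -> differentiable g x ->
  dd (fun y => f y - g y) x =1 (fun v => dd f x v - dd g x v).
Proof. by move=> df dg v; have /(congr1 (fun h => h v)) := diffB df dg. Qed.

Lemma line_diff f (x v : V) (l : C^o) : differentiable f (x + l *: v) ->
  differentiable (fun l : C^o => f (x + l *: v)) l /\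
  'd (fun l : C^o => f (x + l *: v)) l (1 : C^o) = dd f (x + l *: v) v.
Proof.
move=> df; pose D (m : C^o) : E := dd f (x + l *: v) (m *: v).
have [||e e0|dl dlE] := @approx_diff R C^o E (fun l : C^o => f (x + l *: v)) l D.
- by move=> a m m'; rewrite /D scalerDl -scalerA linearP.
- exists (nm (D 1)) => h.
  have -> : D h = h *: D 1 by rewrite /D scale1r linearZ.
  by rewrite nmZ mulrC.
- have v0 : 0 < nm v + 1 by rewrite ltr_wpDl// nm_ge0.
  have e10 : 0 < e / (nm v + 1) by rewrite divr_gt0.
  have [d d0 dP] := dd_approx df e10; exists (d / (nm v + 1)); first by rewrite divr_gt0.
  move=> h; rewrite ltr_pdivlMr// => hd.
  have hvd : nm (h *: v) < d.
    by rewrite nmZ (le_lt_trans _ hd)// ler_wpM2l ?nm_ge0// lerDl.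
  have := dP _ hvd; rewrite -(addrA x) -scalerDl => /le_trans; apply.
  rewrite nmZ -mulrA ler_wpM2l ?(ltW e0)// mulrCA ler_piMr ?nm_ge0//.
  by rewrite mulrC ler_pdivrMr// mul1r lerDl.
by split => //; rewrite dlE /D scale1r.
Qed.

Lemma cauchy_slice f (x v : V) (r M : R) : 0 < r ->
  (forall l : C, nm l < r -> differentiable f (x + l *: v)) ->
  (forall l : C, nm l < r -> nm (f (x + l *: v)) <= M) ->
  nm (dd f x v) * r <= 2 * M.
Proof.
move=> r0 df fM; rewrite leNgt; apply/negP => h.
have M0 : 0 <= M by rewrite (le_trans (nm_ge0 _) (fM 0 _))// nm0.
have D0 : 0 < nm (dd f x v).
  by rewrite lt_neqAle nm_ge0 andbT; apply: contraTneq h => <-; rewrite mul0r -leNgt mulr_ge0.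
(* Cauchy's estimate needs a closed disc, while the bound is known on an open one; s lies strictly
   between the radius where the contradiction starts and r. *)
pose s := (2 * M / nm (dd f x v) + r) / 2.
have sr : s < r.
  have : 2 * M / nm (dd f x v) < r by rewrite ltr_pdivrMr// [ltRHS]mulrC.
  by rewrite /s; lra.
have Ms : 2 * M < nm (dd f x v) * s.
  rewrite [ltRHS]mulrC -ltr_pdivrMr//.
  have : 2 * M / nm (dd f x v) < r by rewrite ltr_pdivrMr// [ltRHS]mulrC.
  by rewrite /s; lra.
have s0 : 0 < s by rewrite divr_gt0// ltr_wpDl// divr_ge0 ?mulr_ge0// ltW.
have := @cauchy_estimate R E (fun l : C^o => f (x + l *: v)) s M s0.
rewrite (_ : 'd _ _ _ = dd f x v); last first.
  have [|_ ->] := @line_diff f x v 0; first by apply: df; rewrite nm0.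
  by rewrite scale0r addr0.
rewrite ler_pdivlMr// => H; move: Ms; apply/negP; rewrite -leNgt; apply: H => z zs.
  by apply: (line_diff _).1; apply: df; rewrite (le_lt_trans zs).
by apply: fM; rewrite (le_lt_trans zs).
Qed.

Lemma segment_le f (x h : V) (K : R) :
  (forall t : R, 0 <= t <= 1 -> differentiable f (x + t%:C%C *: h)) ->
  (forall t : R, 0 <= t <= 1 -> nm (dd f (x + t%:C%C *: h) h) <= K) ->
  nm (f (x + h) - f x) <= K.
Proof.
move=> df dK; have := @mean_value_ineq R E (fun t => f (x + t%:C%C *: h)) K.
rewrite scale1r scale0r addr0; apply=> t t01; exists (dd f (x + t%:C%C *: h) h); first exact: dK.
move=> e e0; have h0 : 0 < nm h + 1 by rewrite ltr_wpDl// nm_ge0.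
have e10 : 0 < e / (nm h + 1) by rewrite divr_gt0.
have [d d0 dP] := dd_approx (df t t01) e10.
exists (d / (nm h + 1)); first by rewrite divr_gt0.
move=> k; rewrite ltr_pdivlMr// => kd.
have khd : nm (k%:C%C *: h) < d.
  by rewrite nmZ nm_real (le_lt_trans _ kd)// ler_wpM2l// lerDl.
have := dP _ khd; rewrite -(addrA x) -scalerDl -rmorphD linearZ /= => /le_trans; apply.
rewrite nmZ nm_real -mulrA ler_wpM2l ?(ltW e0)// mulrCA ler_piMr//.
by rewrite mulrC ler_pdivrMr// mul1r lerDl.
Qed.

Definition holb f (z : V) (r M : R) :=
  forall y, nm (y - z) < r -> differentiable f y /\ nm (f y) <= M.

Lemma holb_sub f z r M z' r' : holb f z r M -> nm (z' - z) + r' <= r -> holb f z' r' M.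
Proof.
move=> hf zz y yz'; apply: hf; rewrite (lt_le_trans _ zz)//.
have -> : y - z = (y - z') + (z' - z) by zmod.
by rewrite (le_lt_trans (nmD _ _))// addrC ltrD2l.
Qed.

Lemma holb_ge0 f z r M : 0 < r -> holb f z r M -> 0 <= M.
Proof.
move=> r0 hf; have [|_ fM] := hf z; first by rewrite subrr nm0.
exact: le_trans (nm_ge0 _) fM.
Qed.

Lemma holb_deriv f z r M v : 0 < r -> holb f z r M ->
  nm (dd f z v) <= 2 * M / r * nm v.
Proof.
move=> r0 hf; have [->|v0] := eqVneq v 0; first by rewrite linear0 !nm0 mulr0.
have {}v0 : 0 < nm v by rewrite lt_neqAle eq_sym nm_eq0 v0 nm_ge0.
have rv0 : 0 < r / nm v by rewrite divr_gt0.
have := @cauchy_slice f z v _ M rv0.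
rewrite mulrA ler_pdivrMr// => H; rewrite mulrAC ler_pdivlMr//; apply: H.
  move=> l; rewrite ltr_pdivlMr// => lr.
  by have [] := hf (z + l *: v); rewrite // addrAC subrr add0r nmZ.
move=> l; rewrite ltr_pdivlMr// => lr.
by have [] := hf (z + l *: v); rewrite // addrAC subrr add0r nmZ.
Qed.

Lemma shift_diff f z h : differentiable f (z + h) ->
  differentiable (fun y => f (y + h)) z /\ dd (fun y => f (y + h)) z =1 dd f (z + h).
Proof.
move=> df; apply: approx_dd; [exact: dd_linear|exact: dd_bounded|].
move=> e e0; have [d d0 dP] := dd_approx df e0; exists d => // k /dP.
by rewrite (addrAC z h).
Qed.

(** Instead of second derivatives, Cauchy's estimate is applied to f(y + h) - f(y), which is O(|h|)
    on a smaller ball by the mean value inequality. *)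
Lemma holb_deriv_lip f z r M h v : 0 < r -> holb f z r M -> nm h < r / 4 ->
  nm (dd f (z + h) v - dd f z v) <= 32 * M / r ^+ 2 * nm h * nm v.
Proof.
move=> r0 hf hr; have r4 : 0 < r / 4 by rewrite divr_gt0.
have r2 : 0 < r / 2 by rewrite divr_gt0.
have dfz y : nm (y - z) < r -> differentiable f y by move=> /hf[].
have zhr : nm (z + h - z) < r by rewrite addrAC subrr add0r; move: hr r0; clear; lra.
have [dsh dshE] := shift_diff (dfz _ zhr).
have dz : differentiable f z by apply: dfz; rewrite subrr nm0.
rewrite -dshE -(ddB dsh dz).
have hg : holb (fun y => f (y + h) - f y) z (r / 4) (4 * M / r * nm h).
  move=> y yr; have yhr : nm (y + h - z) < r.
    rewrite addrAC (le_lt_trans (nmD _ _))//; move: hr yr r0; clear; lra.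
  split.
    apply: differentiableB; last by apply: dfz; move: yr r0; clear; lra.
    exact: (shift_diff (dfz _ yhr)).1.
  have sr t : 0 <= t <= 1 -> nm (y + t%:C%C *: h - z) < r / 2.
    move=> /andP[t0 t1]; rewrite addrAC (le_lt_trans (nmD _ _))// nmZ nm_real ger0_norm//.
    have : t * nm h <= nm h by rewrite ler_piMl// nm_ge0.
    by move: hr yr; clear; lra.
  apply: segment_le => t /sr tr.
    by apply: dfz; move: tr r0; clear; lra.
  have -> : 4 * M / r * nm h = 2 * M / (r / 2) * nm h by field; rewrite gt_eqF.
  apply: holb_deriv => //; apply: (holb_sub hf).
  by move: tr; clear; lra.
apply: le_trans (holb_deriv _ r4 hg) _.
by rewrite le_eqVlt; apply/orP; left; apply/eqP; field; rewrite gt_eqF.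
Qed.

(** The mean value inequality for f minus its differential at z, whose derivative is small by
    [holb_deriv_lip]. *)
Lemma holb_taylor2 f z r M h : 0 < r -> holb f z r M -> nm h < r / 4 ->
  nm (f (z + h) - f z - dd f z h) <= 32 * M / r ^+ 2 * nm h ^+ 2.
Proof.
move=> r0 hf hr; have dz : differentiable f z by have [] := hf z; rewrite // subrr nm0.
have M0 := holb_ge0 r0 hf.
have th t : 0 <= t <= 1 -> nm (t%:C%C *: h) <= nm h.
  by move=> /andP[t0 t1]; rewrite nmZ nm_real ger0_norm// ler_piMl// nm_ge0.
have dt t : 0 <= t <= 1 -> differentiable f (z + t%:C%C *: h).
  move=> /th tn; have [] := hf (z + t%:C%C *: h) => //.
  by rewrite addrAC subrr add0r; move: tn hr r0; clear; lra.
have -> : f (z + h) - f z - dd f z h = (f (z + h) - dd f z (z + h)) - (f z - dd f z z).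
  by rewrite linearD /=; move: (dd f z z) (dd f z h) => a b; zmod.
apply: (@segment_le (fun y => f y - dd f z y)) => t t01.
  by apply: differentiableB; [exact: dt|exact: (differentiable_dd _ dz).1].
rewrite (ddB (dt _ t01) (differentiable_dd _ dz).1) (differentiable_dd _ dz).2.
apply: le_trans (holb_deriv_lip _ r0 hf _) _; first by rewrite (le_lt_trans (th _ t01)).
rewrite expr2 mulrA ler_wpM2r ?nm_ge0// ler_wpM2l ?th//.
by rewrite divr_ge0 ?mulr_ge0 ?exprn_ge0// ltW.
Qed.

Hypothesis complE : ncomplete E.

(** Cauchy's estimate on differences makes the differentials converge, and the second order
    remainder bound is uniform in n, so it survives in the limit. *)
Lemma weierstrass (fn : nat -> V -> E) f z r M : 0 < r ->
  (forall n, holb (fn n) z r M) ->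
  (forall e : R, 0 < e -> exists n0, forall n, (n0 <= n)%N ->
     forall y, nm (y - z) < r -> nm (fn n y - f y) <= e) ->
  differentiable f z.
Proof.
move=> r0 hfn fnf.
have fc y : nm (y - z) < r -> ncvg (fn ^~ y) (f y).
  by move=> yr e /fnf[n0 n0P]; exists n0 => n n0n; exact: n0P.
have M0 := holb_ge0 r0 (hfn 0%N).
have zr : nm (z - z) < r by rewrite subrr nm0.
have /choice[D DP] : forall h, exists l, ncvg (fun n => dd (fn n) z h) l.
  move=> h; apply: complE => e e0; have h0 : 0 < nm h + 1 by rewrite ltr_wpDl// nm_ge0.
  have e10 : 0 < e * r / (4 * (nm h + 1)) by rewrite divr_gt0 ?mulr_gt0.
  have [n0 n0P] := fnf _ e10; exists n0 => n k n0n n0k.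
  have -> : dd (fn n) z h - dd (fn k) z h = dd (fun y => fn n y - fn k y) z h.
    by rewrite (ddB (hfn n z zr).1 (hfn k z zr).1).
  have hB : holb (fun y => fn n y - fn k y) z r (2 * (e * r / (4 * (nm h + 1)))).
    move=> y yr; split.
      by apply: differentiableB; [exact: (hfn n y yr).1|exact: (hfn k y yr).1].
    have -> : fn n y - fn k y = (fn n y - f y) - (fn k y - f y) by zmod.
    by rewrite (le_trans (nmB _ _))// mulr_natl mulr2n lerD// n0P.
  rewrite (le_trans (holb_deriv h r0 hB))//.
  have -> : 2 * (2 * (e * r / (4 * (nm h + 1)))) / r * nm h = e * (nm h / (nm h + 1)).
    by field; rewrite !gt_eqF.
  by rewrite ler_piMr ?(ltW e0)// ler_pdivrMr// mul1r lerDl.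
apply: (proj1 (approx_dd (D := D) _ _ _)).
- move=> a x y; apply: (ncvg_unique (DP _)).
  have := ncvg_lin a (DP x) (DP y); congr ncvg.
  by apply/funext => n; rewrite linearP.
- exists (2 * M / r) => h; apply: (ncvg_le (n0 := 0%N) _ (DP h)) => n _.
  exact: holb_deriv.
- move=> e e0; pose K := 32 * M / r ^+ 2 + 1.
  have K0 : 0 < K by rewrite ltr_wpDl// divr_ge0 ?mulr_ge0 ?exprn_ge0// ltW.
  exists (Num.min (r / 4) (e / K)); first by rewrite lt_min !divr_gt0.
  move=> h; rewrite lt_min => /andP[hr hK].
  have zh : nm (z + h - z) < r by rewrite addrAC subrr add0r; move: hr r0; clear; lra.
  apply: (@le_trans _ _ (K * nm h ^+ 2)); last first.
    by rewrite expr2 mulrA ler_wpM2r ?nm_ge0// mulrC -ler_pdivlMr// ltW.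
  apply: (ncvg_le (u := fun n => fn n (z + h) - fn n z - dd (fn n) z h) (n0 := 0%N)).
    move=> n _; rewrite (le_trans (holb_taylor2 r0 (hfn n) hr))//.
    by rewrite ler_wpM2r ?exprn_ge0 ?nm_ge0// lerDl.
  exact: ncvgB (ncvgB (fc _ zh) (fc z zr)) (DP h).
Qed.

(** A directional derivative is a uniform limit of difference quotients, with error O(1/n) by
    [holb_taylor2]. *)
Lemma deriv_differentiable f z r M v : 0 < r -> holb f z r M ->
  differentiable (fun y => dd f y v) z.
Proof.
move=> r0 hf; have r2 : 0 < r / 2 by rewrite divr_gt0.
have M0 := holb_ge0 r0 hf.
(* This offset keeps all increments below r/8, as [holb_taylor2] requires on balls of radius r/2. *)
pose n0 := Num.truncn (nm v / (r / 8)).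
have vn n : nm v / (n + n0).+1%:R < r / 8.
  rewrite ltr_pdivrMr// mulrC -ltr_pdivrMr ?divr_gt0//.
  rewrite (lt_le_trans (real_truncnS_gt (num_real _)))// ler_nat ltnS leq_addl//.
pose c n : C := (n + n0).+1%:R.
have cn0 n : c n != 0 by rewrite pnatr_eq0.
pose fn n y := c n *: (f (y + (c n)^-1 *: v) - f y).
have nmv n : nm ((c n)^-1 *: v) = nm v / (n + n0).+1%:R.
  by rewrite nmZ nmV nm_nat mulrC.
pose K := 32 * M / (r / 2) ^+ 2 * nm v ^+ 2.
have K0 : 0 <= K by rewrite mulr_ge0 ?divr_ge0 ?mulr_ge0 ?exprn_ge0 ?nm_ge0// ltW.
have fnd n y : nm (y - z) < r / 2 -> nm (fn n y - dd f y v) <= K / (n + n0).+1%:R.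
  move=> yr; have hy : holb f y (r / 2) M.
    by apply: (holb_sub hf); move: yr; clear; lra.
  have vr : nm ((c n)^-1 *: v) < r / 2 / 4.
    by rewrite nmv; have := vn n; move: (nm v / _) r0 => q; clear; lra.
  have -> : fn n y - dd f y v = c n *: (f (y + (c n)^-1 *: v) - f y - dd f y ((c n)^-1 *: v)).
    by rewrite linearZ /= [in RHS]scalerBr scalerA mulfV// scale1r.
  rewrite nmZ nm_nat (le_trans (ler_wpM2l _ (holb_taylor2 r2 hy vr)))// nmv.
  have : (n + n0).+1%:R != 0 :> R by rewrite pnatr_eq0.
  rewrite le_eqVlt; move: (_.+1%:R) => N N0; apply/orP; left; apply/eqP; rewrite /K; field.
  by rewrite N0 gt_eqF.
apply: (@weierstrass fn _ z (r / 2) (K + 4 * M / r * nm v) r2).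
  move=> n y yr; split.
    apply: differentiableZ; apply: differentiableB.
      apply: (shift_diff _).1; apply: (hf _ _).1; rewrite addrAC (le_lt_trans (nmD _ _))// nmv.
      by have := vn n; move: (nm v / _) yr r0 => q; clear; lra.
    by apply: (hf _ _).1; move: yr r0; clear; lra.
  have -> : fn n y = (fn n y - dd f y v) + dd f y v by rewrite subrK.
  rewrite (le_trans (nmD _ _))// lerD//.
    rewrite (le_trans (fnd n y yr))// ler_piMr// invf_le1// ?ler1n ?ltr0n//.
  have hy : holb f y (r / 2) M by apply: (holb_sub hf); move: yr; clear; lra.
  rewrite (le_trans (holb_deriv v r2 hy))//.
  by rewrite le_eqVlt; apply/orP; left; apply/eqP; field; rewrite gt_eqF.
move=> e e0; exists (Num.truncn (K / e)) => n nn y /(fnd n) /le_trans; apply.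
rewrite ler_pdivrMr// mulrC -ler_pdivrMr//.
rewrite (le_trans (ltW (real_truncnS_gt (num_real _))))// ler_nat ltnS.
by rewrite (leq_trans nn)// leq_addr.
Qed.

End Slices.
End BoundedHolomorphic.

(** * Division by coordinate functions *)

Section Hadamard.
Variables (R : realType) (m : nat) (zeta : 'rV[(R[i] : numFieldType)]_m) (E : normedModType R[i]).
Local Notation C := R[i].
Local Notation V := 'rV[(R[i] : numFieldType)]_m.
Implicit Types (f : V -> E) (y : V) (i : 'I_m).

Definition dil (a : 'I_m -> C) (y : V) : V :=
  \row_j (zeta 0 j + a j * (y 0 j - zeta 0 j)).

Lemma nm_dil a y : (forall j, nm (a j) <= 1) -> nm (dil a y - zeta) <= nm (y - zeta).
Proof.
move=> a1; apply: nm_mx_le => [|k j]; first exact: nm_ge0.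
rewrite [k]ord1 !mxE addrAC subrr add0r nmM (le_trans (ler_piMl (nm_ge0 _) (a1 j)))//.
by have := nm_mx_coord (y - zeta) 0 j; rewrite !mxE.
Qed.

Lemma differentiable_dil (W : normedModType C) (g : V -> W) a y :
  (forall j, nm (a j) <= 1) -> differentiable g (dil a y) ->
  differentiable (fun z => g (dil a z)) y.
Proof.
move=> a1 dg; suff dd : differentiable (dil a) y by exact: (differentiable_comp dd dg).
pose D (h : V) : V := \row_j (a j * h 0 j).
have nD h : nm (D h) <= nm h.
  apply: nm_mx_le => [|k j]; first exact: nm_ge0.
  by rewrite !mxE nmM (le_trans (ler_piMl (nm_ge0 _) (a1 j)))// nm_mx_coord.
apply: (proj1 (approx_dd (D := D) _ _ _)).
- by move=> b x z; apply/rowP => j; rewrite !mxE; ring.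
- by exists 1 => h; rewrite mul1r.
- move=> e e0; exists 1 => // h _; rewrite (_ : _ - _ - _ = 0) ?nm0 ?mulr_ge0 ?nm_ge0 ?ltW//.
  by apply/rowP => j; rewrite !mxE; ring.
Qed.

Definition dil1 i (t : C) (j : 'I_m) : C := if j == i then t else 1.

Lemma nm_dil1 i t j : nm t <= 1 -> nm (dil1 i t j) <= 1.
Proof. by rewrite /dil1; case: eqP; rewrite // nm1. Qed.

Lemma dil1_1 i y : dil (dil1 i 1) y = y.
Proof. by apply/rowP => j; rewrite !mxE /dil1; case: eqP => _; ring. Qed.

Lemma dil1D i t s y : dil (dil1 i (t + s)) y =
  dil (dil1 i t) y + (s * (y 0 i - zeta 0 i)) *: delta_mx 0 i.
Proof.
apply/rowP => j; rewrite !mxE /dil1 eqxx /=; case: eqP => [->|_].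
  by rewrite mulr1; ring.
by rewrite mulr0 addr0.
Qed.

Lemma nm_delta i : nm (delta_mx 0 i : V) <= 1.
Proof.
apply: nm_mx_le => // k j; rewrite !mxE; case: (_ && _); first by rewrite nm1.
by rewrite nm0.
Qed.

(** The divided difference in the i-th coordinate between y and its projection to the hyperplane
    through zeta; on the hyperplane it is continued by the partial derivative. *)
Definition ddiff i f y : E :=
  if y 0 i == zeta 0 i then dd f y (delta_mx 0 i)
  else (y 0 i - zeta 0 i)^-1 *: (f y - f (dil (dil1 i 0) y)).

Lemma ddiffE i f y :
  f y - f (dil (dil1 i 0) y) = (y 0 i - zeta 0 i) *: ddiff i f y.
Proof.
rewrite /ddiff; case: eqP => [e|/eqP ne].
  rewrite e subrr scale0r (_ : dil _ y = y) ?subrr//.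
  by apply/rowP => j; rewrite !mxE /dil1; case: eqP => [->|_]; rewrite ?e; ring.
by rewrite scalerA divff ?scale1r// subr_eq0.
Qed.

(** Within r/2 of the hyperplane, the mean value inequality and Cauchy's estimate on discs of radius
    r/2 apply. Farther away, the crude bound 2M is divided by at least r/2. *)
Lemma nm_ddiff i f y (r M : R) : 0 < r -> holb f zeta r M -> nm (y - zeta) < r ->
  nm (ddiff i f y) <= 4 * M / r.
Proof.
move=> r0 hf yr; have r2 : 0 < r / 2 by rewrite divr_gt0.
have M0 := holb_ge0 r0 hf.
have dB w : nm (w - zeta) < r -> nm (w 0 i - zeta 0 i) < r / 2 ->
    nm (dd f w (delta_mx 0 i)) <= 4 * M / r.
  move=> wr wi.
  have inb l : nm l < r / 2 -> nm (w + l *: delta_mx 0 i - zeta) < r.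
    move=> lr; rewrite [ltRHS](_ : _ = Num.max (nm (w - zeta)) (nm (w 0 i - zeta 0 i) + nm l)
       + (r - Num.max (nm (w - zeta)) (nm (w 0 i - zeta 0 i) + nm l))); last by ring.
    rewrite ltr_pwDr//.
      by rewrite subr_gt0 gt_max wr/=; move: wi lr; clear; lra.
    apply: nm_mx_le => [|k j]; first by rewrite le_max nm_ge0.
    rewrite [k]ord1 !mxE eqxx /=; have [->|ji] := eqVneq j i.
      by rewrite mulr1 addrAC le_max nmD orbT.
    rewrite mulr0 addr0 le_max; apply/orP; left.
    by have := nm_mx_coord (w - zeta) 0 j; rewrite !mxE.
  have := @cauchy_slice R _ E f w (delta_mx 0 i) (r / 2) M r2.
  have -> : 4 * M / r = 2 * M / (r / 2) by field; rewrite gt_eqF.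
  rewrite ler_pdivlMr//; apply=> l /inb lr; first exact: (hf _ lr).1.
  exact: (hf _ lr).2.
have zr t : nm t <= 1 -> nm (dil (dil1 i t) y - zeta) < r.
  move=> t1; rewrite (le_lt_trans (nm_dil _ _))// => j; exact: nm_dil1.
have zi t : nm t <= 1 -> nm (dil (dil1 i t) y 0 i - zeta 0 i) <= nm (y 0 i - zeta 0 i).
  by move=> t1; rewrite !mxE /dil1 eqxx addrAC subrr add0r nmM ler_piMl// nm_ge0.
rewrite /ddiff; case: eqP => [e|/eqP ne].
  by apply: dB => //; rewrite e subrr nm0.
have c0 : 0 < nm (y 0 i - zeta 0 i).
  by rewrite lt_neqAle nm_ge0 andbT eq_sym nm_eq0 subr_eq0.
rewrite nmZ nmV mulrC ler_pdivrMr//.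
have [cr|rc] := ltP (nm (y 0 i - zeta 0 i)) (r / 2).
  have yE : y = dil (dil1 i 0) y + (y 0 i - zeta 0 i) *: delta_mx 0 i.
    by rewrite -{1}(dil1_1 i y) -[1]add0r dil1D mul1r.
  rewrite {1}yE; apply: segment_le => t /andP[t0 t1];
      rewrite scalerA -dil1D add0r; have nt : nm t%:C%C <= 1 by rewrite nm_real ger0_norm.
    exact: (hf _ (zr _ nt)).1.
  rewrite linearZ /= nmZ mulrC ler_pM2r//; apply: dB; first exact: zr.
  exact: (le_lt_trans (zi _ nt)).
apply: (@le_trans _ _ (M + M)).
  rewrite (le_trans (nmB _ _))// lerD//; first exact: (hf _ yr).2.
  by apply: (hf _ _).2; apply: zr; rewrite nm0.
have -> : M + M = 4 * M / r * (r / 2) by field; rewrite gt_eqF.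
by rewrite ler_wpM2l// divr_ge0 ?mulr_ge0// ltW.
Qed.

Hypothesis complE : ncomplete E.

(** The divided difference is the integral over t in [0, 1] of the partial derivative at the point
    whose i-th offset is scaled by t. Its Riemann sums [G N] are holomorphic and converge uniformly,
    so [weierstrass] applies. *)
Lemma differentiable_ddiff i f y (r M : R) : 0 < r -> holb f zeta r M -> nm (y - zeta) < r ->
  differentiable (ddiff i f) y.
Proof.
move=> r0 hf yr; pose s := (r - nm (y - zeta)) / 2.
have s0 : 0 < s by rewrite divr_gt0// subr_gt0.
have sr : s < r by rewrite /s; have := nm_ge0 (y - zeta); move: r0; clear; lra.
have M0 := holb_ge0 r0 hf.
have K0 : 0 <= 2 * M / s by apply: divr_ge0; [exact: mulr_ge0|exact: ltW].
pose c N : R := N.+1%:R; have c0 N : 0 < c N by rewrite ltr0n.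
pose t N (j : nat) : C := (j%:R / c N)%:C%C.
have t1 N j : (j <= N.+1)%N -> nm (t N j) <= 1.
  move=> jN; rewrite nm_real ger0_norm; first by rewrite ler_pdivrMr// mul1r ler_nat.
  by rewrite divr_ge0// ltW.
pose w N j z := dil (dil1 i (t N j)) z.
have zs z : nm (z - y) < s -> nm (z - zeta) < r - s.
  move=> zy; have -> : z - zeta = (z - y) + (y - zeta) by zmod.
  by rewrite (le_lt_trans (nmD _ _))//; move: zy; rewrite /s; clear; lra.
clearbody s.
have ws N j z : (j <= N.+1)%N -> nm (z - y) < s -> nm (w N j z - zeta) < r - s.
  move=> jN /zs; apply: le_lt_trans; apply: nm_dil => k; apply: nm_dil1; exact: t1.
have hw N j z : (j <= N.+1)%N -> nm (z - y) < s -> holb f (w N j z) s M.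
  move=> jN zy; apply: (holb_sub hf); have := ws N j z jN zy; clear; lra.
pose G N z : E := (c N)%:C%C^-1 *: \sum_(j < N.+1) dd f (w N j z) (delta_mx 0 i).
have GM N z : nm (z - y) < s -> nm (G N z) <= 2 * M / s.
  move=> zy; rewrite nmZ nmV nm_real gtr0_norm// mulrC ler_pdivrMr//.
  apply: (le_trans (nm_sum _ _ _)); apply: (@le_trans _ _ (\sum_(j < N.+1) (2 * M / s))).
    apply: ler_sum => j _; have := holb_deriv (delta_mx 0 i) s0 (hw N j z (ltnW (ltn_ord j)) zy).
    by move=> /le_trans; apply; rewrite ler_piMr ?nm_delta.
  by rewrite sumr_const card_ord mulr_natr.
have dG N z : nm (z - y) < s -> differentiable (G N) z.
  move=> zy; apply: differentiableZ.
  pose F (j : 'I_N.+1) z := dd f (w N j z) (delta_mx 0 i).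
  rewrite [X in differentiable X _](_ : _ = \sum_(j < N.+1) F j); last first.
    by apply/funext => x; rewrite fct_sumE.
  apply: differentiable_sum => j; have jN := ltnW (ltn_ord j).
  apply: (differentiable_dil (g := fun z => dd f z (delta_mx 0 i))) => [k|].
    exact/nm_dil1/t1.
  by apply: deriv_differentiable (s0) (hw N j z jN zy).
(* The increment of f telescopes over N+1 equal steps; linearizing each costs O(1/N^2), hence O(1/N)
   altogether. *)
have GS N z : 4 * r < s * c N -> nm (z - y) < s ->
    nm (G N z - ddiff i f z) <= 32 * M / s ^+ 2 * r / c N.
  move=> Nr zy; have rhs0 : 0 <= 32 * M / s ^+ 2 * r / c N.
    by rewrite !mulr_ge0 ?invr_ge0 ?exprn_ge0 ?(ltW s0) ?(ltW r0) ?(ltW (c0 N)).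
  pose d := z 0 i - zeta 0 i.
  have dr : nm d < r.
    have := nm_mx_coord (z - zeta) 0 i; rewrite !mxE => /le_lt_trans; apply.
    by rewrite (lt_trans (zs z zy))// ltrBlDr ltrDl.
  have [d0|dn0] := eqVneq d 0.
    have zi : z 0 i = zeta 0 i by apply/eqP; rewrite -subr_eq0 -/d d0.
    have wz N' j : w N' j z = z.
      apply/rowP => k; rewrite !mxE /dil1; case: eqP => [->|_]; last by ring.
      by rewrite zi subrr mulr0 addr0.
    rewrite /G /ddiff zi eqxx (eq_bigr (fun=> dd f z (delta_mx 0 i))); last first.
      by move=> j _; rewrite wz.
    rewrite sumr_const card_ord -scaler_nat scalerA (_ : (c N)%:C%C = N.+1%:R); last first.
      by rewrite /c rmorph_nat.
    by rewrite mulVf ?pnatr_eq0// scale1r subrr nm0.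
  have nd0 : 0 < nm d by rewrite lt_neqAle nm_ge0 andbT eq_sym nm_eq0.
  rewrite -(ler_pM2l nd0) -nmZ scalerBr -ddiffE.
  have ddE : d *: G N z = \sum_(j < N.+1) dd f (w N j z) ((d / (c N)%:C%C) *: delta_mx 0 i).
    by rewrite /G scalerA scaler_sumr; apply: eq_bigr => j _; rewrite linearZ.
  have tel : f z - f (dil (dil1 i 0) z) = \sum_(j < N.+1) (f (w N j.+1 z) - f (w N j z)).
    rewrite -(big_mkord xpredT (fun j => f (w N j.+1 z) - f (w N j z))).
    rewrite telescope_sumr// /w /t mul0r divff ?gt_eqF//.
    by rewrite [_%:C%C](_ : _ = 1)// dil1_1.
  have hn : nm ((d / (c N)%:C%C) *: delta_mx 0 i : V) <= nm d / c N.
    rewrite nmZ nmM nmV nm_real gtr0_norm// ler_piMr ?nm_delta//.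
    by rewrite divr_ge0 ?nm_ge0 ?(ltW (c0 N)).
  rewrite ddE tel -sumrB (le_trans (nm_sum _ _ _))//.
  apply: (@le_trans _ _ (\sum_(j < N.+1) (32 * M / s ^+ 2 * (nm d / c N) ^+ 2))).
    apply: ler_sum => j _; have jN := ltn_ord j.
    have -> : w N j.+1 z = w N j z + (d / (c N)%:C%C) *: delta_mx 0 i.
      rewrite /w [t N j.+1](_ : _ = t N j + (c N)%:C%C^-1) ?dil1D; last first.
        by rewrite /t -addn1 natrD mulrDl mul1r rmorphD fmorphV.
      by rewrite mulrC.
    rewrite nmBC; apply: le_trans (holb_taylor2 s0 (hw N j z (ltnW jN) zy) _) _.
      apply: (le_lt_trans hn); rewrite ltr_pdivrMr//.
      by move: dr Nr; clear; lra.
    rewrite ler_wpM2l ?divr_ge0 ?mulr_ge0 ?exprn_ge0 ?(ltW s0)//.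
    by rewrite lerXn2r// nnegrE ?nm_ge0// divr_ge0 ?nm_ge0 ?(ltW (c0 N)).
  rewrite sumr_const card_ord -[X in X <= _]mulr_natl -/(c N).
  have -> : c N * (32 * M / s ^+ 2 * (nm d / c N) ^+ 2) =
      nm d * (32 * M / s ^+ 2 * nm d / c N).
    by move: (c N) (c0 N) => b b0; field; rewrite !gt_eqF.
  rewrite ler_pM2l// ler_wpM2r ?invr_ge0 ?(ltW (c0 N))//.
  by rewrite ler_wpM2l ?(ltW dr)// divr_ge0 ?mulr_ge0 ?exprn_ge0 ?(ltW s0).
apply: (@weierstrass _ _ _ complE G _ y s (2 * M / s) s0).
  by move=> N z zy; split; [exact: dG|exact: GM].
move=> e e0.
pose N0 := Num.truncn (4 * r / s); pose N1 := Num.truncn (32 * M / s ^+ 2 * r / e).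
exists (maxn N0 N1) => N; rewrite geq_max => /andP[NN0 NN1] z zy.
apply: (le_trans (GS N z _ zy)).
  rewrite [ltRHS]mulrC -ltr_pdivrMr//; apply: (lt_le_trans (real_truncnS_gt (num_real _))).
  by rewrite /c ler_nat ltnS.
rewrite ler_pdivrMr// [leRHS]mulrC -ler_pdivrMr//.
apply: (le_trans (ltW (real_truncnS_gt (num_real _)))).
by rewrite /c ler_nat ltnS.
Qed.

(* Setting the first [i] coordinates to their values at [zeta] before dividing  *)
(* keeps the bound on the ball of [f] itself, without shrinking it.             *)
Definition hterm i f y : E := ddiff i f (dil (fun j => (i <= j)%:R) y).

Lemma holb_hterm i f (r M : R) : 0 < r -> holb f zeta r M -> holb (hterm i f) zeta r (4 * M / r).
Proof.
move=> r0 hf y yr.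
have b1 (j : 'I_m) : nm ((i <= j)%:R : C) <= 1 by case: (i <= j)%N; rewrite ?nm1 ?nm0.
have yr' := le_lt_trans (nm_dil y b1) yr.
split; last exact: (nm_ddiff _ r0).
by apply: differentiable_dil => //; exact: (differentiable_ddiff _ r0 hf).
Qed.

(** Telescoping: the coordinates are moved to those of zeta one at a time. *)
Lemma hadamard f y : f y = f zeta + \sum_i (y 0 i - zeta 0 i) *: hterm i f y.
Proof.
pose P (k : nat) : V := dil (fun j => (k <= j)%:R) y.
have tel : \sum_(i < m) (f (P i.+1) - f (P i)) = f zeta - f y.
  rewrite -(big_mkord xpredT (fun k => f (P k.+1) - f (P k))) telescope_sumr//.
  congr (f _ - f _); apply/rowP => j; rewrite !mxE.
    by rewrite leqNgt ltn_ord /= mul0r addr0.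
  by rewrite leq0n mul1r addrC subrK.
rewrite (eq_bigr (fun i : 'I_m => - (f (P i.+1) - f (P i)))); last first.
  move=> i _; rewrite opprB.
  have -> : P i.+1 = dil (dil1 i 0) (P i).
    apply/rowP => j; rewrite !mxE /dil1; case: eqP => [->|/eqP ji].
      by rewrite ltnn leqnn /=; ring.
    by rewrite ltn_neqAle eq_sym ji /=; ring.
  by rewrite ddiffE !mxE leqnn mul1r addrAC subrr add0r.
by rewrite sumrN tel; zmod.
Qed.

End Hadamard.

(** * Power series as Dirichlet series *)

Section Smooth.

Lemma nprime_subproof : {f : nat -> nat | forall k, prime (f k) & forall k, (f k < f k.+1)%N}.
Proof.
exists (fun k => iter k (fun p => s2val (prime_above p)) 2).
  by case=> [|k]; [|rewrite iterS; case: (prime_above _)].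
by move=> k; rewrite iterS; case: (prime_above _).
Qed.

(** Primes name the variables: unique factorization identifies exponent vectors with integers, and
    sizes of integers serve as weights. *)
Definition nprime : nat -> nat := s2val nprime_subproof.

Lemma nprime_prime k : prime (nprime k).
Proof. by rewrite /nprime; case: nprime_subproof => f /=. Qed.

Lemma nprime_gt1 k : (1 < nprime k)%N.
Proof. exact: prime_gt1 (nprime_prime k). Qed.

Lemma nprime_gt0 k : (0 < nprime k)%N.
Proof. exact: prime_gt0 (nprime_prime k). Qed.

Lemma nprime_ltS k : (nprime k < nprime k.+1)%N.
Proof. by rewrite /nprime; case: nprime_subproof => f /= _. Qed.

Lemma nprime_mono : {mono nprime : j k / (j <= k)%N}.
Proof.
have h := @homo_ltn nat nprime (fun x y => (x < y)%N) (fun y x z => @ltn_trans y x z) nprime_ltS.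
exact: leq_mono h.
Qed.

Lemma nprime_inj : injective nprime.
Proof. by move=> j k jk; apply/eqP; rewrite eqn_leq -(nprime_mono j k) -(nprime_mono k j) jk leqnn. Qed.

Definition sprimes (m : nat) : nat_pred := [pred p | p \in [seq nprime i | i <- iota 0 m]].

Definition smooth (m d : nat) := (sprimes m).-nat d.

Lemma sprimesP m p : reflect (exists i : 'I_m, p = nprime i) (p \in sprimes m).
Proof.
apply: (iffP mapP) => [[k]|[k ->]].
  by rewrite mem_iota add0n => /andP[_ km] ->; exists (Ordinal km).
by exists (val k); rewrite // mem_iota add0n leq0n ltn_ord.
Qed.

Lemma smoothM m d e : smooth m (d * e) = smooth m d && smooth m e.
Proof. exact: pnatM. Qed.

Lemma smooth_nprime m (i : 'I_m) : smooth m (nprime i).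
Proof. by rewrite /smooth pnatE ?nprime_prime//; apply/sprimesP; exists i. Qed.

Lemma smooth_gt0 m d : smooth m d -> (0 < d)%N.
Proof. by case/andP. Qed.

Lemma smooth_ind m (P : nat -> Prop) : P 1%N ->
  (forall (i : 'I_m) d, smooth m d -> P d -> P (nprime i * d)%N) ->
  forall d, smooth m d -> P d.
Proof.
move=> P1 PM d; elim/ltn_ind: d => d IH sd; have d0 := smooth_gt0 sd.
have [->//|d1] := eqVneq d 1%N.
have dgt1 : (1 < d)%N by rewrite ltn_neqAle eq_sym d1.
have /sprimesP[i pi] : pdiv d \in sprimes m.
  by move: sd => /pnatP => /(_ d0); apply; [exact: pdiv_prime|exact: pdiv_dvd].
have /dvdnP[k dk] : (nprime i %| d)%N by rewrite -pi pdiv_dvd.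
rewrite dk mulnC; move: sd; rewrite dk smoothM => /andP[sk _].
apply: PM => //; apply: IH => //; rewrite dk ltn_Pmulr ?nprime_gt1//.
exact: smooth_gt0 sk.
Qed.

Lemma sum_dvdn (E : nmodType) (F : nat -> E) n p : (0 < p)%N ->
  \sum_(1 <= d < n.+1 | (p %| d)%N) F d = \sum_(1 <= d < (n %/ p).+1) F (p * d)%N.
Proof.
move=> p0; elim: n => [|n IH]; first by rewrite div0n !big_geq.
rewrite big_mkcond big_nat_recr//= -big_mkcond/= IH divnS//.
case: ifP => [pn|_]; last by rewrite add0n addr0.
rewrite add1n [in RHS]big_nat_recr//=; congr (_ + F _).
by rewrite -{1}(divnK pn) divnS// pn mulnC.
Qed.

End Smooth.

(** * Monomials as completely multiplicative functions *)

Section Monomials.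
Variables (R : realType) (m : nat).
Local Notation C := R[i].
Local Notation V := 'rV[(R[i] : numFieldType)]_m.

(** The monomial in x whose exponents are the prime valuations of d. *)
Definition chi (x : V) (d : nat) : C :=
  if smooth m d then \prod_(i < m) x 0 i ^+ logn (nprime i) d else 0.

Lemma chi1 x : chi x 1 = 1.
Proof. by rewrite /chi /smooth (_ : _.-nat 1) ?big1// => i _; rewrite logn1. Qed.

Lemma chiM x d e : chi x (d * e) = chi x d * chi x e.
Proof.
rewrite /chi smoothM; have [sd|] := boolP (smooth m d); last by rewrite mul0r.
have [se|] := boolP (smooth m e); last by rewrite mulr0.
rewrite -big_split; apply: eq_bigr => i _.
by rewrite lognM ?(smooth_gt0 sd) ?(smooth_gt0 se)// exprD.
Qed.

Lemma chi_nprime x (i : 'I_m) : chi x (nprime i) = x 0 i.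
Proof.
rewrite /chi smooth_nprime (bigD1 i)//= logn_prime ?nprime_prime// eqxx big1 ?mulr1//.
move=> j ji; rewrite logn_prime ?nprime_prime// (inj_eq nprime_inj).
by rewrite [_ == _ :> nat](negbTE ji).
Qed.

Lemma chi_nsmooth x d : ~~ smooth m d -> chi x d = 0.
Proof. by rewrite /chi => /negbTE ->. Qed.

(** These radii turn the bound on all monomials into the single power d^-s ([nm_chi]). *)
Definition polydisc (s : nat) (x : V) := forall i, nm (x 0 i) <= (nprime i)%:R ^- s.

Lemma natr_exp_gt0 d s : (0 < d)%N -> 0 < d%:R ^+ s :> R.
Proof. by move=> d0; rewrite exprn_gt0// ltr0n. Qed.

Lemma nm_chi x s d : polydisc s x -> (0 < d)%N -> nm (chi x d) <= d%:R ^- s.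
Proof.
move=> xs d0; have [sd|/chi_nsmooth->] := boolP (smooth m d); last first.
  by rewrite nm0 invr_ge0 ltW// natr_exp_gt0.
move: d sd {d0}; apply: smooth_ind => [|i d sd IH].
  by rewrite chi1 nm1 expr1n invr1.
rewrite chiM chi_nprime nmM natrM exprMn invfM.
by rewrite ler_pM ?nm_ge0.
Qed.

Lemma polydisc_le s s' x : (s <= s')%N -> polydisc s' x -> polydisc s x.
Proof.
move=> ss xs i; apply: (le_trans (xs i)); rewrite lef_pV2 ?posrE ?natr_exp_gt0 ?nprime_gt0//.
by rewrite ler_weXn2l// ler1n nprime_gt0.
Qed.

Lemma nm_polydisc s x : polydisc s x -> nm x <= 2 ^- s.
Proof.
move=> xs; apply: nm_mx_le => [|k i]; first by rewrite invr_ge0 exprn_ge0.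
rewrite [k]ord1 (le_trans (xs i))// lef_pV2 ?posrE ?natr_exp_gt0 ?nprime_gt0 ?exprn_gt0//.
by rewrite lerXn2r ?nnegrE ?ler0n// ler_nat nprime_gt1.
Qed.

Lemma polydisc_small s x : nm x <= (nprime m)%:R ^- s -> polydisc s x.
Proof.
move=> xs i; apply: (le_trans (nm_mx_coord x 0 i)); apply: (le_trans xs).
rewrite lef_pV2 ?posrE ?natr_exp_gt0 ?nprime_gt0//.
by rewrite lerXn2r ?nnegrE ?ler0n// ler_nat nprime_mono ltnW.
Qed.

(** The point of the polydisc at which every monomial attains its bound; coefficients are extracted
    there. *)
Definition corner (s : nat) : V := \row_i ((nprime i)%:R ^- s).

Lemma chi_corner s d : smooth m d -> chi (corner s) d = d%:R ^- s.
Proof.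
move: d; apply: smooth_ind => [|i d sd IH]; first by rewrite chi1 expr1n invr1.
by rewrite chiM chi_nprime IH mxE natrM exprMn invfM.
Qed.

Lemma nm_natX d s : nm (d%:R ^- s : C) = d%:R ^- s.
Proof. by rewrite nmV nmX nm_nat. Qed.

Lemma polydisc_corner s : polydisc s (corner s).
Proof. by move=> i; rewrite mxE nm_natX. Qed.

Lemma differentiable_chi (zeta y : V) d :
  differentiable (fun y => chi (y - zeta) d : C^o) y.
Proof.
have [sd|/chi_nsmooth nd] := boolP (smooth m d); last first.
  rewrite (_ : (fun _ => _) = cst 0); first exact: differentiable_cst.
  by apply/funext => x; rewrite nd.
move: d sd; apply: smooth_ind => [|i d sd IH].
  rewrite (_ : (fun _ => _) = cst 1); first exact: differentiable_cst.
  by apply/funext => x; rewrite chi1.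
rewrite (_ : (fun _ => _) = (fun x : V => ((x 0 i - zeta 0 i) : C^o) *: (chi (x - zeta) d : C^o))).
  apply: differentiable_scaler; last exact: IH.
  apply: differentiableB; first exact: differentiable_coord.
  exact: differentiable_cst.
by apply/funext => x; rewrite chiM chi_nprime !mxE.
Qed.

End Monomials.

(** * Expansions with remainder and their uniqueness *)

Section Expansions.
Variables (R : realType) (m : nat) (zeta : 'rV[(R[i] : numFieldType)]_m).
Local Notation C := R[i].
Local Notation V := 'rV[(R[i] : numFieldType)]_m.

Section Expand.
Variable E : normedModType C.
Implicit Types (f : V -> E) (a : nat -> E).

(* Bohr's lift: a power series in [m] variables is indexed by the smooth         *)
(* integers, and the radii [p_i^-s] turn it into a Dirichlet series at [s].       *)
Definition expands f a (M : R) (s : nat) := forall e x N,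
  polydisc (s + e) x -> (0 < N)%N ->
  nm (f (zeta + x) - \sum_(1 <= d < N) chi x d *: a d) <= M / N%:R ^+ e.

Definition smooth_supp a := forall d, ~~ smooth m d -> a d = 0.

Definition growth a (M : R) (s : nat) := forall d, nm (a d) <= M * d%:R ^+ s.

Lemma ltr_div_pow (N : nat) (M : R) e e' : 0 <= M -> (0 < N)%N -> (e <= e')%N ->
  M / N%:R ^+ e' <= M / N%:R ^+ e.
Proof.
move=> M0 N0 ee; rewrite ler_wpM2l// lef_pV2 ?posrE ?natr_exp_gt0//.
by rewrite ler_weXn2l// ler1n.
Qed.

Lemma expands_ge0 f a M s : expands f a M s -> 0 <= M.
Proof.
move=> fa; have := fa 0%N (corner R m s) 1%N; rewrite addn0 expr0 divr1.
by move=> /(_ (@polydisc_corner R m s) isT); exact/le_trans/nm_ge0.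
Qed.

Lemma expands_mono f a M s M' s' : expands f a M s -> M <= M' -> (s <= s')%N ->
  expands f a M' s'.
Proof.
move=> fa MM ss e x N xs N0.
have := fa (s' - s + e)%N x N; rewrite addnA subnKC// => /(_ xs N0)/le_trans; apply.
apply: (le_trans (ltr_div_pow (expands_ge0 fa) N0 (leq_addl (s' - s) e))).
by rewrite ler_wpM2r// invr_ge0 exprn_ge0.
Qed.

Lemma expands_near f g a M s : (\forall y \near zeta, f y = g y) ->
  expands f a M s -> exists s', expands g a M s'.
Proof.
move=> /nm_nearP[e e0 fg] fa; have [k ke] := half_pow_le ler01 (divr_gt0 e0 (ltr0n _ 2)).
exists (s + k)%N => e' x N xs N0; rewrite -fg.
  exact: (expands_mono fa (lexx _) (leq_addr k s)).
rewrite addrAC subrr add0r; have xk : polydisc k x.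
  by apply: polydisc_le xs; rewrite addnAC leq_addl.
rewrite (le_lt_trans (nm_polydisc xk))// -[_^-1]div1r (le_lt_trans ke)//.
by rewrite ltr_pdivrMr// ltr_pMr// ltr1n.
Qed.

(** Two consecutive partial sums at the corner isolate one term. *)
Lemma expands_growth f a M s : smooth_supp a -> expands f a M s -> growth a (2 * M) s.
Proof.
move=> a0 fa d; have [sd|/a0->] := boolP (smooth m d); last first.
  by rewrite nm0 mulr_ge0 ?exprn_ge0// mulr_ge0// (expands_ge0 fa).
have d0 := smooth_gt0 sd; pose x := corner R m s.
have xs : polydisc (s + 0) x by rewrite addn0; exact: (@polydisc_corner R m).
have := fa 0%N x d xs d0; have := fa 0%N x d.+1 xs isT.
rewrite big_nat_recr//= !expr0 !divr1; set S := \sum_(_ <= _ < _) _ => h1 h2.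
have h : nm (chi x d *: a d) <= 2 * M.
  have -> : chi x d *: a d = (f (zeta + x) - S) - (f (zeta + x) - (S + chi x d *: a d)).
    by clearbody S; move: (chi x d *: a d) (f _) => u v; zmod.
  by rewrite (le_trans (nmB _ _))// mulr_natl mulr2n lerD.
rewrite nmZ /x chi_corner// nm_natX mulrC ler_pdivrMr ?natr_exp_gt0// in h.
Qed.

Lemma geom_small (q K e : R) : 0 <= q < 1 -> 0 < e -> exists k, K * q ^+ k <= e.
Proof.
move=> /andP[q0 q1] e0; have [K0|K0] := ltP 0 K; last first.
  by exists 0%N; rewrite expr0 mulr1 (le_trans K0)// ltW.
have : q ^+ n @[n --> \oo] --> 0 by apply: cvg_expr; rewrite ger0_norm.
move=> /cvgrPdist_le /(_ (e / K) (divr_gt0 e0 K0))[k _ /(_ k (leqnn _))].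
rewrite sub0r normrN ger0_norm ?exprn_ge0// => h; exists k.
by rewrite mulrC -ler_pdivlMr.
Qed.

(** At the first index d of disagreement, evaluate at smaller and smaller corners: the d-th terms
    scale like d^-k, the remainders like (d+1)^-k. *)
Lemma expands_inj f a b M s N s' : smooth_supp a -> smooth_supp b ->
  expands f a M s -> expands f b N s' -> a =1 b.
Proof.
move=> a0 b0 fa fb d; elim/ltn_ind: d => d IH.
have [sd|nd] := boolP (smooth m d); last by rewrite a0// b0.
have d0 := smooth_gt0 sd; apply/eqP; rewrite -subr_eq0 -nm_eq0 eq_le nm_ge0 andbT.
apply/ler_addgt0Pr => e e0; rewrite add0r.
pose t := maxn s s'.
have q01 : 0 <= (d%:R / d.+1%:R : R) < 1.
  by rewrite divr_ge0//= ltr_pdivrMr// mul1r ltr_nat.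
have [k kP] := geom_small ((M + N) * d%:R ^+ t) q01 e0.
pose x := corner R m (t + k).
have xt : polydisc (t + k) x by exact: (@polydisc_corner R m).
have M0 := expands_ge0 fa; have N0 := expands_ge0 fb.
have fat : expands f a M t := expands_mono fa (lexx _) (leq_maxl s s').
have fbt : expands f b N t := expands_mono fb (lexx _) (leq_maxr s s').
have := fat k x d.+1 xt isT; have := fbt k x d.+1 xt isT.
rewrite !big_nat_recr//=.
rewrite (eq_big_nat _ _ (F2 := fun d => chi x d *: a d)) => [|i /andP[_ id]]; last by rewrite IH.
set S := \sum_(_ <= _ < _) _ => h1 h2.
have : nm (chi x d *: (a d - b d)) <= (M + N) / d.+1%:R ^+ k.
  rewrite scalerBr.
  have -> : chi x d *: a d - chi x d *: b d = (f (zeta + x) - (S + chi x d *: b d)) -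
     (f (zeta + x) - (S + chi x d *: a d)).
    by clearbody S; move: (chi x d *: a d) (chi x d *: b d) (f _) => u v w; zmod.
  by rewrite (le_trans (nmB _ _))// addrC mulrDl lerD.
rewrite nmZ /x chi_corner// nm_natX mulrC ler_pdivrMr ?natr_exp_gt0// => /le_trans; apply.
rewrite (le_trans _ kP)// exprD expr_div_n le_eqVlt; apply/orP; left; apply/eqP.
by move: (_ ^+ k) (_ ^+ t) => u v; ring.
Qed.

Lemma expands_eq0 f M s : expands f (fun=> 0) M s ->
  \forall y \near zeta, f y = 0.
Proof.
move=> f0; have r0 : 0 < (nprime m)%:R ^- (s + 1) :> R.
  by rewrite invr_gt0 natr_exp_gt0// nprime_gt0.
apply/nm_nearP; exists ((nprime m)%:R ^- (s + 1)) => // y yr.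
have xs : polydisc (s + 1) (y - zeta) by apply: polydisc_small; exact: ltW.
apply/eqP; rewrite -nm_eq0 eq_le nm_ge0 andbT; apply/ler_addgt0Pr => e e0; rewrite add0r.
pose N := (Num.truncn (M / e)).+1.
have := f0 1%N _ N xs isT; rewrite (addrC zeta) subrK big1 => [|i _]; last by rewrite scaler0.
rewrite subr0 expr1 => /le_trans; apply.
rewrite ler_pdivrMr// [leRHS]mulrC -ler_pdivrMr//.
exact/ltW/real_truncnS_gt/num_real.
Qed.

End Expand.
End Expansions.

(** * Convergence and products of expansions *)

Section ExpansionOperations.
Variables (R : realType) (m : nat) (zeta : 'rV[(R[i] : numFieldType)]_m).
Local Notation C := R[i].
Local Notation V := 'rV[(R[i] : numFieldType)]_m.

Lemma sum_inv_sqr (N N' : nat) :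
  \sum_(N <= d < N' | (0 < d)%N) (d%:R ^- 2 : R) <= 2.
Proof.
have h n : \sum_(0 <= d < n.+2 | (0 < d)%N) (d%:R ^- 2 : R) <= 2 - n.+1%:R^-1.
  elim: n => [|n IH].
    by rewrite big_mkcond big_nat_recr//= big_nat1/= add0r expr1n invr1; lra.
  rewrite big_mkcond big_nat_recr//= -big_mkcond/=.
  apply: (le_trans (lerD IH (lexx _))).
  have n0 : 0 < n.+1%:R :> R by rewrite ltr0n.
  rewrite -[n.+2%:R]natr1; move: (n.+1%:R) n0 => x x0.
  have x1 : 0 < x + 1 by rewrite addr_gt0.
  rewrite -subr_ge0 (_ : _ - _ = (x * (x + 1) ^+ 2)^-1).
    by rewrite invr_ge0 mulr_ge0 ?exprn_ge0 ?ltW.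
  by field; rewrite !gt_eqF.
have ge0 a b : 0 <= \sum_(a <= d < b | (0 < d)%N) (d%:R ^- 2 : R).
  by rewrite sumr_ge0// => i _; rewrite invr_ge0 exprn_ge0.
have [NN'|N'N] := leqP N N'; last by rewrite big_geq// ltnW.
apply: (@le_trans _ _ (\sum_(0 <= d < N' | (0 < d)%N) (d%:R ^- 2 : R))).
  by rewrite [leRHS](@big_cat_nat _ _ _ N)//= lerDr ge0.
apply: (@le_trans _ _ (\sum_(0 <= d < N'.+2 | (0 < d)%N) (d%:R ^- 2 : R))).
  rewrite [leRHS](@big_cat_nat _ _ _ N')//= ?lerDl ?ge0//.
  by rewrite -addn2 leq_addr.
by rewrite (le_trans (h N'))// gerBl invr_ge0.
Qed.

Section Series.
Variable E : normedModType C.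

(** Two extra powers of the radius make the terms summable like d^-2; the remaining e powers give
    the decay in N. *)
Lemma tail_bound (u : nat -> E) (A : R) s e (x : V) N N' : 0 <= A -> (0 < N)%N ->
  (forall d, nm (u d) <= A * d%:R ^+ s) -> polydisc (s + 2 + e) x ->
  nm (\sum_(N <= d < N') chi x d *: u d) <= 2 * A / N%:R ^+ e.
Proof.
move=> A0 N0 uA xs; rewrite (le_trans (nm_sum _ _ _))//.
apply: (@le_trans _ _ (\sum_(N <= d < N') A / N%:R ^+ e * d%:R ^- 2)).
  rewrite big_nat_cond [leRHS]big_nat_cond; apply: ler_sum => d /andP[/andP[Nd _] _].
  have d0 : (0 < d)%N by exact: leq_trans Nd.
  rewrite nmZ (@le_trans _ _ (d%:R ^- (s + 2 + e) * (A * d%:R ^+ s)))//.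
    by rewrite ler_pM ?nm_ge0// nm_chi.
  have -> : d%:R ^- (s + 2 + e) * (A * d%:R ^+ s) = A / d%:R ^+ e * d%:R ^- 2 :> R.
    rewrite !exprD; have : d%:R != 0 :> R by rewrite pnatr_eq0 -lt0n.
    move: (d%:R : R) => y y0; move: (expf_neq0 s y0) (expf_neq0 e y0).
    by move: (y ^+ s) (y ^+ e) => v w v0 w0; field; rewrite v0 w0 y0.
  rewrite ler_wpM2r ?invr_ge0 ?exprn_ge0// ler_wpM2l//.
  rewrite lef_pV2 ?posrE ?natr_exp_gt0//.
  by rewrite lerXn2r ?nnegrE ?ler0n// ler_nat.
rewrite -mulr_sumr (_ : 2 * A / _ = A / N%:R ^+ e * 2); last by ring.
rewrite ler_wpM2l ?divr_ge0 ?exprn_ge0//; have := sum_inv_sqr N N'; apply: le_trans.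
rewrite big_nat_cond [leRHS]big_nat_cond le_eqVlt; apply/orP; left; apply/eqP.
apply: eq_bigl => d; rewrite andbT; case: (leqP N d) => //= Nd.
by rewrite (leq_trans N0 Nd) andbT.
Qed.

Hypothesis complE : ncomplete E.

Lemma differentiable_partial (u : nat -> V -> E) y N :
  (forall d, differentiable (u d) y) ->
  differentiable (fun y => \sum_(1 <= d < N) chi (y - zeta) d *: u d y) y.
Proof.
move=> du.
elim: N => [|N IH].
  rewrite (_ : (fun _ => _) = cst 0); first exact: differentiable_cst.
  by apply/funext => x; rewrite big_geq.
case: N IH => [|N] IH.
  rewrite (_ : (fun _ => _) = cst 0); first exact: differentiable_cst.
  by apply/funext => x; rewrite big_geq.
rewrite (_ : (fun _ => _) = (fun y => (\sum_(1 <= d < N.+1) chi (y - zeta) d *: u d y) +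
    chi (y - zeta) N.+1 *: u N.+1 y)).
  apply: (differentiableD IH); apply: differentiable_scaler => //.
  exact: differentiable_chi.
by apply/funext => x; rewrite big_nat_recr.
Qed.

(** The coefficients may vary with the point. Constant ones realize prescribed Taylor coefficients;
    coefficients L_d(f(y)) later define psi. *)
Lemma bohr_series (u : nat -> V -> E) (r A : R) s : 0 < r -> 0 <= A ->
  (forall d y, nm (y - zeta) < r ->
     differentiable (u d) y /\ nm (u d y) <= A * d%:R ^+ s) ->
  exists F : V -> E, holomorphic_at zeta F /\
    exists s', forall e x N, polydisc (s' + e) x -> (0 < N)%N ->
    nm (F (zeta + x) - \sum_(1 <= d < N) chi x d *: u d (zeta + x)) <=
      2 * A / N%:R ^+ e.
Proof.
move=> r0 A0 hu; pose S N y := \sum_(1 <= d < N) chi (y - zeta) d *: u d y.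
have Sd N N' y : (0 < N)%N -> (N <= N')%N ->
    S N' y - S N y = \sum_(N <= d < N') chi (y - zeta) d *: u d y.
  move=> N0 NN; rewrite [S N' y](_ : _ = S N y + \sum_(N <= d < N') chi (y - zeta) d *: u d y).
    by rewrite (addrC (S N y)) addrK.
  by rewrite /S (@big_cat_nat _ _ _ N).
have [k kr] := half_pow_le ler01 (divr_gt0 r0 (ltr0n _ 2)).
(* s compensates the growth, 2 gives summability, 1 gives decay 1/N even when e = 0, and k keeps the
   polydisc inside the ball of radius r. *)
pose t := (s + 3 + k)%N.
have inr e y : polydisc (t + e) (y - zeta) -> nm (y - zeta) < r.
  move=> yt; have yk : polydisc k (y - zeta).
    by apply: polydisc_le yt; rewrite /t addnAC leq_addl.
  rewrite (le_lt_trans (nm_polydisc yk))// -[_^-1]div1r (le_lt_trans kr)//.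
  by rewrite ltr_pdivrMr// ltr_pMr// ltr1n.
have SB e N N' y : (0 < N)%N -> (N <= N')%N -> polydisc (t + e) (y - zeta) ->
    nm (S N' y - S N y) <= 2 * A / N%:R ^+ (e + 1).
  move=> N0 NN yt; rewrite Sd//; apply: (tail_bound (s := s)) => //.
    by move=> d; apply: (hu d y _).2; exact: inr yt.
  by apply: polydisc_le yt; rewrite /t; lia.
have cS y : polydisc t (y - zeta) -> exists l, ncvg (S ^~ y) l.
  move=> yt; apply: complE => e e0.
  pose n0 := (Num.truncn (2 * A / e)).+1; exists n0.
  have n0P : 2 * A / n0%:R <= e.
    rewrite ler_pdivrMr ?ltr0n// [leRHS]mulrC -ler_pdivrMr//.
    exact/ltW/real_truncnS_gt/num_real.
  have aux n n' : (n0 <= n)%N -> (n <= n')%N -> nm (S n' y - S n y) <= e.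
    move=> n0n nn'; have n_gt0 : (0 < n)%N by exact: leq_trans n0n.
    apply: (le_trans (SB 0%N n n' y n_gt0 nn' _)); first by rewrite addn0.
    apply: le_trans n0P; rewrite add0n expr1 ler_wpM2l ?mulr_ge0//.
    by rewrite lef_pV2 ?posrE ?ltr0n// ler_nat.
  move=> n n' n0n n0n'; have [nn|/ltnW nn] := leqP n n'; last exact: aux.
  by rewrite nmBC aux.
have /choice[F FP] : forall y, exists l, polydisc t (y - zeta) -> ncvg (S ^~ y) l.
  move=> y; have [/cS[l lP]|ny] := pselect (polydisc t (y - zeta)); first by exists l.
  by exists 0.
have FS e N y : (0 < N)%N -> polydisc (t + e) (y - zeta) ->
    nm (F y - S N y) <= 2 * A / N%:R ^+ (e + 1).
  move=> N0 yt; have yt0 : polydisc t (y - zeta) by apply: polydisc_le yt; rewrite leq_addr.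
  have cst_cvg : ncvg (fun=> S N y) (S N y).
    by move=> e' e0; exists 0%N => n _; rewrite subrr nm0 ltW.
  apply: (ncvg_le (n0 := N) _ (ncvgB (FP _ yt0) cst_cvg)) => n Nn.
  exact: SB.
exists F; split; last first.
  exists t => e x N xt N0.
  have xE : x = (zeta + x) - zeta by rewrite addrAC subrr add0r.
  have := FS e N (zeta + x) N0; rewrite /S -xE => /(_ xt) /le_trans; apply.
  by apply: ltr_div_pow; rewrite ?mulr_ge0// leq_addr.
pose rho : R := (nprime m)%:R ^- t.
have rho0 : 0 < rho by rewrite invr_gt0 natr_exp_gt0 ?nprime_gt0.
apply/nm_nearP; exists (rho / 2); first by rewrite divr_gt0.
move=> z zr.
have zrho y : nm (y - z) < rho / 2 -> polydisc t (y - zeta).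
  move=> yz; apply: polydisc_small; rewrite -/rho.
  have -> : y - zeta = (y - z) + (z - zeta) by zmod.
  by rewrite (le_trans (nmD _ _))//; move: yz zr; clear; lra.
apply: (@weierstrass _ _ _ complE S _ z (rho / 2) (4 * A)); first by rewrite divr_gt0.
  move=> N y yz; have yt := zrho y yz.
  have yr : nm (y - zeta) < r by apply: (inr 0%N); rewrite addn0.
  split; first by apply: differentiable_partial => d; exact: (hu d y yr).1.
  have [->|N0] := posnP N; first by rewrite /S big_geq// nm0 mulr_ge0.
  have := SB 0%N 1%N N y isT N0; rewrite addn0 => /(_ yt).
  rewrite [S 1%N y](_ : _ = 0) ?subr0 ?expr1n ?divr1; last by rewrite /S big_geq.
  move=> /le_trans; apply.
  by rewrite ler_wpM2r// ler_nat.
move=> e e0; pose n0 := (Num.truncn (2 * A / e)).+1; exists n0 => n n0n y yz.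
have n_gt0 : (0 < n)%N by exact: leq_trans n0n.
rewrite nmBC; have := FS 0%N n y n_gt0; rewrite addn0 add0n expr1 => /(_ (zrho y yz)).
move=> /le_trans; apply; rewrite ler_pdivrMr ?ltr0n// [leRHS]mulrC -ler_pdivrMr//.
apply: (le_trans (ltW (real_truncnS_gt (num_real _)))).
by rewrite ler_nat.
Qed.

End Series.

Section Product.
Variable E : normedModType C.

(** Dirichlet convolution, which is the Cauchy product of power series because [chi] is
    multiplicative. *)
Definition dconv (a : nat -> C) (b : nat -> E) (n : nat) : E :=
  \sum_(1 <= d < n.+1 | (d %| n)%N) a d *: b (n %/ d)%N.

Lemma sum_dconv (a : nat -> C) (b : nat -> E) (x : V) N : (0 < N)%N ->
  \sum_(1 <= n < N) chi x n *: dconv a b n =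
  \sum_(1 <= d < N) \sum_(1 <= d' < (N.-1 %/ d).+1) (chi x d * a d) *: (chi x d' *: b d').
Proof.
case: N => // N _ /=.
transitivity (\sum_(1 <= n < N.+1) \sum_(1 <= d < N.+1 | (d %| n)%N)
    chi x n *: (a d *: b (n %/ d)%N)).
  apply: eq_big_nat => n /andP[n1 nN]; rewrite /dconv scaler_sumr.
  rewrite [RHS](@big_cat_nat _ _ _ n.+1)//= [X in _ = _ + X]big_nat_cond.
  rewrite [X in _ = _ + X]big_pred0 ?addr0// => d.
  apply/negP => /andP[/andP[nd _] /dvdn_leq]; rewrite n1 leqNgt nd => /(_ isT)//.
rewrite (exchange_big_dep_nat xpredT)//=; apply: eq_big_nat => d /andP[d1 dN].
rewrite (sum_dvdn (fun n => chi x n *: (a d *: b (n %/ d)%N)))//.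
apply: eq_bigr => d' _; rewrite mulKn// chiM !scalerA; congr (_ *: _).
by ring.
Qed.

Lemma expandsZ (f : V -> C^o) (g : V -> E) a b M N s s' :
  smooth_supp m a -> smooth_supp m b ->
  expands zeta f a M s -> expands zeta g b N s' ->
  exists K t, expands zeta (fun y => f y *: g y) (dconv a b) K t.
Proof.
move=> a0 b0 fa gb; have M0 := expands_ge0 fa; have N0 := expands_ge0 gb.
pose t := maxn s s'.
have fat : expands zeta f a M t := expands_mono fa (lexx _) (leq_maxl s s').
have gbt : expands zeta g b N t := expands_mono gb (lexx _) (leq_maxr s s').
have aG := expands_growth a0 fat; have bG := expands_growth b0 gbt.
exists (M * N + 2 * M * N + 4 * M * (4 * N)), (t + 2)%N => e x n xs n0.
set fx := f _; set gx := g _.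
have xt e' : (e' <= 2 + e)%N -> polydisc (t + e') x.
  by move=> e'e; apply: polydisc_le xs; rewrite -addnA leq_add2l.
pose A := \sum_(1 <= d < n) chi x d *: (a d : C^o).
pose B := \sum_(1 <= d < n) chi x d *: b d.
have fA : nm (fx - A) <= M / n%:R ^+ e by apply: fat => //; apply: xt; rewrite leq_addl.
have gB : nm (gx - B) <= N / n%:R ^+ e by apply: gbt => //; apply: xt; rewrite leq_addl.
have gN : nm gx <= N.
  have := gbt 0%N x 1%N (xt 0%N isT) isT.
  by rewrite big_geq// subr0 expr0 divr1.
have fM : nm fx <= M.
  have := fat 0%N x 1%N (xt 0%N isT) isT.
  by rewrite big_geq// subr0 expr0 divr1.
have ne0 : 0 < n%:R ^+ e :> R by exact: natr_exp_gt0.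
have ne1 : 1 <= n%:R ^+ e :> R by rewrite exprn_ege1// ler1n.
have AM : nm A <= 2 * M.
  have -> : A = fx - (fx - A) by rewrite opprB addrC subrK.
  rewrite (le_trans (nmB _ _))// mulr_natl mulr2n lerD// (le_trans fA)//.
  by rewrite ler_pdivrMr// ler_peMr.
(* The product of partial sums and the partial sum of the convolution differ by terms with d d' >=
   n, handled by [tail_bound] for each d. *)
have ABn : nm (A *: B - \sum_(1 <= d < n) chi x d *: dconv a b d) <=
     4 * M * (4 * N) / n%:R ^+ e.
  rewrite sum_dconv//.
  have -> : A *: B = \sum_(1 <= d < n) \sum_(1 <= d' < n) (chi x d * a d) *: (chi x d' *: b d').
    by rewrite /A scaler_suml; apply: eq_bigr => d _; rewrite /B scaler_sumr.
  rewrite -sumrB.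
  rewrite (eq_big_nat _ _ (F2 := fun d =>
      \sum_((n.-1 %/ d).+1 <= d' < n) (chi x d * a d) *: (chi x d' *: b d'))); last first.
    move=> d /andP[d1 dn]; rewrite (@big_cat_nat _ _ _ (n.-1 %/ d).+1 1 n)//=.
      by set T := \sum_(1 <= i < _) _; rewrite (addrC T) addrK.
    by rewrite -[leqRHS](prednK n0) ltnS leq_div.
  rewrite (le_trans (nm_sum _ _ _))//.
  apply: (@le_trans _ _ (\sum_(1 <= d < n) (2 * M / d%:R ^+ 2) * (2 * (2 * N)) / n%:R ^+ e)).
    rewrite big_nat_cond [leRHS]big_nat_cond; apply: ler_sum => d /andP[/andP[d1 dn] _].
    rewrite -scaler_sumr nmZ nmM.
    set k := (n.-1 %/ d).+1.
    have kn : (n <= d * k)%N.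
      rewrite /k -{1}(prednK n0) mulnC ltn_ceil//.
    have k0 : (0 < k)%N by [].
    clearbody k.
    have h1 : nm (chi x d) * nm (a d) <= 2 * M / d%:R ^+ 2 / d%:R ^+ e.
      apply: (@le_trans _ _ (d%:R ^- (t + (2 + e)) * (2 * M * d%:R ^+ t))).
        by rewrite ler_pM ?nm_ge0// nm_chi//; apply: xt.
      rewrite le_eqVlt; apply/orP; left; apply/eqP; rewrite !exprD.
      have : d%:R != 0 :> R by rewrite pnatr_eq0 -lt0n.
      move: (d%:R : R) => y y0; move: (expf_neq0 t y0) (expf_neq0 e y0).
      by move: (y ^+ t) (y ^+ e) => v w v0 w0; field; rewrite v0 w0 y0.
    have h2 : nm (\sum_(k <= d' < n) chi x d' *: b d') <= 2 * (2 * N) / k%:R ^+ e.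
      by apply: (tail_bound (s := t)) => //; rewrite mulr_ge0.
    apply: (le_trans (ler_pM _ _ h1 h2)); rewrite ?mulr_ge0 ?nm_ge0//.
    have -> : 2 * M / d%:R ^+ 2 / d%:R ^+ e * (2 * (2 * N) / k%:R ^+ e) =
       2 * M / d%:R ^+ 2 * (2 * (2 * N)) / (d * k)%:R ^+ e :> R.
      rewrite (natrM _ d k) (exprMn _ d%:R) (invfM (d%:R ^+ e)).
      by move: (_^-1) (_^-1) (_^-1) => y1 y2 y3; ring.
    rewrite ler_wpM2l//; first by rewrite !mulr_ge0// invr_ge0 exprn_ge0.
    rewrite lef_pV2 ?posrE ?natr_exp_gt0 ?muln_gt0 ?d1//.
    by rewrite lerXn2r ?nnegrE ?ler0n// ler_nat.
  have -> : \sum_(1 <= d < n) 2 * M / d%:R ^+ 2 * (2 * (2 * N)) / n%:R ^+ e =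
      (2 * M * (2 * (2 * N)) / n%:R ^+ e) * \sum_(1 <= d < n | (0 < d)%N) d%:R ^- 2.
    rewrite mulr_sumr big_nat_cond [RHS]big_nat_cond; apply: eq_big => d.
      by case: d => [|d] //=; rewrite !andbT.
    by move=> _; ring.
  have -> : 4 * M * (4 * N) / n%:R ^+ e = (2 * M * (2 * (2 * N)) / n%:R ^+ e) * 2 :> R by ring.
  by rewrite ler_wpM2l ?sum_inv_sqr// !mulr_ge0// invr_ge0 ltW.
rewrite (_ : fx *: gx - _ = (fx - A) *: gx + A *: (gx - B) +
    (A *: B - \sum_(1 <= d < n) chi x d *: dconv a b d)); last first.
  rewrite scalerBl scalerBr; move: (fx *: gx) (A *: gx) (A *: B) (\sum_(_ <= _ < _) _).
  by move=> u v w z; zmod.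
have n1 : nm ((fx - A) *: gx) <= M * N / n%:R ^+ e.
  by rewrite nmZ mulrAC ler_pM ?nm_ge0.
have n2 : nm (A *: (gx - B)) <= 2 * M * N / n%:R ^+ e.
  by rewrite nmZ -[leRHS]mulrA ler_pM ?nm_ge0.
rewrite [leRHS]mulrDl [X in _ <= X + _]mulrDl.
apply: (le_trans (nmD _ _)); apply: lerD ABn.
by apply: (le_trans (nmD _ _)); exact: lerD.
Qed.

End Product.
End ExpansionOperations.

(** * Taylor coefficients by repeated Hadamard division *)

Section Taylor.
Variables (R : realType) (m : nat) (zeta : 'rV[(R[i] : numFieldType)]_m).
Local Notation C := R[i].
Local Notation V := 'rV[(R[i] : numFieldType)]_m.

Section TaylorCoefficients.
Variable E : normedModType C.
Hypothesis complE : ncomplete E.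
Implicit Types f : V -> E.

(* [k] is fuel for the recursion on [d]; any [k >= d] gives the same value. *)
Fixpoint coef (k d : nat) f : E := if k is k'.+1 then
  (if d == 1%N then f zeta else 0) +
  \sum_(i < m | (nprime i %| d)%N) coef k' (d %/ nprime i)%N (hterm zeta i f) else 0.

Lemma coef0 k f : coef k 0 f = 0.
Proof.
elim: k f => // k IH f /=; rewrite add0r big1// => i _.
by rewrite div0n IH.
Qed.

Lemma coef_fuel k k' d f : (d <= k)%N -> (d <= k')%N -> coef k d f = coef k' d f.
Proof.
elim: k k' d f => [|k IH] k' d f.
  by rewrite leqn0 => /eqP -> _; rewrite !coef0.
case: k' => [|k']; first by rewrite leqn0 => _ /eqP ->; rewrite !coef0.
move=> dk dk' /=; congr (_ + _); apply: eq_bigr => i _.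
have [->|d0] := posnP d; first by rewrite div0n !coef0.
have dd : (d %/ nprime i < d)%N by rewrite ltn_Pdiv// nprime_gt1.
by apply: IH; rewrite -ltnS (leq_trans dd).
Qed.

Definition tcoef f d : E := coef d d f.

Lemma tcoefE f d : (0 < d)%N -> tcoef f d = (if d == 1%N then f zeta else 0) +
  \sum_(i < m | (nprime i %| d)%N) tcoef (hterm zeta i f) (d %/ nprime i)%N.
Proof.
case: d => // d _; rewrite /tcoef /=; congr (_ + _); apply: eq_bigr => i _.
apply: coef_fuel => //; rewrite -ltnS ltn_Pdiv// nprime_gt1//.
Qed.

Lemma tcoef_supp f : smooth_supp m (tcoef f).
Proof.
move=> d; elim/ltn_ind: d f => d IH f nd.
have [->|d0] := posnP d; first by rewrite /tcoef coef0.
rewrite tcoefE// big1 => [|i pd].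
  by rewrite addr0; case: eqP nd => // ->.
apply: IH; first by rewrite ltn_Pdiv// nprime_gt1.
apply: contra nd => sd; rewrite -(divnK pd) smoothM sd.
exact: smooth_nprime.
Qed.

Lemma taylor_sum f (x : V) N : \sum_(1 <= d < N.+2) chi x d *: tcoef f d =
  f zeta + \sum_(i < m) x 0 i *:
    (\sum_(1 <= d < (N.+1 %/ nprime i).+1) chi x d *: tcoef (hterm zeta i f) d).
Proof.
rewrite (eq_big_nat _ _ (F2 := fun d => chi x d *: (if d == 1%N then f zeta else 0) +
  \sum_(i < m | (nprime i %| d)%N) chi x d *: tcoef (hterm zeta i f) (d %/ nprime i)%N)).
  rewrite big_split /=; congr (_ + _).
    rewrite big_ltn//= chi1 scale1r big_nat_cond big1 ?addr0// => d /andP[/andP[d1 _] _].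
    by rewrite gtn_eqF// scaler0.
  rewrite (exchange_big_dep xpredT)//=; apply: eq_bigr => i _.
  rewrite (sum_dvdn (fun d => chi x d *: tcoef (hterm zeta i f) (d %/ nprime i)%N))//.
    rewrite scaler_sumr; apply: eq_bigr => d _.
    by rewrite mulKn ?nprime_gt0// chiM chi_nprime scalerA.
  exact: nprime_gt0.
by move=> d /andP[d1 _]; rewrite tcoefE// scalerDr scaler_sumr.
Qed.

(** Induction on N: dividing off the variable p_i replaces N by about N/p_i and M by 4M/r. The
    exponent depends on r and m only. *)
Lemma taylor_expands (r : R) : 0 < r -> exists s, forall f M,
  holb f zeta r M -> expands zeta f (tcoef f) M s.
Proof.
(* The exponent is such that the factor 4/r and the sum over m variables are absorbed by 2^-(s+1), a
   bound for each p_i^-(s+1). *)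
move=> r0; pose s := Num.truncn (4 * m.+1%:R / r).
have sP : 4 * m.+1%:R / r <= 2 ^+ s.+1.
  apply: (le_trans (ltW (real_truncnS_gt (num_real _)))).
  by rewrite -natrX ler_nat ltnW// ltn_expl.
have two0 : 0 < 2 ^+ s.+1 :> R by rewrite exprn_gt0.
exists s.+1 => f M hf e x N xs.
have xr : nm (zeta + x - zeta) < r.
  rewrite addrAC subrr add0r.
  have xs1 : polydisc s.+1 x by apply: polydisc_le xs; rewrite leq_addr.
  apply: (le_lt_trans (nm_polydisc xs1)); rewrite invf_plt ?posrE//.
  apply: lt_le_trans sP; rewrite ltr_pdivlMr// mulVf ?gt_eqF//.
  by rewrite -natrM ltr1n; lia.
elim/ltn_ind: N f M hf => -[|[|N]] IH f M hf _ //.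
  by rewrite big_geq// subr0 expr1n divr1; exact: (hf _ xr).2.
have M0 := holb_ge0 r0 hf.
rewrite taylor_sum [f (zeta + x)](hadamard zeta).
set S := \sum_(i < m) _; set T := \sum_(i < m) _.
have -> : f zeta + S - (f zeta + T) = S - T by clearbody S T; move: (f zeta) => u; zmod.
rewrite /S /T -sumrB (le_trans (nm_sum _ _ _))//.
apply: (@le_trans _ _ (\sum_(i < m) (2 ^- s.+1 * (4 * M / r) / N.+2%:R ^+ e))).
  apply: ler_sum => i _.
  have -> : (zeta + x) 0 i - zeta 0 i = x 0 i by rewrite !mxE addrAC subrr add0r.
  rewrite -scalerBr nmZ; set Ni := (N.+1 %/ nprime i).+1.
  have Nilt : (Ni < N.+2)%N by rewrite /Ni ltnS ltn_Pdiv// nprime_gt1.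
  have := IH Ni Nilt _ _ (holb_hterm complE i r0 hf) isT => IHi.
  have pN : (N.+2 <= nprime i * Ni)%N by rewrite /Ni mulnC ltn_ceil// nprime_gt0.
  apply: (@le_trans _ _ ((nprime i)%:R ^- (s.+1 + e) * (4 * M / r / Ni%:R ^+ e))).
    by rewrite ler_pM ?nm_ge0.
  have -> : (nprime i)%:R ^- (s.+1 + e) * (4 * M / r / Ni%:R ^+ e) =
      (nprime i)%:R ^- s.+1 * (4 * M / r) / (nprime i * Ni)%:R ^+ e :> R.
    by rewrite exprD invfM natrM exprMn (invfM (_ ^+ e)); move: (_^-1) (_^-1) (_^-1) (_^-1) => *; ring.
  have K0 : 0 <= 4 * M / r by rewrite divr_ge0 ?mulr_ge0// ltW.
  apply: ler_pM.
  - by apply: mulr_ge0 => //; rewrite invr_ge0 exprn_ge0.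
  - by rewrite invr_ge0 exprn_ge0.
  - rewrite ler_wpM2r// lef_pV2 ?posrE ?natr_exp_gt0 ?nprime_gt0//.
    by rewrite lerXn2r ?nnegrE ?ler0n// ler_nat nprime_gt1.
  - rewrite lef_pV2 ?posrE ?natr_exp_gt0 ?muln_gt0 ?nprime_gt0//.
    by rewrite lerXn2r ?nnegrE ?ler0n// ler_nat.
rewrite sumr_const card_ord -[X in X <= _]mulr_natl.
have Ne : 0 < N.+2%:R ^+ e :> R by rewrite natr_exp_gt0.
rewrite !mulrA ler_wpM2r ?invr_ge0 ?(ltW Ne)//.
have -> : m%:R * 2 ^- s.+1 * 4 * M / r = (4 * m%:R / r) / 2 ^+ s.+1 * M by field; rewrite !gt_eqF.
rewrite ler_piMl// ler_pdivrMr// mul1r; apply: le_trans sP.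
by rewrite ler_wpM2r ?invr_ge0 ?(ltW r0)// ler_wpM2l// ler_nat.
Qed.

End TaylorCoefficients.

Lemma expandsD (E : normedModType C) (f g : V -> E) a b M N s s' :
  expands zeta f a M s -> expands zeta g b N s' ->
  expands zeta (fun y => f y + g y) (fun d => a d + b d) (M + N) (maxn s s').
Proof.
move=> fa gb e x n xs n0.
have fat := expands_mono fa (lexx _) (leq_maxl s s').
have gbt := expands_mono gb (lexx _) (leq_maxr s s').
rewrite (eq_bigr (fun d => chi x d *: a d + chi x d *: b d)) => [|d _]; last exact: scalerDr.
rewrite big_split /= opprD addrACA (le_trans (nmD _ _))// mulrDl.
by apply: lerD; [exact: fat|exact: gbt].
Qed.

Definition delta_coef (E : zmodType) (k : nat) (v : E) (d : nat) : E := if d == k then v else 0.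

Lemma sum_delta_coef (E : normedModType C) k (v : E) (x : V) N : (0 < k)%N ->
  \sum_(1 <= d < N) chi x d *: delta_coef k v d = if (k < N)%N then chi x k *: v else 0.
Proof.
move=> k0; rewrite /delta_coef; case: ifP => kN.
  rewrite (bigD1_seq k)/= ?mem_index_iota ?k0 ?iota_uniq// eqxx big1 ?addr0// => d dk.
  by rewrite (negbTE dk) scaler0.
rewrite big_nat_cond big1// => d /andP[/andP[_ dN] _]; case: eqP => [dk|_].
  by rewrite -dk dN in kN.
by rewrite scaler0.
Qed.

Lemma expands_cst (E : normedModType C) (v : E) :
  expands zeta (fun=> v) (delta_coef 1 v) (nm v) 0.
Proof.
move=> e x N _ N0; rewrite sum_delta_coef//; case: ifP => [_|].
  by rewrite chi1 scale1r subrr nm0 divr_ge0 ?nm_ge0 ?exprn_ge0.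
by case: N N0 => [|[|N]]// _ _; rewrite subr0 expr1n divr1.
Qed.

End Taylor.

(** * Coefficients of germs *)

Section GermCoefficients.
Variables (R : realType) (m : nat) (zeta : 'rV[(R[i] : numFieldType)]_m).
Local Notation C := R[i].
Local Notation V := 'rV[(R[i] : numFieldType)]_m.
Local Notation O := (germ zeta (R[i]^o : normedModType R[i])).

Definition rp (E : normedModType C) (F : germ zeta E) : V -> E := val (repr F).

Section Basic.
Variable E : normedModType C.
Implicit Types (F G : germ zeta E).

Lemma rp_hol F : holomorphic_at zeta (rp F).
Proof. exact: holoP. Qed.

Lemma germ_eqP F G : F = G <-> \forall y \near zeta, rp F y = rp G y.
Proof.
split=> [->|FG]; first by near=> y.
rewrite -[F]reprK -[G]reprK; apply/eqP; rewrite eqmodE; exact/asboolP.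
Unshelve. all: by end_near. Qed.

Lemma rpD F G : \forall y \near zeta, rp (F + G) y = rp F y + rp G y.
Proof. exact: repr_germ_of. Qed.

Lemma rpZ (a : O) F : \forall y \near zeta, rp (a *: F) y = rp a y *: rp F y.
Proof. exact: repr_germ_of. Qed.

Lemma rp_of (f : V -> E) (hf : holomorphic_at zeta f) :
  \forall y \near zeta, rp (germ_of hf) y = f y.
Proof. exact: repr_germ_of. Qed.

Lemma rp0 : \forall y \near zeta, rp (0 : germ zeta E) y = 0.
Proof. exact: repr_germ_of. Qed.

Lemma rp_sum (n : nat) (F : 'I_n -> germ zeta E) :
  \forall y \near zeta, rp (\sum_i F i) y = \sum_i rp (F i) y.
Proof.
elim: n F => [|n IH] F.
  by rewrite big_ord0; apply: filterS rp0 => y ->; rewrite big_ord0.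
rewrite big_ord_recl.
have := rpD (F ord0) (\sum_(i < n) F (lift ord0 i)).
have := IH (fun i => F (lift ord0 i)); apply: filterS2 => y e1 ->.
by rewrite e1 big_ord_recl.
Qed.

Lemma germ_valZ (a : O) F : germ_val (a *: F) = germ_val a *: germ_val F.
Proof. exact: nbhs_singleton (rpZ a F). Qed.

Lemma holomorphic_holb (f : V -> E) : holomorphic_at zeta f ->
  exists r M, 0 < r /\ holb f zeta r M.
Proof.
move=> /nm_nearP[r1 r10 hf]; have df : differentiable f zeta by apply: hf; rewrite subrr nm0.
have [d d0 dP] := dd_approx df ltr01; have [K KP] := dd_bounded df.
exists (Num.min r1 d), (nm (f zeta) + (1 + `|K|) * d); split; first by rewrite lt_min r10.
move=> y; rewrite lt_min => /andP[yr yd]; split; first exact: hf.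
have := dP _ yd; rewrite (addrC zeta) subrK mul1r; set D := dd f zeta _ => h.
have -> : f y = f zeta + ((f y - f zeta - D) + D) by clearbody D; zmod.
rewrite (le_trans (nmD _ _))// lerD2l (le_trans (nmD _ _))// mulrDl mul1r lerD//.
  exact: (le_trans h (ltW yd)).
apply: (le_trans (KP _)); apply: (le_trans (ler_wpM2r (nm_ge0 _) (ler_norm K))).
by rewrite ler_wpM2l// ltW.
Qed.

End Basic.

Section Tau.
Variable E : normedModType C.
Hypothesis complE : ncomplete E.
Implicit Types (F G : germ zeta E).

Definition tau F : nat -> E := tcoef zeta (rp F).

Lemma tau_supp F : smooth_supp m (tau F).
Proof. exact: tcoef_supp. Qed.

Lemma tau_expands F : exists M s, expands zeta (rp F) (tau F) M s.
Proof.
have [r [M [r0 hM]]] := holomorphic_holb (rp_hol F).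
have [s sP] := taylor_expands zeta complE r0.
by exists M, s; exact: sP.
Qed.

(** Coefficients can be read off any expansion of any function representing the germ; the formulas
    for sums, constants and products follow. *)
Lemma tau_uniq F f a M s : (\forall y \near zeta, rp F y = f y) ->
  smooth_supp m a -> expands zeta f a M s -> tau F = a.
Proof.
move=> Ff a0 fa; apply/funext => d; have [N [t FN]] := tau_expands F.
have [t' fN] := expands_near Ff FN.
exact: (expands_inj (@tau_supp F) a0 fN fa).
Qed.

Lemma tau_growth F : exists M s, 0 <= M /\ growth (tau F) M s.
Proof.
have [M [s FM]] := tau_expands F; exists (2 * M), s; split.
  by rewrite mulr_ge0// (expands_ge0 FM).
exact: expands_growth (@tau_supp F) FM.
Qed.

Lemma tauD F G : tau (F + G) = (fun d => tau F d + tau G d).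
Proof.
have [M [s FM]] := tau_expands F; have [N [t GN]] := tau_expands G.
apply: (tau_uniq (rpD F G) _ (expandsD FM GN)) => d nd.
by rewrite !tau_supp// addr0.
Qed.

Lemma tau_cst (v : E) (F : germ zeta E) : (\forall y \near zeta, rp F y = v) ->
  tau F = delta_coef 1 v.
Proof.
move=> Fv; apply: (tau_uniq Fv _ (expands_cst zeta v)) => d nd.
by rewrite /delta_coef; case: eqP nd => // ->.
Qed.

Lemma tau0 d : tau (0 : germ zeta E) d = 0.
Proof. by rewrite (tau_cst (rp0 E)) /delta_coef if_same. Qed.

Lemma tau_inj F G : tau F = tau G -> F = G.
Proof.
move=> FG; apply/germ_eqP.
have [M [s FM]] := tau_expands F; have [N [t GN]] := tau_expands (- G).
have GG : tau (F - G) = (fun=> 0).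
  rewrite tauD FG; apply/funext => d.
  by have := congr1 (fun h => h d) (tauD G (- G)); rewrite subrr tau0 => ->.
have [K [u]] := tau_expands (F - G); rewrite GG => /expands_eq0.
have := rpD (F - G) G; rewrite subrK.
by apply: filterS2 => y -> ->; rewrite add0r.
Qed.

Lemma tauN F : tau (- F) = (fun d => - tau F d).
Proof.
apply/funext => d; apply/eqP; rewrite eq_sym -subr_eq0 -opprD oppr_eq0; apply/eqP.
by have := congr1 (fun h => h d) (tauD F (- F)); rewrite subrr tau0.
Qed.

Lemma tau_surj a (A : R) s : smooth_supp m a -> 0 <= A -> growth a A s ->
  exists F : germ zeta E, tau F = a.
Proof.
move=> a0 A0 aA.
have hu d y : nm (y - zeta) < 1 ->
    differentiable (fun _ : V => a d) y /\ nm (a d) <= A * d%:R ^+ s.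
  by move=> _; split; [exact: differentiable_cst|exact: aA].
have [f [hf [t ft]]] := bohr_series complE ltr01 A0 hu.
exists (germ_of hf); apply: (tau_uniq (rp_of hf) a0 (M := 2 * A) (s := t)).
by move=> e x N xt N0; exact: ft.
Qed.

End Tau.

Notation complC := (@complex_ncomplete R).

Lemma tauZ (E : normedModType C) (complE : ncomplete E) (a : O) (F : germ zeta E) :
  tau (a *: F) = dconv (tau a : nat -> C) (tau F).
Proof.
have [M [s aM]] := tau_expands (complC : ncomplete R[i]^o) a.
have [N [t FN]] := tau_expands complE F.
have [K [u Ku]] := expandsZ (@tau_supp _ a) (@tau_supp _ F) aM FN.
apply: (tau_uniq complE (rpZ a F) _ Ku) => d nd.
rewrite /dconv big1// => k kd; have [sk|nk] := boolP (smooth m k); last first.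
  by rewrite (tau_supp a nk) scale0r.
rewrite (@tau_supp _ F) ?scaler0//; apply: contra nd => skd.
by rewrite -(divnK kd) smoothM skd.
Qed.

Lemma coord_holomorphic (i : 'I_m) :
  holomorphic_at zeta (fun y : V => y 0 i - zeta 0 i : R[i]^o).
Proof.
near=> z; apply: differentiableB; first exact: differentiable_coord.
exact: differentiable_cst.
Unshelve. all: by end_near. Qed.

Definition germ_coord (i : 'I_m) : O := germ_of (coord_holomorphic i).

Lemma germ_val_coord (i : 'I_m) : germ_val (germ_coord i) = 0.
Proof. by rewrite germ_valE subrr. Qed.

(** Modulo constants, every germ lies in the maximal ideal times the module of germs. *)
Lemma germ_hadamard (E : normedModType C) (complE : ncomplete E) (F : germ zeta E) :
  exists G : 'I_m -> germ zeta E,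
    F = germ_of (holomorphic_cst zeta (germ_val F)) + \sum_i germ_coord i *: G i.
Proof.
have [r [M [r0 hM]]] := holomorphic_holb (rp_hol F).
have hG i : holomorphic_at zeta (hterm zeta i (rp F)).
  apply/nm_nearP; exists r => // z zr.
  by have [] := holb_hterm complE i r0 hM zr.
exists (fun i => germ_of (hG i)); apply/germ_eqP.
have h1 i : \forall y \near zeta, rp (germ_coord i *: germ_of (hG i)) y =
    (y 0 i - zeta 0 i) *: hterm zeta i (rp F) y.
  have := rp_of (hG i); have := rp_of (coord_holomorphic i).
  have := rpZ (germ_coord i) (germ_of (hG i)).
  by apply: filterS3 => y -> -> ->.
have h2 : \forall y \near zeta, forall i, rp (germ_coord i *: germ_of (hG i)) y =
    (y 0 i - zeta 0 i) *: hterm zeta i (rp F) y.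
  exact: (@filter_forall V _ (fun i y => rp (germ_coord i *: germ_of (hG i)) y =
    (y 0 i - zeta 0 i) *: hterm zeta i (rp F) y) (nbhs zeta) _ h1).
have h3 := rp_sum (fun i => germ_coord i *: germ_of (hG i)).
have h4 := rpD (germ_of (holomorphic_cst zeta (germ_val F)))
   (\sum_i germ_coord i *: germ_of (hG i)).
have h5 := rp_of (holomorphic_cst zeta (germ_val F)).
near=> y.
have e4 := near h4 y; have e5 := near h5 y; have e3 := near h3 y; have e2 := near h2 y.
rewrite e4// e5// e3// [LHS](hadamard zeta); congr (_ + _).
by apply: eq_bigr => i _; rewrite e2.
Unshelve. all: by end_near. Qed.

End GermCoefficients.

(** * Division with bounds *)

Section Dickson.

Lemma smoothS m d : smooth m.+1 d ->
  exists c d', d = (nprime m ^ c * d')%N /\ smooth m d'.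
Proof.
move: d; apply: smooth_ind => [|j d _ [c [d' [-> sd']]]].
  by exists 0%N, 1%N; rewrite expn0 mul1n.
have [jm|jm] := eqVneq (val j) m.
  by exists c.+1, d'; rewrite jm expnS mulnA.
have jlt : (j < m)%N by rewrite ltn_neqAle jm -ltnS ltn_ord.
exists c, (nprime j * d')%N; split; first by rewrite mulnCA.
by rewrite smoothM sd' (smooth_nprime (Ordinal jlt)).
Qed.

(** Induction on the number of primes. A finite basis for the parts free of the last prime, each
    with a witnessing exponent, covers all large exponents of that prime; the finitely many smaller
    exponents are treated one by one. *)
Lemma dickson m (D : nat -> Prop) : exists s : seq nat,
  (forall d, d \in s -> D d) /\
  (forall d, smooth m d -> D d -> exists2 e, e \in s & (e %| d)%N).
Proof.
elim: m D => [|m IH] D.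
  have [D1|nD1] := pselect (D 1%N).
    exists [:: 1%N]; split=> [d|d _ _]; first by rewrite inE => /eqP ->.
    by exists 1%N; rewrite ?inE// dvd1n.
  exists [::]; split=> // d; move: d; apply: smooth_ind => [//|j]; have := ltn_ord j.
  by rewrite ltn0.
pose p := nprime m.
have [s0 [s0D s0P]] := IH (fun d' => exists c, D (p ^ c * d')%N).
have /choice[c cP] : forall d', exists c, d' \in s0 -> D (p ^ c * d')%N.
  move=> d'; have [/s0D[c ?]|_] := boolP (d' \in s0); first by exists c.
  by exists 0%N.
have /choice[t tP] := fun a : nat => IH (fun d' => D (p ^ a * d')%N).
pose e := \max_(d' <- s0) c d'.
exists ([seq (p ^ c d' * d')%N | d' <- s0] ++
        [seq (p ^ a * d')%N | a <- iota 0 e, d' <- t a]).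
split=> [d|d /smoothS[a [d' [-> sd']]] Dd].
  rewrite mem_cat => /orP[/mapP[d' d's ->]|/allpairsPdep[a [d' [_ d't ->]]]].
    exact: cP.
  exact: (tP a).1.
have [ae|ea] := ltnP a e.
  have [f ft fd'] := (tP a).2 d' sd' Dd.
  exists (p ^ a * f)%N; last by rewrite dvdn_mul.
  rewrite mem_cat; apply/orP; right; apply/allpairsPdep; exists a, f.
  by rewrite mem_iota.
have [f fs fd'] := s0P d' sd' (ex_intro _ a Dd).
exists (p ^ c f * f)%N.
  by rewrite mem_cat; apply/orP; left; apply/mapP; exists f.
rewrite dvdn_mul// dvdn_exp2l// (leq_trans _ ea)//.
by rewrite /e (big_rem f)//= leq_maxl.
Qed.

End Dickson.

(** * Division of coefficient arrays by leading terms *)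

Section Division.
Variables (R : realType) (m n : nat).
Local Notation C := R[i].

(* The monomial of index [d] in the [j]-th component is ordered by [d] times a   *)
(* further prime, so that distinct terms of a vector have distinct weights.      *)
Definition wgt (d : nat) (j : 'I_n) : nat := (d * nprime (m + j))%N.

Lemma wgtM e d j : wgt (e * d) j = (e * wgt d j)%N.
Proof. by rewrite /wgt mulnA. Qed.

Lemma wgt_gt0 d j : (0 < wgt d j)%N = (0 < d)%N.
Proof. by rewrite muln_gt0 nprime_gt0 andbT. Qed.

Lemma leq_wgt d j : (d <= wgt d j)%N.
Proof. by rewrite leq_pmulr// nprime_gt0. Qed.

Lemma nprime_dvd_smooth d k : (m <= k)%N -> smooth m d -> ~~ (nprime k %| d)%N.
Proof.
move=> mk sd; apply/negP => kd; have d0 := smooth_gt0 sd.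
have /sprimesP[j kj] : nprime k \in sprimes m.
  by move: sd => /pnatP => /(_ d0); apply => //; exact: nprime_prime.
by move: mk; rewrite (nprime_inj kj) leqNgt ltn_ord.
Qed.

Lemma wgt_inj d d' j j' : smooth m d -> smooth m d' -> wgt d j = wgt d' j' ->
  d = d' /\ j = j'.
Proof.
move=> sd sd' e; have jj : j = j'.
  have : (nprime (m + j) %| wgt d' j')%N by rewrite -e dvdn_mull.
  rewrite /wgt Euclid_dvdM ?nprime_prime// (negbTE (nprime_dvd_smooth _ sd')) ?leq_addr//=.
  rewrite dvdn_prime2 ?nprime_prime// => /eqP/nprime_inj/addnI; exact: val_inj.
split=> //; move: e; rewrite /wgt jj => /eqP.
by rewrite eqn_pmul2r ?nprime_gt0// => /eqP.
Qed.

Variables (k : nat) (ld : 'I_k -> nat) (lj : 'I_k -> 'I_n).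
Variable h : 'I_k -> nat -> 'rV[C]_n.

Hypothesis ld_smooth : forall i, smooth m (ld i).
Hypothesis h_supp : forall i, smooth_supp m (h i : nat -> 'rV[(R[i] : numFieldType)]_n).
Hypothesis h_lead : forall i, h i (ld i) 0 (lj i) = 1.
Hypothesis h_low : forall i d j, (wgt d j < wgt (ld i) (lj i))%N -> h i d 0 j = 0.
Hypothesis h_growth : forall i, exists M s, 0 <= M /\
  forall d j, nm (h i d 0 j) <= M * d%:R ^+ s.

(** A fixed choice of divisor for each term makes quotients and remainder functions of the dividend,
    and linear ones. *)
Definition idx d j : option 'I_k := [pick i | (ld i %| d)%N && (lj i == j)].

Lemma idxP d j i : idx d j = Some i -> (ld i %| d)%N /\ lj i = j.
Proof. by rewrite /idx; case: pickP => // i' /andP[? /eqP ?] [<-]. Qed.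

Definition hrest i d j : C :=
  if (d == ld i) && (j == lj i) then 0 else h i d 0 j.

Lemma hrest_gt i d j : hrest i d j != 0 -> (wgt (ld i) (lj i) < wgt d j)%N.
Proof.
rewrite /hrest; case: ifPn => [_|ne]; first by rewrite eqxx.
move=> hn0; rewrite ltnNge leq_eqVlt; apply/negP => /orP[/eqP e|/h_low h0]; last first.
  by rewrite h0 eqxx in hn0.
have [sd|/h_supp h0] := boolP (smooth m d); last by rewrite h0 mxE eqxx in hn0.
have [dE jE] := wgt_inj sd (ld_smooth i) e.
by rewrite dE jE !eqxx in ne.
Qed.

Implicit Types (f u : nat -> 'I_n -> C).

Definition qof u i e : C :=
  if smooth m e && (idx (e * ld i) (lj i) == Some i) then u (e * ld i)%N (lj i) else 0.

(** One array u encodes the division: its entries at multiples of leading terms are quotient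
    coefficients, the others form the remainder. The division is the fixed point of [dstep f]. *)
Definition dstep f u d j : C :=
  f d j - \sum_i \sum_(1 <= e < d.+1 | (e %| d)%N) qof u i e * hrest i (d %/ e)%N j.

Definition dapprox f t := iter t (dstep f) (fun _ _ => 0).

(** Everything beyond the leading term has larger weight, so an entry depends on entries of smaller
    weight only; hence iteration becomes stationary. *)
Lemma dstep_local f u v d j :
  (forall d' j', (wgt d' j' < wgt d j)%N -> u d' j' = v d' j') ->
  dstep f u d j = dstep f v d j.
Proof.
move=> uv; congr (_ - _); apply: eq_bigr => i _.
rewrite big_nat_cond [RHS]big_nat_cond; apply: eq_bigr => e /andP[/andP[e0 _] ed].
have [->|r0] := eqVneq (hrest i (d %/ e)%N j) 0; first by rewrite !mulr0.
congr (_ * _); rewrite /qof; case: ifP => // _; apply: uv.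
by rewrite wgtM -[X in wgt X j](divnK ed) [X in wgt X j]mulnC wgtM ltn_pmul2l// hrest_gt.
Qed.

Lemma dapprox_stable f t t' d j : (wgt d j < t)%N -> (wgt d j < t')%N ->
  dapprox f t d j = dapprox f t' d j.
Proof.
elim: t t' d j => // t IH [|t'] d j; first by rewrite ltn0.
rewrite !ltnS => wt wt'; apply: dstep_local => d' j' w'.
by apply: IH; exact: leq_trans w' _.
Qed.

Definition udiv f d j := dapprox f (wgt d j).+1 d j.

Lemma udivE f d j : udiv f d j = dstep f (udiv f) d j.
Proof.
apply: dstep_local => d' j' w'.
by apply: dapprox_stable => //; exact: ltnSn.
Qed.

Definition qdiv f := qof (udiv f).

Definition gdiv f d j : C := if idx d j is None then udiv f d j else 0.

Definition fsupp f := forall d j, ~~ smooth m d -> f d j = 0.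

Lemma udiv_supp f : fsupp f -> fsupp (udiv f).
Proof.
move=> f0 d j nd; rewrite udivE /dstep f0// sub0r big1 ?oppr0// => i _.
rewrite big1// => e ed; rewrite /qof; have [se|] := boolP (smooth m e); last by rewrite mul0r.
have ne : ~~ smooth m (d %/ e).
  by apply: contra nd => sde; rewrite -(divnK ed) smoothM sde.
rewrite /hrest; case: ((d %/ e == ld i)%N && (j == lj i)); first by rewrite mulr0.
by rewrite h_supp// mxE mulr0.
Qed.

(** In the fixed point equation, the quotients times the leading terms restore exactly the entries
    of u at indices divisible by a leading term. *)
Lemma division f d j : fsupp f ->
  f d j = \sum_i \sum_(1 <= e < d.+1 | (e %| d)%N) qdiv f i e * h i (d %/ e)%N 0 j + gdiv f d j.
Proof.
move=> f0; have [sd|nd] := boolP (smooth m d); last first.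
  have -> : gdiv f d j = 0 by rewrite /gdiv udiv_supp//; case: (idx d j).
  rewrite f0// addr0 big1// => i _; rewrite big1// => e ed; rewrite /qdiv /qof.
  have [se|] := boolP (smooth m e); last by rewrite mul0r.
  rewrite h_supp ?mxE ?mulr0//; apply: contra nd => sde.
  by rewrite -(divnK ed) smoothM sde.
have d0 := smooth_gt0 sd.
have := udivE f d j; rewrite /dstep => /eqP; rewrite eq_sym subr_eq => /eqP ->.
rewrite addrC.
have hE i e : h i (d %/ e)%N 0 j = hrest i (d %/ e)%N j +
    ((d %/ e == ld i)%N && (j == lj i))%:R.
  rewrite /hrest; case: ifP => [/andP[/eqP -> /eqP ->]|_]; last by rewrite addr0.
  by rewrite h_lead add0r.
under [in RHS]eq_bigr => i _ do under eq_bigr => e _ do rewrite hE mulrDr.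
under [in RHS]eq_bigr => i _ do rewrite big_split/=.
rewrite big_split/= -addrA; congr (_ + _).
have sumE i : \sum_(1 <= e < d.+1 | (e %| d)%N)
    qdiv f i e * ((d %/ e == ld i)%N && (j == lj i))%:R =
    if idx d j == Some i then udiv f d j else 0.
  have [/andP[ldd /eqP ljj]|nld] := boolP ((ld i %| d)%N && (lj i == j)); last first.
    case: ifPn => [/eqP/idxP[h1 h2]|_]; first by rewrite h1 h2 eqxx in nld.
    rewrite big1// => e ed; case: eqP => [de|]; last by rewrite mulr0.
    case: eqP => [jj|]; last by rewrite mulr0.
    by rewrite -de jj eqxx andbT dvdn_div in nld.
  have ld0 := smooth_gt0 (ld_smooth i).
  have e0 : (0 < d %/ ld i)%N by rewrite divn_gt0// dvdn_leq.
  have eI : (d %/ ld i)%N \in index_iota 1 d.+1.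
    by rewrite mem_index_iota e0 ltnS leq_div.
  rewrite big_mkcond (bigD1_seq _ eI (iota_uniq _ _)) dvdn_div// /= big1 ?addr0; last first.
    move=> e ne; case: ifP => // ed; case: eqP => [de|]; last by rewrite mulr0.
    by rewrite -de divnA// mulKn ?eqxx in ne.
  rewrite divnA// mulKn// eqxx ljj eqxx mulr1 /qdiv /qof divnK// ljj.
  suff -> : smooth m (d %/ ld i) by [].
  by move: sd; rewrite -{1}(divnK ldd) smoothM => /andP[].
rewrite (eq_bigr _ (fun i _ => sumE i)) /gdiv.
case E : (idx d j) => [i0|]; last by rewrite big1 ?add0r// => i _.
rewrite (bigD1 i0)//= eqxx big1 ?addr0// => i ii0.
by case: eqP => // -[ei]; rewrite ei eqxx in ii0.
Qed.

Lemma dapprox_lin a f g t d j :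
  dapprox (fun d j => a * f d j + g d j) t d j = a * dapprox f t d j + dapprox g t d j.
Proof.
elim: t d j => [|t IH] d j; first by rewrite /dapprox /= mulr0 addr0.
rewrite /dapprox !iterS -!/(dapprox _ t) /dstep.
rewrite (eq_bigr (fun i => a * (\sum_(1 <= e < d.+1 | (e %| d)%N)
    qof (dapprox f t) i e * hrest i (d %/ e)%N j) +
  \sum_(1 <= e < d.+1 | (e %| d)%N) qof (dapprox g t) i e * hrest i (d %/ e)%N j)).
  by rewrite big_split/= -mulr_sumr; ring.
move=> i _; rewrite mulr_sumr -big_split; apply: eq_bigr => e _ /=.
rewrite /qof; case: ifP => _; last by ring.
by rewrite IH; ring.
Qed.

Lemma gdiv_lin a f g d j :
  gdiv (fun d j => a * f d j + g d j) d j = a * gdiv f d j + gdiv g d j.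
Proof.
rewrite /gdiv /udiv; case: (idx d j) => [_|]; first by rewrite mulr0 addr0.
exact: dapprox_lin.
Qed.

Lemma gdiv_low f X : (forall d j, (wgt d j < X)%N -> f d j = 0) ->
  forall d j, (wgt d j < X)%N -> gdiv f d j = 0.
Proof.
move=> f0; have u0 t : forall d j, (wgt d j < X)%N -> dapprox f t d j = 0.
  elim: t => // t IH d j wX; rewrite /dapprox iterS -/(dapprox f t).
  rewrite (@dstep_local f _ (fun _ _ => 0)); last first.
    by move=> d' j' w'; apply: IH; exact: ltn_trans wX.
  rewrite /dstep f0// sub0r big1 ?oppr0// => i _; rewrite big1// => e _.
  by rewrite /qof if_same mul0r.
by move=> d j wX; rewrite /gdiv; case: (idx d j) => [_ //|]; exact: u0.
Qed.

(* For large [t] the weights [w ^+ t] make the part of each divisor beyond its  *)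
(* leading term arbitrarily small relative to that term; this is what makes     *)
(* the division converge with a bound that does not depend on the dividend.     *)
Lemma hrest_small (c : R) i : 0 < c -> exists s, forall t d j, (s <= t)%N -> (0 < d)%N ->
  (wgt (ld i) (lj i))%:R ^+ t * nm (hrest i d j) <= c / d%:R ^+ 2 * (wgt d j)%:R ^+ t.
Proof.
move=> c0; have [M [s [M0 hM]]] := h_growth i.
set W := wgt (ld i) (lj i).
have W0 : (0 < W)%N by rewrite wgt_gt0 (smooth_gt0 (ld_smooth i)).
have q01 : 0 <= (W%:R / W.+1%:R : R) < 1.
  by rewrite divr_ge0//= ltr_pdivrMr// mul1r ltr_nat.
have [t0 t0P] := geom_small (M * W%:R ^+ (s + 2)) q01 c0.
exists (s + 2 + t0)%N => t d j st d0.
have [->|r0] := eqVneq (hrest i d j) 0.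
  by rewrite nm0 mulr0 mulr_ge0 ?divr_ge0 ?exprn_ge0// ltW.
have Wlt := hrest_gt r0; set w := wgt d j in Wlt *.
have w0 : (0 < w)%N by exact: leq_trans Wlt.
have dw : (d <= w)%N by exact: leq_wgt.
have -> : t = (s + 2 + t0 + (t - (s + 2 + t0)))%N by rewrite subnKC.
set t1 := (t - _)%N; rewrite (exprD _ (s + 2 + t0)) (exprD _ (s + 2 + t0)).
have h1 : W%:R ^+ t1 <= w%:R ^+ t1 :> R.
  by rewrite lerXn2r ?nnegrE ?ler0n// ler_nat ltnW.
have h2 : W%:R ^+ (s + 2 + t0) * nm (hrest i d j) <= c / d%:R ^+ 2 * w%:R ^+ (s + 2 + t0).
  have rM : nm (hrest i d j) <= M * d%:R ^+ s.
    rewrite /hrest; case: ifP => _; last exact: hM.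
    by rewrite nm0 mulr_ge0 ?exprn_ge0.
  have h3 : M * W%:R ^+ (s + 2) * W%:R ^+ t0 <= c * W.+1%:R ^+ t0.
    by rewrite -ler_pdivrMr ?natr_exp_gt0// (le_trans _ t0P)// expr_div_n mulrA.
  have h4 : c * W.+1%:R ^+ t0 <= c * w%:R ^+ t0.
    by rewrite ler_pM2l// lerXn2r ?nnegrE ?ler0n// ler_nat.
  have h5 : d%:R ^+ s * d%:R ^+ 2 <= w%:R ^+ (s + 2) :> R.
    by rewrite -exprD lerXn2r ?nnegrE ?ler0n// ler_nat.
  rewrite mulrAC ler_pdivlMr ?natr_exp_gt0//.
  apply: (@le_trans _ _ (W%:R ^+ (s + 2 + t0) * (M * d%:R ^+ s) * d%:R ^+ 2)).
    by rewrite ler_wpM2r ?exprn_ge0// ler_wpM2l ?exprn_ge0.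
  rewrite (exprD _ (s + 2)) [X in _ <= _ * X]exprD.
  have -> : W%:R ^+ (s + 2) * W%:R ^+ t0 * (M * d%:R ^+ s) * d%:R ^+ 2 =
    (M * W%:R ^+ (s + 2) * W%:R ^+ t0) * (d%:R ^+ s * d%:R ^+ 2) :> R by ring.
  have -> : c * (w%:R ^+ (s + 2) * w%:R ^+ t0) = (c * w%:R ^+ t0) * w%:R ^+ (s + 2) :> R by ring.
  rewrite ler_pM ?mulr_ge0 ?exprn_ge0//.
  exact: le_trans h4.
rewrite mulrAC [leRHS]mulrA ler_pM ?mulr_ge0 ?exprn_ge0 ?nm_ge0//.
Qed.

Lemma sum_dvdn_rev (F : nat -> R) d : (0 < d)%N ->
  \sum_(1 <= e < d.+1 | (e %| d)%N) F (d %/ e)%N = \sum_(1 <= e < d.+1 | (e %| d)%N) F e.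
Proof.
move=> d0.
rewrite -!(big_filter (index_iota 1 d.+1) (fun e => (e %| d)%N)).
set s := [seq e <- _ | _].
rewrite -(big_map (fun e => d %/ e)%N xpredT F); apply: perm_big.
have sE e : (e \in s) = (e %| d)%N.
  rewrite mem_filter mem_index_iota ltnS; have [ed|//] := boolP (e %| d)%N.
  by rewrite (dvdn_gt0 d0 ed) dvdn_leq.
have us : uniq s by rewrite filter_uniq// iota_uniq.
apply: uniq_perm => //.
  rewrite map_inj_in_uniq// => x y; rewrite !sE => xd yd e.
  have dK z : (z %| d)%N -> (d %/ (d %/ z) = z)%N by move=> zd; rewrite divnA// mulKn.
  by rewrite -[LHS](dK x xd) -[RHS](dK y yd) e.
move=> x; rewrite sE; apply/mapP/idP => [[e]|xd].
  by rewrite sE => ed ->; rewrite dvdn_div.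
by exists (d %/ x)%N; rewrite ?sE ?dvdn_div// divnA// mulKn.
Qed.

Definition bounded_by f (B : R) t := forall d j, nm (f d j) <= B * (wgt d j)%:R ^+ t.

Lemma udiv_bound : exists s, forall t B f, (s <= t)%N -> 0 <= B ->
  bounded_by f B t -> bounded_by (udiv f) (2 * B) t.
Proof.
(* Each of the k divisors contributes at most 4c times the bound: a factor 2 from the bound 2B under
   induction, and 2 from the sum of the inverse squares. Together they stay below B. *)
pose c : R := (4 * k.+1%:R)^-1; have c0 : 0 < c by rewrite invr_gt0 mulr_gt0.
have /choice[s sP] := fun i => hrest_small i c0.
exists (\max_i s i) => t B f st B0 fB d j; rewrite /udiv.
move: (wgt d j).+1 => T; elim: T d j => [|T IH] d j.
  by rewrite /dapprox /= nm0 !mulr_ge0 ?exprn_ge0.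
rewrite /dapprox iterS -/(dapprox f T) /dstep (le_trans (nmB _ _))//.
rewrite mulr_natl mulr2n mulrDl lerD//.
have [->|d0] := posnP d.
  rewrite big1 ?nm0 ?mulr_ge0 ?exprn_ge0// => i _; rewrite big_geq//.
rewrite (le_trans (nm_sum _ _ _))//.
apply: (@le_trans _ _ (\sum_(i < k) (4 * c * B * (wgt d j)%:R ^+ t))).
  apply: ler_sum => i _; rewrite (le_trans (nm_sum _ _ _))//.
  apply: (@le_trans _ _ (\sum_(1 <= e < d.+1 | (e %| d)%N)
      (2 * B * c * (wgt d j)%:R ^+ t) * (d %/ e)%:R ^- 2)).
    rewrite big_nat_cond [leRHS]big_nat_cond; apply: ler_sum => e /andP[/andP[e0 _] ed].
    have de0 : (0 < d %/ e)%N by rewrite divn_gt0// dvdn_leq.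
    rewrite nmM; apply: (@le_trans _ _ (2 * B * (wgt (e * ld i) (lj i))%:R ^+ t * nm (hrest i (d %/ e)%N j))).
      rewrite ler_wpM2r ?nm_ge0// /qof; case: ifP => _; first exact: IH.
      by rewrite nm0 !mulr_ge0 ?exprn_ge0.
    have sit : (s i <= t)%N by apply: leq_trans st; exact: leq_bigmax.
    have := sP i t (d %/ e)%N j sit de0.
    rewrite wgtM natrM exprMn => hs.
    have -> : (wgt d j)%:R ^+ t = e%:R ^+ t * (wgt (d %/ e) j)%:R ^+ t :> R.
      by rewrite -exprMn -natrM -wgtM mulnC divnK.
    have -> : 2 * B * (e%:R ^+ t * (wgt (ld i) (lj i))%:R ^+ t) * nm (hrest i (d %/ e)%N j) =
       (2 * B * e%:R ^+ t) * ((wgt (ld i) (lj i))%:R ^+ t * nm (hrest i (d %/ e)%N j)) by ring.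
    have -> : 2 * B * c * (e%:R ^+ t * (wgt (d %/ e) j)%:R ^+ t) * (d %/ e)%:R ^- 2 =
       (2 * B * e%:R ^+ t) * (c / (d %/ e)%:R ^+ 2 * (wgt (d %/ e) j)%:R ^+ t) :> R.
      by move: ((d %/ e)%:R ^- 2) => z; ring.
    by rewrite ler_wpM2l// !mulr_ge0 ?exprn_ge0.
  rewrite -mulr_sumr (sum_dvdn_rev (fun e => e%:R ^- 2))//.
  have -> : 4 * c * B * (wgt d j)%:R ^+ t = (2 * B * c * (wgt d j)%:R ^+ t) * 2 by ring.
  rewrite ler_wpM2l ?mulr_ge0 ?exprn_ge0 ?(ltW c0)//.
  apply: le_trans (sum_inv_sqr R 1 d.+1).
  rewrite big_mkcond [leRHS]big_mkcond; apply: ler_sum => e _.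
  case: ifP => ed; last by case: ifP => // _; rewrite invr_ge0 exprn_ge0.
  by rewrite (dvdn_gt0 d0 ed).
rewrite sumr_const card_ord -[X in X <= _]mulr_natl.
have -> : k%:R * (4 * c * B * (wgt d j)%:R ^+ t) = (k%:R / k.+1%:R) * (B * (wgt d j)%:R ^+ t).
  have : k.+1%:R != 0 :> R by rewrite pnatr_eq0.
  by rewrite /c; move: ((wgt d j)%:R ^+ t) (k.+1%:R) => z y y0; field.
rewrite ler_piMl ?mulr_ge0 ?exprn_ge0//.
by rewrite ler_pdivrMr// mul1r ler_nat.
Qed.

End Division.

(** * Normal forms modulo a submodule *)

Section SubmoduleDivision.
Variables (R : realType) (m n : nat) (zeta : 'rV[(R[i] : numFieldType)]_m).
Local Notation C := R[i].
Local Notation O := (germ zeta (R[i]^o : normedModType R[i])).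
Local Notation W := ('rV[(R[i] : numFieldType)]_n : normedModType R[i]).
Local Notation GW := (germ zeta W).
Implicit Types (F G : GW).

Let complW : ncomplete W := @rV_ncomplete R 1 n.
Let complC : ncomplete R[i]^o := @complex_ncomplete R.

Definition cf F (d : nat) (j : 'I_n) : C := (tau F d : 'rV[C]_n) 0 j.

Lemma cfD F G d j : cf (F + G) d j = cf F d j + cf G d j.
Proof. by rewrite /cf tauD// mxE. Qed.

Lemma cfN F d j : cf (- F) d j = - cf F d j.
Proof. by rewrite /cf tauN// mxE. Qed.

Lemma cf0 d j : cf 0 d j = 0.
Proof. by rewrite /cf tau0// mxE. Qed.

Lemma cf_sum k (F : 'I_k -> GW) d j : cf (\sum_i F i) d j = \sum_i cf (F i) d j.
Proof.
elim: k F => [|k IH] F; first by rewrite !big_ord0 cf0.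
by rewrite !big_ord_recl cfD IH.
Qed.

Lemma cf_supp F : fsupp m (cf F).
Proof. by move=> d j nd; rewrite /cf tau_supp// mxE. Qed.

Lemma cfZ (a : O) F d j : cf (a *: F) d j =
  \sum_(1 <= e < d.+1 | (e %| d)%N) (tau a e : C) * cf F (d %/ e)%N j.
Proof.
rewrite /cf tauZ// /dconv summxE; apply: eq_bigr => e _.
by rewrite mxE.
Qed.

Lemma cf_inj F G : (forall d j, cf F d j = cf G d j) -> F = G.
Proof.
move=> FG; apply: (tau_inj complW); apply/funext => d; apply/rowP => j.
exact: FG.
Qed.

Lemma cf_bounded F : exists M s, 0 <= M /\ bounded_by m (cf F) M s.
Proof.
have [M [s [M0 FM]]] := tau_growth complW F; exists M, s; split=> // d j.
apply: (le_trans (nm_mx_coord _ _ _)); apply: (le_trans (FM d)).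
by rewrite ler_wpM2l// lerXn2r ?nnegrE ?ler0n// ler_nat leq_wgt.
Qed.

Lemma bounded_by_le (f : nat -> 'I_n -> C) B B' t t' : 0 <= B -> B <= B' -> (t <= t')%N ->
  fsupp m f -> bounded_by m f B t -> bounded_by m f B' t'.
Proof.
move=> B0 BB tt f0 fB d j; have [sd|/f0->] := boolP (smooth m d); last first.
  by rewrite nm0 mulr_ge0 ?exprn_ge0// (le_trans B0).
apply: (le_trans (fB d j)); rewrite ler_pM ?exprn_ge0//.
by rewrite ler_weXn2l// ler1n wgt_gt0 (smooth_gt0 sd).
Qed.

Lemma cf_surj (f : nat -> 'I_n -> C) B t : fsupp m f -> 0 <= B -> bounded_by m f B t ->
  exists G, forall d j, cf G d j = f d j.
Proof.
move=> f0 B0 fB; pose a d : W := \row_j f d j.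
pose Q := nprime (m + n).
have [||d|G GE] := @tau_surj R m zeta W complW a (B * Q%:R ^+ t) t.
- by move=> d nd; apply/rowP => j; rewrite !mxE f0.
- by rewrite mulr_ge0 ?exprn_ge0.
- apply: nm_mx_le => [|i j]; first by rewrite !mulr_ge0 ?exprn_ge0.
  rewrite mxE; apply: (le_trans (fB d j)); rewrite -mulrA ler_wpM2l// -exprMn -natrM.
  rewrite lerXn2r ?nnegrE ?ler0n// ler_nat /wgt mulnC leq_mul2r nprime_mono.
  by rewrite leq_add2l ltnW ?orbT.
by exists G => d j; rewrite /cf GE mxE.
Qed.

Definition germ_cst (v : C) : O := germ_of (holomorphic_cst zeta (v : R[i]^o)).

Lemma cf_cst v F d j : cf (germ_cst v *: F) d j = v * cf F d j.
Proof.
have [->|d0] := posnP d; first by rewrite !cf_supp ?mulr0.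
rewrite /cf tauZ//.
have -> : tau (germ_cst v) = (fun d => (delta_coef 1 (v : R[i]^o)) d).
  exact: (tau_cst complC (rp_of _)).
rewrite /dconv big_mkcond (bigD1_seq 1%N) ?mem_index_iota ?iota_uniq//=.
rewrite dvd1n /delta_coef eqxx divn1 big1 ?addr0 ?mxE// => e e1.
by rewrite (negbTE e1) scale0r if_same.
Qed.

Variable K : GW -> Prop.
Hypothesis K0 : K 0.
Hypothesis KD : forall F G, K F -> K G -> K (F + G).
Hypothesis KZ : forall (a : O) F, K F -> K (a *: F).

Let lead (d : nat) (j : 'I_n) F := [/\ K F, cf F d j = 1 &
  forall d' j', (wgt m d' j' < wgt m d j)%N -> cf F d' j' = 0].

Lemma exists_lead F : K F -> F <> 0 -> exists d j F', [/\ smooth m d, cf F d j != 0 & lead d j F'].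
Proof.
move=> KF F0.
have exN : exists N, `[< exists d j, wgt m d j = N /\ cf F d j != 0 >].
  apply: contrapT => h; apply: F0; apply: cf_inj => d j; rewrite cf0.
  apply/eqP; apply: contrapT => /negP c0; apply: h; exists (wgt m d j).
  by apply/asboolP; exists d, j.
case: (ex_minnP exN) => N /asboolP[d [j [wN c0]]] minN.
exists d, j, (germ_cst (cf F d j)^-1 *: F); split=> //.
  by apply: contraNT c0 => nd; rewrite cf_supp.
split; [exact: KZ|by rewrite cf_cst mulVf|].
move=> d' j' w'; rewrite cf_cst; have [->|c'] := eqVneq (cf F d' j') 0; first by rewrite mulr0.
have : (wgt m d j <= wgt m d' j')%N.
  by rewrite wN; apply: minN; apply/asboolP; exists d', j'.
by rewrite leqNgt w'.
Qed.

(* [nf] is the remainder of the division by leading terms of [K]. *)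
Theorem submodule_division : exists (nf : GW -> nat -> 'I_n -> C) (k : nat)
    (H : 'I_k -> GW) (s0 : nat) (c : nat -> R),
  [/\ forall i, K (H i), (forall t, 0 <= c t),
      forall v F G d j, nf (germ_cst v *: F + G) d j = v * nf F d j + nf G d j,
      (forall F, K F -> forall d j, nf F d j = 0) /\
      (forall F X, (forall d j, (wgt m d j < X)%N -> cf F d j = 0) ->
        forall d j, (wgt m d j < X)%N -> nf F d j = 0) &
      forall F, exists (a : 'I_k -> O) G,
        [/\ F = \sum_i a i *: H i + G, forall d j, cf G d j = nf F d j &
        forall t B, (s0 <= t)%N -> 0 <= B -> bounded_by m (cf F) B t ->
          bounded_by m (nf F) (2 * B) t /\
          forall i, growth (tau (a i)) (c t * B) t]].
Proof.
(* Dickson's lemma in each component: finitely many leading terms divide all leading terms of K. *)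
have /choice[s sP] := fun j => dickson m (fun d => smooth m d /\ exists F, lead d j F).
pose L := [seq (d, j) | j <- enum 'I_n, d <- s j].
have LP p : p \in L -> smooth m p.1 /\ exists F, lead p.1 p.2 F.
  by move=> /allpairsPdep[j [d [_ ds ->]]]; exact: (sP j).1.
pose k := size L; pose ld (i : 'I_k) := (tnth (in_tuple L) i).1.
pose lj (i : 'I_k) := (tnth (in_tuple L) i).2.
have ldP i : smooth m (ld i) /\ exists F, lead (ld i) (lj i) F by apply: LP; exact: mem_tnth.
have /choice[H HP] := fun i => (ldP i).2.
have ld_smooth i : smooth m (ld i) := (ldP i).1.
pose h i d : 'rV[C]_n := tau (H i) d.
have h_supp i : smooth_supp m (h i : nat -> W) by exact: tau_supp.
have h_lead i : h i (ld i) 0 (lj i) = 1 by have [] := HP i.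
have h_low i d j : (wgt m d j < wgt m (ld i) (lj i))%N -> h i d 0 j = 0.
  by have [_ _] := HP i; exact.
have h_growth i : exists M s, 0 <= M /\ forall d j, nm (h i d 0 j) <= M * d%:R ^+ s.
  have [M [t [M0 HM]]] := tau_growth complW (H i); exists M, t; split=> // d j.
  by apply: (le_trans (nm_mx_coord _ _ _)); exact: HM.
have idxE d j F : smooth m d -> lead d j F -> idx ld lj d j != None.
  move=> sd lF; have [|e es ed] := (sP j).2 d sd; first by split=> //; exists F.
  have : (e, j) \in L by apply/allpairsPdep; exists j, e; rewrite mem_enum.
  move=> /(@tnthP _ _ (in_tuple L))[i iE]; rewrite /idx; case: pickP => // /(_ i).
  by rewrite /ld /lj -iE /= ed eqxx.
have [s0 s0P] := udiv_bound ld_smooth h_supp h_low h_growth.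
pose u F := udiv m ld lj h (cf F); pose nf F := gdiv m ld lj h (cf F).
have uB t B F : (s0 <= t)%N -> 0 <= B -> bounded_by m (cf F) B t ->
    bounded_by m (u F) (2 * B) t by exact: s0P.
have nfB t B F : (s0 <= t)%N -> 0 <= B -> bounded_by m (cf F) B t ->
    bounded_by m (nf F) (2 * B) t.
  move=> st B0 FB d j; rewrite /nf /gdiv; case: (idx ld lj d j) => [_|].
    by rewrite nm0 !mulr_ge0 ?exprn_ge0.
  exact: uB.
have nf_supp F : fsupp m (nf F).
  move=> d j nd; rewrite /nf /gdiv udiv_supp//; last exact: cf_supp.
  by case: (idx _ _ _ _).
pose c t : R := 2 * \sum_i (wgt m (ld i) (lj i))%:R ^+ t.
have c0 t : 0 <= c t by rewrite mulr_ge0// sumr_ge0// => i _; rewrite exprn_ge0.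
have qB t B F i : (s0 <= t)%N -> 0 <= B -> bounded_by m (cf F) B t ->
    growth (qdiv m ld lj h (cf F) i : nat -> R[i]^o) (c t * B) t.
  move=> st B0 FB e; rewrite /qdiv /qof; case: ifP => _; last first.
    by rewrite nm0 mulr_ge0 ?exprn_ge0// mulr_ge0.
  apply: (le_trans (uB t B F st B0 FB _ _)); rewrite wgtM natrM exprMn.
  have -> : c t * B * e%:R ^+ t = 2 * B * (e%:R ^+ t * (\sum_i (wgt m (ld i) (lj i))%:R ^+ t)).
    by rewrite /c; ring.
  rewrite ler_wpM2l ?mulr_ge0// ler_wpM2l ?exprn_ge0//.
  by rewrite (bigD1 i)//= lerDl sumr_ge0// => i' _; rewrite exprn_ge0.
have dec F : exists (a : 'I_k -> O) G, [/\ F = \sum_i a i *: H i + G,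
    forall d j, cf G d j = nf F d j &
    forall i, tau (a i) = (qdiv m ld lj h (cf F) i : nat -> R[i]^o)].
  have [M [t [M0 FM]]] := cf_bounded F; pose t' := maxn s0 t.
  have st : (s0 <= t')%N by exact: leq_maxl.
  have FM' : bounded_by m (cf F) M t'.
    exact: bounded_by_le M0 (lexx _) (leq_maxr _ _) (@cf_supp F) FM.
  have [|G GE] := cf_surj (nf_supp F) _ (nfB t' M F st M0 FM'); first by rewrite mulr_ge0.
  have /choice[a aE] : forall i, exists a : O, tau a = (qdiv m ld lj h (cf F) i : nat -> R[i]^o).
    move=> i; apply: (@tau_surj R m zeta (R[i]^o : normedModType R[i]) complC _ (c t' * M) t').
    - by move=> d nd; rewrite /qdiv /qof (negbTE nd).
    - by rewrite mulr_ge0.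
    - exact: qB.
  exists a, G; split=> //; apply: cf_inj => d j.
  rewrite cfD cf_sum GE (division ld_smooth h_supp h_lead h_low d j (@cf_supp F)).
  by congr (_ + _); apply: eq_bigr => i _; rewrite cfZ aE.
have KH i : K (H i) by have [] := HP i.
have Ksum (a : 'I_k -> O) : K (\sum_i a i *: H i).
  by apply: (big_ind K) => // i _; exact: KZ.
exists nf, k, H, s0, c; split=> //.
- move=> v F G d j; rewrite /nf -gdiv_lin; congr (gdiv _ _ _ _ _ _ _).
  by apply/funext => d'; apply/funext => j'; rewrite cfD cf_cst.
- split; last by move=> F X FX; exact: gdiv_low.
  move=> F KF; have [a [G [FE GE _]]] := dec F.
  have KG : K G.
    have -> : G = F + germ_cst (-1) *: (\sum_i a i *: H i).
      apply: cf_inj => d j; rewrite cfD cf_cst FE cfD; ring.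
    by apply: KD => //; apply: KZ; exact: Ksum.
  (* The remainder of an element of K lies in K. If nonzero, its term of least weight would be
     divisible by a chosen leading term, but a remainder has no such term. *)
  have [G0|/eqP G0] := eqVneq G 0; first by move=> d j; rewrite -GE G0 cf0.
  have [d [j [F' [sd cG lF]]]] := exists_lead KG G0.
  move: cG; rewrite GE /nf /gdiv; case E : (idx ld lj d j) => [//|]; first by rewrite eqxx.
  by have := idxE d j F' sd lF; rewrite E.
move=> F; have [a [G [FE GE aE]]] := dec F; exists a, G; split=> // t B st B0 FB.
split; first exact: nfB.
by move=> i; rewrite aE; exact: qB.
Qed.

End SubmoduleDivision.

(** * Automatic continuity *)

Section GeometricSeries.
Variables (R : realType) (E : normedModType R[i]) (e : nat -> E).
Local Notation C := R[i].
Hypothesis complE : ncomplete E.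
Hypothesis e1 : forall k, nm (e k) <= 1.

(** Horner form of the sum of a^l e_(k+l) over l < N. *)
Fixpoint gsum (a : C) N k : E := if N is N'.+1 then e k + a *: gsum a N' k.+1 else 0.

Lemma gsum_le (a : C) N k : nm a <= 2^-1 -> nm (gsum a N k) <= 2.
Proof.
move=> a1; elim: N k => [|N IH] k /=; first by rewrite nm0.
rewrite (le_trans (nmD _ _))// nmZ.
have : nm a * nm (gsum a N k.+1) <= 2^-1 * 2 by rewrite ler_pM ?nm_ge0.
have := e1 k; lra.
Qed.

Lemma gsum_tail (a : C) N l k : nm a <= 2^-1 ->
  nm (gsum a (N + l) k - gsum a N k) <= 2 / 2 ^+ N.
Proof.
move=> a1; elim: N k => [|N IH] k /=.
  by rewrite add0n subr0 expr0 divr1 gsum_le.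
rewrite opprD addrACA subrr add0r -scalerBr nmZ.
rewrite exprS invfM mulrCA ler_pM ?nm_ge0//.
Qed.

Lemma gsum_cvg (a : C) k : nm a <= 2^-1 -> exists l, ncvg (fun N => gsum a N k) l.
Proof.
move=> a1; apply: complE => d d0; have [N NP] := half_pow_le (ler0n R 4) d0.
exists N => n n' Nn Nn'.
have h n1 : (N <= n1)%N -> nm (gsum a n1 k - gsum a N k) <= 2 / 2 ^+ N.
  by move=> Nn1; rewrite -(subnKC Nn1); exact: gsum_tail.
have -> : gsum a n k - gsum a n' k = (gsum a n k - gsum a N k) - (gsum a n' k - gsum a N k).
  by zmod.
apply: (le_trans (nmB _ _)); apply: (le_trans (lerD (h n Nn) (h n' Nn'))).
by rewrite -mulrDl -natrD.
Qed.

Lemma gsum_lim_le (a : C) k l N : nm a <= 2^-1 -> ncvg (fun N => gsum a N k) l ->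
  nm (gsum a N k - l) <= 2 / 2 ^+ N.
Proof.
move=> a1 al; apply: (@ncvg_le R E (fun n => gsum a N k - gsum a n k) _ _ N).
  by move=> n Nn; rewrite nmBC -(subnKC Nn); exact: gsum_tail.
by apply: ncvgB al => d d0; exists 0%N => n _; rewrite subrr nm0 ltW.
Qed.

Lemma gsum_limS (a : C) k l l' : ncvg (fun N => gsum a N k) l ->
  ncvg (fun N => gsum a N k.+1) l' -> l = e k + a *: l'.
Proof.
move=> al al'; rewrite addrC.
apply: (@ncvg_unique R E (fun N => gsum a N.+1 k)).
  by move=> d /al[n0 n0P]; exists n0 => n nn; apply: n0P; exact: leqW.
have ek : ncvg (fun=> e k) (e k) by move=> d d0; exists 0%N => n _; rewrite subrr nm0 ltW.
by have := ncvg_lin a al' ek; under eq_fun do rewrite addrC.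
Qed.

End GeometricSeries.

Section GermSeries.
Variables (R : realType) (m : nat) (zeta : 'rV[(R[i] : numFieldType)]_m).
Variables (E : normedModType R[i]).
Local Notation O := (germ zeta (R[i]^o : normedModType R[i])).
Hypothesis complE : ncomplete E.

Definition gcst (v : E) : germ zeta E := germ_of (holomorphic_cst zeta v).

Lemma rp_cst (v : E) : \forall y \near zeta, rp (gcst v) y = v.
Proof. exact: rp_of. Qed.

Lemma gcst_lin (v : R[i]) (x y : E) :
  gcst (v *: x + y) = germ_cst zeta v *: gcst x + gcst y.
Proof.
apply/germ_eqP; have h1 := rp_cst (v *: x + y).
have h2 := rpD (germ_cst zeta v *: gcst x) (gcst y); have h3 := rpZ (germ_cst zeta v) (gcst x).
have h4 := rp_cst x; have h5 := rp_cst y.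
have h6 : \forall z \near zeta, rp (germ_cst zeta v) z = v by exact: rp_of.
near=> z; have q1 := near h1 z; have q2 := near h2 z; have q3 := near h3 z.
have q4 := near h4 z; have q5 := near h5 z; have q6 := near h6 z.
by rewrite q1// q2// q3// q4// q5// q6.
Unshelve. all: by end_near. Qed.

(** f_k is the sum of S^l e_(k+l) over all l. Near zeta one has |S| <= 1/2, so all these series
    converge on a common neighbourhood. *)
Lemma germ_series (S : O) (e : nat -> E) : germ_val S = 0 -> (forall k, nm (e k) <= 1) ->
  exists f : nat -> germ zeta E, forall k, f k = gcst (e k) + S *: f k.+1.
Proof.
move=> S0 e1.
have [r [M [r0 hM]]] := holomorphic_holb (rp_hol S).
have dS : differentiable (rp S) zeta by have [] := hM zeta; rewrite ?subrr ?nm0.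
have nS : \forall y \near zeta, nm (rp S y) <= 2^-1.
  have cS : {for zeta, continuous (rp S)} by exact: differentiable_continuous.
  have hS : \forall z \near (rp S zeta : (R[i]^o : normedModType R[i])), nm z <= 2^-1.
    apply/nm_nearP; exists 2^-1; first by rewrite invr_gt0.
    by move=> z /ltW; rewrite (_ : rp S zeta = 0) ?subr0.
  exact: cS hS.
have /nm_nearP[r1 r10 r1P] := nS.
pose r2 := Num.min r r1; have r20 : 0 < r2 by rewrite lt_min r0.
have lim_ex k y : exists l, nm (rp S y) <= 2^-1 -> ncvg (fun N => gsum e (rp S y) N k) l.
  have [sy|_] := boolP (nm (rp S y) <= 2^-1); last by exists 0.
  by have [l ?] := gsum_cvg complE e1 k sy; exists l.
have /choice[g gP] : forall k, exists g : 'rV[(R[i] : numFieldType)]_m -> E, forall y,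
    nm (rp S y) <= 2^-1 -> ncvg (fun N => gsum e (rp S y) N k) (g y).
  by move=> k; have [g gP] := choice (lim_ex k); exists g.
have dgs y N k : nm (y - zeta) < r2 -> differentiable (fun y => gsum e (rp S y) N k) y.
  rewrite lt_min => /andP[yr _]; elim: N k => [|N IH] k /=; first exact: differentiable_cst.
  apply: differentiableD; first exact: differentiable_cst.
  apply: differentiable_scale; last exact: IH.
  by have [] := hM y yr.
have hg k : holomorphic_at zeta (g k).
  have dg y : nm (y - zeta) < r2 -> differentiable (g k) y; last by apply/nm_nearP; exists r2.
  move=> yr2; have r3 : 0 < r2 - nm (y - zeta) by rewrite subr_gt0.
  have sub z : nm (z - y) < r2 - nm (y - zeta) -> nm (z - zeta) < r2.
    move=> zy; have -> : z - zeta = (z - y) + (y - zeta) by zmod.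
    by apply: (le_lt_trans (nmD _ _)); rewrite -ltrBrDr.
  have subS z : nm (z - y) < r2 - nm (y - zeta) -> nm (rp S z) <= 2^-1.
    by move/sub; rewrite lt_min => /andP[_ /r1P].
  apply: (weierstrass complE r3 (fn := fun N y => gsum e (rp S y) N k) (M := 2)).
    move=> N z zy; split; first exact/dgs/sub.
    exact/gsum_le/subS.
  move=> d d0; have [N NP] := half_pow_le (ler0n R 2) d0.
  exists N => n Nn z zy.
  have := gsum_lim_le e1 n (subS z zy) (gP k z (subS z zy)) => /le_trans; apply.
  apply: le_trans NP; rewrite ler_wpM2l// lef_pV2 ?posrE ?exprn_gt0// ler_weXn2l// ler1n//.
exists (fun k => germ_of (hg k)) => k; apply/germ_eqP.
have h1 := rp_of (hg k); have h2 := rp_of (hg k.+1).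
have h3 := rpD (gcst (e k)) (S *: germ_of (hg k.+1)); have h4 := rpZ S (germ_of (hg k.+1)).
have h5 := rp_cst (e k).
near=> y; have q1 := near h1 y; have q2 := near h2 y; have q3 := near h3 y.
have q4 := near h4 y; have q5 := near h5 y; have q6 := near nS y.
rewrite q1// q3// q4// q5// q2//; apply: (@gsum_limS R E e (rp S y)).
  by apply: (gP k y); exact: q6.
by apply: (gP k.+1 y); exact: q6.
Unshelve. all: by end_near. Qed.

End GermSeries.

(** * A uniform boundedness principle *)

Section UniformBoundedness.
Variables (R : realType) (E : normedModType R[i]) (I : Type).
Local Notation C := R[i].
Hypothesis complE : ncomplete E.
Variables (mu : E -> I -> C) (q : nat -> I -> R).
Hypothesis mu_lin : forall a x y i, mu (a *: x + y) i = a * mu x i + mu y i.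
Hypothesis mu_bounded : forall i, exists c : R, forall x, nm (mu x i) <= c * nm x.
Hypothesis mu_pointwise : forall x, exists k0, forall k i, (k0 <= k)%N -> nm (mu x i) <= q k i.

(** Baire's argument with explicit balls: otherwise nested balls can be chosen so that on the k-th
    one some functional exceeds [q k], and their common point contradicts the pointwise bound. *)
Lemma uniform_bound : exists k c, forall x i, nm (mu x i) <= c * nm x * q k i.
Proof.
apply: contrapT => hn.
have unb k c : exists x i, c * nm x * q k i < nm (mu x i).
  apply: contrapT => h; apply: hn; exists k, c => x i; rewrite leNgt.
  by apply/negP => xi; apply: h; exists x, i.
have mu0 i : mu 0 i = 0.
  have := mu_lin 1 0 0 i; rewrite scaler0 addr0 mul1r => h.
  by apply: (@addrI _ (mu 0 i)); rewrite addr0.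
have muD x y i : mu (x + y) i = mu x i + mu y i by rewrite -[x]scale1r mu_lin mul1r scale1r.
have muZ a x i : mu (a *: x) i = a * mu x i by rewrite -[a *: x]addr0 mu_lin mu0 !addr0.
have step (p : nat * (E * R)) : exists xd' : E * R, 0 < p.2.2 ->
    [/\ 0 < xd'.2, xd'.2 <= p.2.2 / 2, nm (xd'.1 - p.2.1) <= p.2.2 / 2 &
     exists i, forall z, nm (z - xd'.1) <= xd'.2 -> q p.1 i < nm (mu z i)].
  case: p => k [x d] /=; have [d0|_] := boolP (0 < d); last by exists (x, d).
  have [x' [i [x'x x'i]]] : exists x' i, nm (x' - x) <= d / 2 /\ q k i < nm (mu x' i).
    have [y [i yi]] := unb k (4 / d).
    (* If x itself does not violate the bound, x + a y does: a y has length d/2 and value above 2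
       [q k i], by the constant 4/d. *)
    have [xi|xi] := ltP (q k i) (nm (mu x i)).
      by exists x, i; rewrite subrr nm0 divr_ge0// ltW.
    have y0 : 0 < nm y.
      rewrite lt_neqAle eq_sym nm_eq0 nm_ge0 andbT; apply/eqP => y0.
      by move: yi; rewrite y0 mu0 !nm0 mulr0 mul0r ltxx.
    pose a : R := d / 2 / nm y; have a0 : 0 < a by rewrite !divr_gt0.
    have na : nm (a%:C%C : C) = a by rewrite nm_real gtr0_norm.
    exists (x + a%:C%C *: y), i; split.
      by rewrite addrAC subrr add0r nmZ na /a mulfVK// gt_eqF.
    have h : 2 * q k i < nm (mu (a%:C%C *: y) i).
      rewrite muZ nmM na -ltr_pdivrMl//; apply: le_lt_trans yi.
      rewrite le_eqVlt; apply/orP; left; apply/eqP; rewrite /a.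
      by field; rewrite !gt_eqF.
    have : nm (mu (a%:C%C *: y) i) <= nm (mu (x + a%:C%C *: y) i) + nm (mu x i).
      by rewrite muD (le_trans _ (nmB _ _))// addrAC subrr add0r.
    move: h xi; lra.
  have [c cP] := mu_bounded i.
  pose g := nm (mu x' i) - q k i; have g0 : 0 < g by rewrite subr_gt0.
  pose d' := Num.min (d / 2) (g / (2 * (`|c| + 1))).
  have c0 : 0 < `|c| + 1 by rewrite ltr_wpDl.
  exists (x', d') => _; split=> //=.
  - by rewrite lt_min !divr_gt0// mulr_gt0.
  - by rewrite ge_min lexx.
  exists i => z; rewrite le_min => /andP[_ zx].
  have zc : nm (mu (z - x') i) <= g / 2.
    apply: (le_trans (cP _)); apply: (@le_trans _ _ ((`|c| + 1) * nm (z - x'))).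
      rewrite ler_wpM2r ?nm_ge0// (le_trans (ler_norm c))// lerDl//.
    apply: (le_trans (ler_wpM2l (ltW c0) zx)).
    rewrite le_eqVlt; apply/orP; left; apply/eqP; field; rewrite gt_eqF//.
  have : nm (mu x' i) <= nm (mu z i) + nm (mu (z - x') i).
    apply: le_trans (nmB _ _); have -> : mu z i = mu (z - x') i + mu x' i by rewrite -muD subrK.
    by rewrite addrAC subrr add0r.
  move: zc g0; rewrite /g; lra.
have /choice[st stP] := step.
pose X := fix X k : E * R := if k is k'.+1 then st (k', X k') else (0, 1).
have XS k : X k.+1 = st (k, X k) by [].
have Xd0 k : 0 < (X k).2 by elim: k => //= k IH; have [] := stP (k, X k) IH.
have Xd k : (X k).2 <= 1 / 2 ^+ k.
  elim: k => [|k IH]; first by rewrite expr0 divr1.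
  have [_ h _ _] := stP (k, X k) (Xd0 k); rewrite XS (le_trans h)//.
  by rewrite exprSr invfM mulrA ler_wpM2r// invr_ge0.
have Xn k l : nm ((X (k + l)%N).1 - (X k).1) <= (X k).2 - (X (k + l)%N).2.
  elim: l => [|l IH]; first by rewrite addn0 !subrr nm0.
  rewrite addnS XS; have [_ h1 h2 _] := stP ((k + l)%N, X (k + l)%N) (Xd0 (k + l)%N).
  move: h1 h2; set Y := st _; set Z := X (k + l)%N in IH Y *; set T := X k in IH * => h1 h2.
  have -> : Y.1 - T.1 = (Y.1 - Z.1) + (Z.1 - T.1) by zmod.
  apply: (le_trans (nmD _ _)); move: h1 h2 IH; lra.
have Xle k l : (k <= l)%N -> nm ((X l).1 - (X k).1) <= (X k).2.
  by move=> kl; have := Xn k (l - k)%N; rewrite subnKC// => /le_trans; apply; rewrite gerBl ltW.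
have [x xP] : exists x, ncvg (fun k => (X k).1) x.
  apply: complE => e e0; have [N NP] := half_pow_le ler01 (divr_gt0 e0 (ltr0n R 2)).
  exists N => k l Nk Nl.
  have -> : (X k).1 - (X l).1 = ((X k).1 - (X N).1) - ((X l).1 - (X N).1) by zmod.
  apply: (le_trans (nmB _ _)); have := Xle N k Nk; have := Xle N l Nl; have := Xd N.
  by move: NP; lra.
have xX k : nm (x - (X k).1) <= (X k).2.
  apply: (@ncvg_le R E (fun l => (X l).1 - (X k).1) _ _ k); first by move=> l; exact: Xle.
  by apply: ncvgB xP _ => d d0; exists 0%N => n _; rewrite subrr nm0 ltW.
have [k kP] := mu_pointwise x.
have [_ _ _ [i iP]] := stP (k, X k) (Xd0 k).
by have := iP x (xX k.+1); rewrite ltNge kP.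
Qed.

End UniformBoundedness.

(** * Order and growth under multiplication by scalars *)

Section Weights.
Variables (R : realType) (m n : nat) (zeta : 'rV[(R[i] : numFieldType)]_m).
Local Notation C := R[i].
Local Notation O := (germ zeta (R[i]^o : normedModType R[i])).
Local Notation W := ('rV[(R[i] : numFieldType)]_n : normedModType R[i]).
Local Notation GW := (germ zeta W).
Implicit Types (F G : GW) (a : O).

Definition low X F := forall d j, (wgt m d j < X)%N -> cf F d j = 0.

Lemma low1 F : low 1 F.
Proof.
move=> d j; rewrite ltnS leqn0 muln_eq0 (gtn_eqF (nprime_gt0 _)) orbF => /eqP ->.
exact: cf_supp.
Qed.

Lemma low_sum X k (F : 'I_k -> GW) : (forall i, low X (F i)) -> low X (\sum_i F i).
Proof. by move=> FX d j w; rewrite cf_sum big1// => i _; exact: FX. Qed.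

Lemma tau1 a : tau a 1 = germ_val a.
Proof. by rewrite /tau tcoefE// eqxx big1 ?addr0// => i; rewrite dvdn1 gtn_eqF// nprime_gt1. Qed.

(** A germ vanishing at zeta involves only indices e >= 2, and weights multiply. *)
Lemma low_scale X a F : germ_val a = 0 -> low X F -> low (2 * X) (a *: F).
Proof.
move=> a0 FX d j w; rewrite cfZ big_nat_cond big1// => e /andP[/andP[e0 _] ed].
have [->|e1] := eqVneq e 1%N; first by rewrite tau1 a0 mul0r.
rewrite FX ?mulr0//; move: w; rewrite -{1}(divnK ed) mulnC wgtM.
have : (2 <= e)%N by rewrite ltn_neqAle eq_sym e1.
by nia.
Qed.

Lemma low_exp k a F : germ_val a = 0 -> low (2 ^ k) (a ^+ k *: F).
Proof.
move=> a0; elim: k => [|k IH]; first by rewrite expr0 scale1r; exact: low1.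
by rewrite expnS exprS -scalerA; exact: low_scale.
Qed.

(** The extra exponent pays for the number of divisors of d, which is at most d. *)
Lemma bounded_byZ a F A B t : 0 <= A -> 0 <= B -> growth (tau a) A t ->
  bounded_by m (cf F) B t -> bounded_by m (cf (a *: F)) (A * B) t.+1.
Proof.
move=> A0 B0 aA FB d j; rewrite cfZ (le_trans (nm_sum _ _ _))//.
apply: (@le_trans _ _ (\sum_(1 <= e < d.+1) (A * B * (wgt m d j)%:R ^+ t))).
  rewrite big_mkcond; apply: ler_sum => e _; case: ifP => ed; last first.
    by rewrite !mulr_ge0 ?exprn_ge0.
  rewrite nmM -[X in wgt m X j](divnK ed) mulnC wgtM natrM exprMn mulrACA.
  by rewrite ler_pM ?nm_ge0.
rewrite sumr_const_nat subn1 /= -[leLHS]mulr_natl exprS [leLHS]mulrCA; apply: ler_wpM2l.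
  by rewrite mulr_ge0.
by rewrite ler_wpM2r ?exprn_ge0// ler_nat leq_wgt.
Qed.

Lemma bounded_by_sum k (F : 'I_k -> GW) (B : 'I_k -> R) t :
  (forall i, bounded_by m (cf (F i)) (B i) t) ->
  bounded_by m (cf (\sum_i F i)) (\sum_i B i) t.
Proof.
move=> FB d j; rewrite cf_sum (le_trans (nm_sum _ _ _))// mulr_suml.
by apply: ler_sum => i _; exact: FB.
Qed.

Lemma bounded_byB F G A B t : bounded_by m (cf F) A t -> bounded_by m (cf G) B t ->
  bounded_by m (cf (F - G)) (A + B) t.
Proof.
move=> FA GB d j; rewrite cfD cfN (le_trans (nmB _ _))// mulrDl lerD//.
Qed.

End Weights.

Section KrullIntersection.
Variables (R : realType) (m n : nat) (zeta : 'rV[(R[i] : numFieldType)]_m).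
Local Notation O := (germ zeta (R[i]^o : normedModType R[i])).
Local Notation W := ('rV[(R[i] : numFieldType)]_n : normedModType R[i]).
Local Notation GW := (germ zeta W).
Variables (M : lmodType O) (p : {linear GW -> M}).
Hypothesis p_epi : forall y : M, exists x, p x = y.

(* Every element of [P] lifts to vectors of arbitrarily high order, and the     *)
(* normal form modulo the kernel of [p] respects the order filtration.          *)
Lemma maxideal_stable_eq0 (P : M -> Prop) :
  (forall x, P x -> exists k (a : 'I_k -> O) v,
     [/\ forall i, germ_val (a i) = 0, forall i, P (v i) & x = \sum_i a i *: v i]) ->
  forall x, P x -> x = 0.
Proof.
move=> PE; pose K F := p F = 0.
have [|F G pF pG|a F pF|nf [k [H [s0 [c [KH _ nf_lin [nfK nf_low] nfE]]]]]] :=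
  @submodule_division R m n zeta K.
- exact: linear0.
- by rewrite /K linearD pF pG addr0.
- by rewrite /K linearZ/= pF scaler0.
have lowP l x : P x -> exists y, p y = x /\ low (2 ^ l) y.
  elim: l x => [|l IH] x Px.
    by have [y yx] := p_epi x; exists y; split=> //; exact: low1.
  have [r [a [v [a0 vP ->]]]] := PE x Px.
  have /choice[y yP] := fun i => IH (v i) (vP i).
  exists (\sum_i a i *: y i); split.
    by rewrite linear_sum; apply: eq_bigr => i _; rewrite linearZ/= (yP i).1.
  rewrite expnS; apply: low_sum => i; apply: low_scale => //.
  exact: (yP i).2.
move=> x Px; have [y yx] := p_epi x.
have y0 d j : nf y d j = 0.
  have [z [zx zl]] := lowP (wgt m d j) x Px.
  have -> : y = germ_cst zeta 1 *: (y - z) + z by rewrite (scale1r (y - z)) subrK.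
  rewrite nf_lin nfK ?mulr0 ?add0r; last by rewrite /K linearB/= yx zx subrr.
  by apply: (nf_low z _ zl); rewrite ltn_expl.
have [a [G [yE GE _]]] := nfE y.
have G0 : G = 0 by apply: cf_inj => d j; rewrite GE y0 cf0.
rewrite -yx yE G0 addr0 linear_sum big1// => i _.
by rewrite linearZ/= KH scaler0.
Qed.

End KrullIntersection.

Section AutomaticContinuity.
Variables (R : realType) (m n : nat) (zeta : 'rV[(R[i] : numFieldType)]_m).
Local Notation C := R[i].
Local Notation O := (germ zeta (R[i]^o : normedModType R[i])).
Local Notation W := ('rV[(R[i] : numFieldType)]_n : normedModType R[i]).
Local Notation GW := (germ zeta W).
Variables (M : lmodType O) (p : {linear GW -> M}).
Hypothesis p_epi : forall y : M, exists x, p x = y.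

Lemma growth_le (a : O) (A : R) t t' : 0 <= A -> (t <= t')%N -> growth (tau a) A t ->
  growth (tau a) A t'.
Proof.
move=> A0 tt aA d; have [sd|nd] := boolP (smooth m d); last first.
  by rewrite tau_supp// nm0 mulr_ge0 ?exprn_ge0.
apply: (le_trans (aA d)); rewrite ler_wpM2l// ler_weXn2l// ler1n.
exact: smooth_gt0 sd.
Qed.

Lemma bounded_by_exp (F : GW) (B : R) t t' : 0 <= B -> (t <= t')%N ->
  bounded_by m (cf F) B t -> bounded_by m (cf F) B t'.
Proof. by move=> B0 tt FB; exact: bounded_by_le B0 (lexx _) tt (@cf_supp _ _ _ _ F) FB. Qed.

Variable lam : GW -> C.
Hypothesis lam_lin : forall v F G, lam (germ_cst zeta v *: F + G) = v * lam F + lam G.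
Hypothesis lam_ker : forall F, p F = 0 -> lam F = 0.
Variables (s : nat) (b : nat -> R).
Hypothesis lam_bounded : forall t B F, (s <= t)%N -> 0 <= B ->
  bounded_by m (cf F) B t -> nm (lam F) <= b t * B.

Lemma lam_eq F G : p F = p G -> lam F = lam G.
Proof.
move=> FG; have -> : F = germ_cst zeta 1 *: (F - G) + G by rewrite (scale1r (F - G)) subrK.
by rewrite lam_lin lam_ker ?mulr0 ?add0r// linearB/= FG subrr.
Qed.

(* The bound comes from division by the submodule [p^-1 (T M)], whose generators *)
(* are [T]-multiples modulo the kernel of [p].                                   *)
Lemma cancel_bound (T : O) (F0 : GW) k : nonzerodivisor_on M T ->
  exists D, forall y z, bounded_by m (cf y) k%:R k -> p (y - F0) = T *: p z ->
    nm (lam z) <= D.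
Proof.
move=> Tnz; pose K F := exists z, p F = T *: p z.
have [||a F [z pF]|nf [l [H [s0 [c [KH c0 _ [nfK _] nfE]]]]]] := @submodule_division R m n zeta K.
- by exists 0; rewrite !linear0.
- by move=> F G [z pF] [z' pG]; exists (z + z'); rewrite !linearD/= pF pG.
- by exists (a *: z); rewrite !linearZ/= pF !scalerA mulrC.
have /choice[g gP] := KH.
have [B0 [t0 [B00 F0B]]] := cf_bounded F0.
have /choice[Bt BtP] : forall i, exists Bt : R * nat, 0 <= Bt.1 /\ bounded_by m (cf (g i)) Bt.1 Bt.2.
  by move=> i; have [B [t h]] := cf_bounded (g i); exists (B, t).
(* t suffices for dividing y - F0, and t' also for the generators g_i and for [lam]; the products
   a_i g_i cost one more. *)
pose t := (s0 + t0 + k)%N; pose t' := (t + \sum_i (Bt i).2 + s)%N.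
have tg i : ((Bt i).2 <= t')%N by rewrite /t' (bigD1 i)//=; lia.
pose A := c t * (k%:R + B0).
have A0 : 0 <= A by rewrite mulr_ge0// addr_ge0.
exists (b t'.+1 * (\sum_i A * (Bt i).1)) => y z yB pyz.
have yFB : bounded_by m (cf (y - F0)) (k%:R + B0) t.
  apply: bounded_byB; apply: bounded_by_exp; [exact: ler0n|exact: leq_addl|exact: yB|
    exact: B00| |exact: F0B].
  by rewrite /t; lia.
have [a [G [yE GE /(_ t _ _ _ yFB)[||_ aA]]]] := nfE (y - F0).
- by rewrite /t; lia.
- by rewrite addr_ge0.
have G0 : G = 0.
  by apply: cf_inj => d j; rewrite GE cf0; apply: nfK; exists z.
have -> : lam z = lam (\sum_i a i *: g i).
  (* T times p z and T times the image of the combination of the g_i coincide, and T can be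
     cancelled on M. *)
  apply: lam_eq; apply/eqP; rewrite -subr_eq0; apply/eqP; apply: Tnz.
  rewrite scalerBr -pyz yE G0 addr0 !(linear_sum p) scaler_sumr.
  rewrite (eq_bigr (fun i => T *: p (a i *: g i))) ?subrr// => i _.
  by rewrite !linearZ/= gP !scalerA mulrC.
apply: lam_bounded; first by rewrite /t'; lia.
  by apply: sumr_ge0 => i _; rewrite mulr_ge0//; exact: (BtP i).1.
apply: bounded_by_sum => i; apply: bounded_byZ => //; first exact: (BtP i).1.
  by apply: growth_le (aA i) => //; rewrite /t'; lia.
by apply: bounded_by_exp (BtP i).2 => //; exact: (BtP i).1.
Qed.

Variables (r : O) (N : nat).
Hypothesis r0 : germ_val r = 0.
Hypothesis r_nz : nonzerodivisor_on M r.
Hypothesis lam_r : forall F, lam (r ^+ N *: F) = 0.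
Variables (E : normedModType C) (phi : {linear germ zeta E -> M}) (lift : E -> GW).
Hypothesis complE : ncomplete E.
Hypothesis liftP : forall e, p (lift e) = phi (gcst zeta e).

Lemma lam_lift_lin v e e' : lam (lift (v *: e + e')) = v * lam (lift e) + lam (lift e').
Proof.
rewrite -lam_lin; apply: lam_eq.
by rewrite linearD linearZ/= !liftP gcst_lin linearD linearZ.
Qed.

(* Gliding hump: otherwise there is a power series [f] in [r ^+ N] with          *)
(* coefficients in [E] such that [phi f] violates every [cancel_bound].          *)
Lemma lam_lift_bounded : exists c : R, forall e, nm (lam (lift e)) <= c * nm e.
Proof.
apply: contrapT => hn.
have lift0 : lam (lift 0) = 0.
  have := lam_lift_lin 1 0 0; rewrite scaler0 addr0 mul1r => h.
  by apply: (@addrI _ (lam (lift 0))); rewrite addr0.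
have unb (c : R) : exists e, nm e <= 1 /\ c < nm (lam (lift e)).
  apply: contrapT => h; apply: hn; exists c => e.
  have [->|e0] := eqVneq e 0; first by rewrite lift0 !nm0 mulr0.
  have {}e0 : 0 < nm e by rewrite lt_neqAle eq_sym nm_eq0 e0 nm_ge0.
  rewrite leNgt; apply/negP => ce; apply: h; exists ((nm e)^-1%:C%C *: e + 0).
  rewrite lam_lift_lin lift0 !addr0 nmZ nmM nm_real gtr0_norm ?invr_gt0// mulVf ?gt_eqF//.
  by rewrite lexx ltr_pdivlMl// mulrC.
pose S := r ^+ N.
have nz l : nonzerodivisor_on M (r ^+ l).
  elim: l => [|l IH] x; first by rewrite expr0 scale1r.
  by rewrite exprSr -scalerA => /IH/r_nz.
have nzS l : nonzerodivisor_on M (S ^+ l) by rewrite /S -exprM; exact: nz.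
have N0 : (0 < N)%N.
  rewrite lt0n; apply/eqP => N0; have [e [_]] := unb 0.
  by have := lam_r (lift e); rewrite N0 expr0 scale1r => ->; rewrite nm0 ltxx.
have S0 : germ_val S = 0.
  by rewrite /S -(prednK N0) exprS (germ_valZ r) r0 scale0r.
(* Given k and the partial sum F, the next coefficient beats the constant of [cancel_bound] for all
   y of growth k. *)
have /choice[hump humpP] : forall kF : nat * GW, exists e, nm e <= 1 /\
    forall y z, bounded_by m (cf y) kF.1%:R kF.1 -> p (y - kF.2) = S ^+ kF.1 *: p z ->
    nm (lam z) < nm (lam (lift e)).
  move=> [k F] /=; have [D DP] := cancel_bound F k (nzS k).
  have [e [e1 De]] := unb D; exists e; split=> // y z yk yz.
  exact: le_lt_trans (DP y z yk yz) De.
pose F := fix F k : GW := if k is k'.+1 then F k' + S ^+ k' *: lift (hump (k', F k')) else 0.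
pose e k := hump (k, F k).
have FS k : F k.+1 = F k + S ^+ k *: lift (e k) by [].
have [f fE] := germ_series complE S0 (fun k => (humpP (k, F k)).1).
have [y0 y0P] := p_epi (phi (f 0%N)).
have /choice[z zP] := fun k => p_epi (phi (f k)).
(* The image under phi of f_0 = sum_(l < k) S^l e_l + S^k f_k. *)
have pF k : p y0 = p (F k) + S ^+ k *: p (z k).
  elim: k => [|k IH]; first by rewrite linear0 add0r expr0 scale1r y0P zP.
  rewrite IH FS linearD linearZ/= -addrA; congr (_ + _).
  rewrite zP fE linearD linearZ/= scalerDr exprSr -scalerA zP liftP//.
have lamz k : lam (z k) = lam (lift (e k)).
  have -> : lam (z k) = lam (germ_cst zeta 1 *: (S *: z k.+1) + lift (e k)).
    apply: lam_eq; rewrite (scale1r (S *: z k.+1)) linearD linearZ/= !zP liftP.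
    by rewrite {1}fE linearD linearZ/= addrC.
  by rewrite lam_lin lam_r mulr0 add0r.
have [B [t [B0 yB]]] := cf_bounded y0.
(* From this k on, the single lift y0 of phi f_0 obeys the growth bound against which e_k was
   chosen. *)
pose k := (t + (Num.truncn B).+1)%N.
have := (humpP (k, F k)).2 y0 (z k).
rewrite /= lamz ltxx => h; suff : false by []; apply: h.
  apply: bounded_by_le B0 _ _ (@cf_supp _ _ _ _ y0) yB; last exact: leq_addr.
  apply: (le_trans (ltW (real_truncnS_gt (num_real B)))); rewrite ler_nat.
  exact: leq_addl.
by rewrite linearB/= (pF k) addrAC subrr add0r.
Qed.

End AutomaticContinuity.

(** * Extension from constant germs and factorization *)

Section GermExtension.
Variables (R : realType) (m : nat) (zeta : 'rV[(R[i] : numFieldType)]_m).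
Local Notation C := R[i].
Local Notation V := 'rV[(R[i] : numFieldType)]_m.
Local Notation O := (germ zeta (R[i]^o : normedModType R[i])).

Lemma near_polydisc (P : V -> Prop) : (\forall y \near zeta, P y) ->
  exists s, forall x, polydisc s x -> P (zeta + x).
Proof.
move=> /nm_nearP[e e0 eP].
have [s sP] := half_pow_le ler01 (divr_gt0 e0 (ltr0n R 2)); exists s => x xs.
apply: eP; rewrite addrAC subrr add0r (le_lt_trans (nm_polydisc xs))//.
rewrite -[2 ^- s]mul1r (le_lt_trans sP)//.
by rewrite ltr_pdivrMr// ltr_pMr// ltr1n.
Qed.

Lemma polydisc_near (P : V -> Prop) s : (forall x, polydisc s x -> P (zeta + x)) ->
  \forall y \near zeta, P y.
Proof.
move=> sP; apply/nm_nearP; exists ((nprime m)%:R ^- s).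
  by rewrite invr_gt0 natr_exp_gt0// nprime_gt0.
move=> y ys; have -> : y = zeta + (y - zeta) by zmod.
by apply: sP; apply: polydisc_small; exact: ltW.
Qed.

Lemma ncvg_div (W : normedZmodType C) (u : nat -> W) l (A : R) :
  (forall N, (0 < N)%N -> nm (l - u N) <= A / N%:R) -> ncvg u l.
Proof.
move=> uA e e0; exists (Num.truncn (A / e)).+1 => N tN.
have N0 : (0 < N)%N by exact: leq_trans tN.
rewrite nmBC (le_trans (uA N N0))// ler_pdivrMr ?ltr0n//.
have : A / e <= N%:R.
  by apply: (le_trans (ltW (real_truncnS_gt (num_real _)))); rewrite ler_nat.
by rewrite ler_pdivrMr// mulrC.
Qed.

Variables (E W : normedModType C) (L : nat -> E -> W) (A : R) (s : nat).
Hypothesis complW : ncomplete W.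
Hypothesis L_lin : forall d, linear (L d).
Hypothesis L_bound : forall d e, nm (L d e) <= A * nm e * d%:R ^+ s.

Let bohr_sum (f : germ zeta E) (x : V) N := \sum_(1 <= d < N) chi x d *: L d (rp f (zeta + x)).

(** psi is first a relation, convergence of the series on some polydisc. Existence and uniqueness
    make it a map, and linearity is then inherited from limits. *)
Let extends (f : germ zeta E) (P : germ zeta W) :=
  exists t, forall x, polydisc t x -> ncvg (bohr_sum f x) (rp P (zeta + x)).

Let extends_inj f P Q : extends f P -> extends f Q -> P = Q.
Proof.
move=> [t tP] [t' tQ]; apply/germ_eqP; apply: (@polydisc_near _ (maxn t t')) => x xt.
apply: (ncvg_unique (tP x _) (tQ x _)); apply: polydisc_le xt; first exact: leq_maxl.
exact: leq_maxr.
Qed.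

Let extends_lin (a : O) f g P Q : extends f P -> extends g Q ->
  extends (a *: f + g) (a *: P + Q).
Proof.
move=> [t1 h1] [t2 h2].
have [t3 h3] := near_polydisc (rpD (a *: f) g); have [t4 h4] := near_polydisc (rpZ a f).
have [t5 h5] := near_polydisc (rpD (a *: P) Q); have [t6 h6] := near_polydisc (rpZ a P).
exists (t1 + t2 + t3 + t4 + t5 + t6)%N => x xt.
have sub t : (t <= t1 + t2 + t3 + t4 + t5 + t6)%N -> polydisc t x.
  by move=> tt; exact: polydisc_le xt.
rewrite h5 ?h6; try by apply: sub; lia.
have -> : bohr_sum (a *: f + g) x = fun N => rp a (zeta + x) *: bohr_sum f x N + bohr_sum g x N.
  apply/funext => N; rewrite /bohr_sum h3 ?h4; try by apply: sub; lia.
  rewrite scaler_sumr -big_split/=; apply: eq_bigr => d _.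
  by rewrite L_lin scalerDr !scalerA mulrC.
by apply: ncvg_lin; [apply: h1|apply: h2]; apply: sub; lia.
Qed.

Let L_differentiable d e : differentiable (L d) e.
Proof.
have [] := @approx_dd R E W (L d) e (L d) (L_lin d); first by exists (A * d%:R ^+ s) => h; rewrite mulrAC.
  move=> v v0; exists 1 => // h _; have := L_lin d 1 e h; rewrite !scale1r => ->.
  by rewrite -addrA -opprD subrr nm0 mulr_ge0 ?nm_ge0// ltW.
by [].
Qed.

Let extends_ex f : exists P, extends f P.
Proof.
have [r [M [r0 hM]]] := holomorphic_holb (rp_hol f).
have M0 := holb_ge0 r0 hM.
have hu d y : nm (y - zeta) < r -> differentiable (fun y => L d (rp f y)) y /\
    nm (L d (rp f y)) <= `|A| * M * d%:R ^+ s.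
  move=> /hM[df fM]; split.
    exact: (@differentiable_comp _ _ _ _ (rp f) (L d)).
  apply: (le_trans (L_bound _ _)); rewrite ler_wpM2r ?exprn_ge0//.
  by rewrite (le_trans (ler_wpM2r (nm_ge0 _) (ler_norm A)))// ler_wpM2l.
have AM : 0 <= `|A| * M by rewrite mulr_ge0.
have [F [hF [t tF]]] := bohr_series complW r0 AM hu.
exists (germ_of hF); have [t' tt'] := near_polydisc (rp_of hF).
exists (t + 1 + t')%N => x xt; rewrite tt'; last by apply: polydisc_le xt; exact: leq_addl.
apply: (@ncvg_div _ _ _ (2 * (`|A| * M))) => N N0.
by have := tF 1%N x N (polydisc_le (leq_addr _ _) xt) N0; rewrite expr1.
Qed.

(** The operators act pointwise on values of f, so a scalar germ can be pulled out of each term: the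
    map is linear over germs, not just over constants. *)
Lemma germ_extension : exists psi : {linear germ zeta E -> germ zeta W},
  forall e P, tau P = (fun d => L d e) -> psi (gcst zeta e) = P.
Proof.
have [psi psiP] := choice extends_ex.
have psi_lin : linear psi.
  by move=> a f g; apply: (extends_inj (psiP _)); exact: extends_lin.
pose psiL : {linear germ zeta E -> germ zeta W} :=
  HB.pack psi (GRing.isLinear.Build _ _ _ _ psi psi_lin).
exists psiL => e P tP /=.
apply: (extends_inj (psiP _)).
have [B [t]] := tau_expands complW P; rewrite tP => PB.
have [t' tt'] := near_polydisc (rp_cst zeta e).
exists (t + 1 + t')%N => x xt.
apply: (@ncvg_div _ _ _ B) => N N0.
rewrite /bohr_sum tt'; last by apply: polydisc_le xt; exact: leq_addl.
by have := PB 1%N x N (polydisc_le (leq_addr _ _) xt) N0; rewrite expr1.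
Qed.

End GermExtension.

Theorem theorem1p3 (R : realType) (m : nat) (zeta : 'rV[R[i]]_m)
    (M : lmodType (germ zeta R[i]^o))
    (M_fg : finitely_generated M)
    (M_depth : depth_gt0 (maxideal zeta) M)
    (n : nat) (p : {linear germ zeta 'rV[R[i]]_n -> M})
    (p_epi : forall y : M, exists x, p x = y)
    (E : completeNormedModType R[i])
    (phi : {linear germ zeta E -> M}) :
  exists psi : {linear germ zeta E -> germ zeta 'rV[R[i]]_n},
    forall f : germ zeta E, phi f = p (psi f).
Proof.
have complE := @completeNormedMod_ncomplete R E.
have krull := @maxideal_stable_eq0 R m n zeta M p p_epi.
case: M_depth => [mM|[r [r0 r_nz _]]].
  (* Here M = mM forces M = 0. *)
  exists (GRing.null_fun _ : {linear germ zeta E -> germ zeta 'rV[R[i]]_n}) => f.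
  have h : forall x : M, True -> x = 0.
    apply: krull => x _; have : ideal_smul (maxideal zeta) (M:=M) x by rewrite mM.
    by move=> [k [a [v [aI ->]]]]; exists k, a, v.
  by rewrite (h (phi f))// (h (p _)).
have [|F G pF pG|a F pF|nf [k [H [s0 [c [KH _ nf_lin [nfK nf_low] nfE]]]]]] :=
  @submodule_division R m n zeta (fun F => p F = 0).
- exact: linear0.
- by rewrite linearD pF pG addr0.
- by rewrite linearZ/= pF scaler0.
have nf_supp F : fsupp m (nf F).
  by move=> d j nd; have [_ [G [_ <- _]]] := nfE F; exact: cf_supp.
have nf_bound t B F d j : (s0 <= t)%N -> 0 <= B -> bounded_by m (cf F) B t ->
    nm (nf F d j) <= 2 * (wgt m d j)%:R ^+ t * B.
  move=> st B0 FB; have [a [G [_ _ aG]]] := nfE F.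
  by rewrite mulrAC; have [] := aG t B st B0 FB.
have /choice[lift liftP] := fun e => p_epi (phi (gcst zeta e)).
(* With N the weight of (d, j), r^N times any vector has order at least 2^N > N, so this coefficient
   of its normal form vanishes. *)
have bounded d j : exists c : R, forall e, nm (nf (lift e) d j) <= c * nm e.
  apply: (@lam_lift_bounded R m n zeta M p p_epi (fun F => nf F d j) _ _
    s0 (fun t => 2 * (wgt m d j)%:R ^+ t) _ r (wgt m d j) r0 r_nz _ E phi lift complE liftP).
  - by move=> v F G; exact: nf_lin.
  - by move=> F /nfK.
  - by move=> t B F st B0 FB; exact: nf_bound.
  - move=> F; have rF := @low_exp R m n zeta (wgt m d j) r F r0.
    by apply: (nf_low _ _ rF); rewrite ltn_expl.
have mu_lin d j v e e' : nf (lift (v *: e + e')) d j =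
    v * nf (lift e) d j + nf (lift e') d j.
  apply: (@lam_lift_lin R m n zeta M p (fun F => nf F d j)) => //.
  by move=> F /nfK.
(* The indices are pairs (d, j). Each fixed lift has polynomial growth, hence is eventually below t
   w^t as t grows. *)
have [t [A tA]] : exists t A, forall e i,
    nm (nf (lift e) i.1 i.2) <= A * nm e * (t%:R * (wgt m i.1 i.2)%:R ^+ t).
  apply: (@uniform_bound R E (nat * 'I_n)%type complE (fun e i => nf (lift e) i.1 i.2)
    (fun t i => t%:R * (wgt m i.1 i.2)%:R ^+ t)).
  - by move=> v e e' i; exact: mu_lin.
  - by move=> i; exact: bounded.
  move=> e; have [B [t [B0 eB]]] := cf_bounded (lift e).
  pose t' := (s0 + t)%N; exists (t' + (Num.truncn (2 * B)).+1)%N => t1 i tt.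
  have [a [G [_ _ /(_ t' B (leq_addr _ _) B0)]]] := nfE (lift e).
  move=> [|nB _]; first by apply: bounded_by_exp eB => //; exact: leq_addl.
  apply: (bounded_by_le _ _ _ (nf_supp _) nB); first by rewrite mulr_ge0.
    apply: (le_trans (ltW (real_truncnS_gt (num_real _)))); rewrite ler_nat.
    exact: leq_trans (leq_addl _ _) tt.
  exact: leq_trans (leq_addr _ _) tt.
pose L d e : 'rV[(R[i] : numFieldType)]_n := \row_j nf (lift e) d j.
have L_lin d : linear (L d).
  by move=> v e e'; apply/rowP => j; rewrite !mxE mu_lin.
pose Q := nprime (m + n).
have L_bound d e : nm (L d e) <= (`|A| * (t%:R * Q%:R ^+ t)) * nm e * d%:R ^+ t.
  apply: nm_mx_le => [|i j]; first by rewrite !mulr_ge0 ?exprn_ge0 ?nm_ge0.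
  rewrite mxE; apply: (le_trans (tA e (d, j))) => /=.
  apply: (@le_trans _ _ (`|A| * nm e * (t%:R * (wgt m d j)%:R ^+ t))).
    by rewrite ler_wpM2r ?mulr_ge0 ?exprn_ge0// ler_wpM2r ?nm_ge0// ler_norm.
  have -> : `|A| * (t%:R * Q%:R ^+ t) * nm e * d%:R ^+ t =
    `|A| * nm e * (t%:R * (Q%:R ^+ t * d%:R ^+ t)) by ring.
  rewrite ler_wpM2l ?mulr_ge0 ?nm_ge0// ler_wpM2l//.
  rewrite -exprMn -natrM lerXn2r ?nnegrE ?ler0n// ler_nat /wgt mulnC leq_mul2r.
  by rewrite nprime_mono leq_add2l ltnW ?orbT.
have [psi psiP] := @germ_extension R m zeta E
  ('rV[(R[i] : numFieldType)]_n : normedModType R[i]) L _ _ (@rV_ncomplete R 1 n) L_lin L_bound.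
exists psi => f; apply/eqP; rewrite -subr_eq0; apply/eqP.
(* L_d(e) are the coefficients of the remainder G of [lift e], which differs from [lift e] by an
   element of the kernel of [p]. *)
have cst0 e : phi (gcst zeta e) = p (psi (gcst zeta e)).
  have [a [G [eE GE _]]] := nfE (lift e).
  rewrite (psiP e G); last first.
    by apply/funext => d; apply/rowP => j; rewrite mxE -GE.
  rewrite -liftP eE linearD linear_sum big1 ?add0r// => i _.
  by rewrite linearZ/= KH scaler0.
(* The image of phi - p psi: constants are killed, so Hadamard's lemma expresses each element
   through coordinate multiples of elements of the same kind. *)
apply: (krull (fun x => exists f, x = phi f - p (psi f))); last by exists f.
move=> x [g ->]; have [g' gE] := germ_hadamard complE g.
exists m, (@germ_coord R m zeta), (fun i => phi (g' i) - p (psi (g' i))); split.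
- by move=> i; exact: germ_val_coord.
- by move=> i; exists (g' i).
rewrite {1 2}gE !linearD/= -/(gcst zeta _) cst0 addrACA subrr add0r.
rewrite (linear_sum phi) (linear_sum psi) (linear_sum p) -sumrB; apply: eq_bigr => i _.
by rewrite scalerBr -!linearZ.
Qed.
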